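(* Let $M$ be a manifold with an order $r$ weighting along a closed submanifold $N\subseteq M$, and let $Q\subseteq T_rM$ be the graded subbundle associated to the weighting. Then the weighted normal bundle is canonically the quotient $$\nu_{\mathcal W}(M,N)=Q/\!\sim$$ under the equivalence relation $$q_1\sim q_2\iff f^{(i)}(q_1)=f^{(i)}(q_2)\ \text{ for all } f\in C^\infty(M)_{(i)},\ 0\le i\le r.$$
   Context: Weightings. A weight sequence of order $r$ is a sequence of integers $0\le w_1\le\dots\le w_n\le r$; put $k_i=\#\{a:w_a\le i\}$. For a chart $U$ with coordinates $x_1,\dots,x_n$, let $C^\infty(U)_{(i)}$ be the ideal generated by monomials $x^s=x_1^{s_1}\cdots x_n^{s_n}$ with $\sum_a s_aw_a\ge i$. An order $r$ weighting on an $n$-dimensional manifold $M$ is a filtration $C^\infty_M=C^\infty_{M,(0)}\supseteq C^\infty_{M,(1)}\supseteq\cdots$ of the structure sheaf by ideal sheaves such that every point has an open neighborhood $U$ with coordinates $x_a$ in which the filtration of $C^\infty(U)$ is given by this local model for a weight sequence of order $r$ (which may depend on the connected component of $N$). $C^\infty_{M,(1)}$ is the vanishing ideal of a closed submanifold $N$, and one speaks of a weighting along $N$. Global sections are denoted $C^\infty(M)_{(i)}$. Weighted normal bundle. $\mathrm{gr}(C^\infty(M))=\bigoplus_{i\ge0}C^\infty(M)_{(i)}/C^\infty(M)_{(i+1)}$, and $\nu_{\mathcal W}(M,N)=\mathrm{Hom}_{\mathrm{alg}}(\mathrm{gr}(C^\infty(M)),\mathbb{R})$. It is a graded bundle over $N$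 (a manifold with a smooth action of the multiplicative monoid $(\mathbb{R},\cdot)$, with base the image of multiplication by $0$) whose algebra of polynomial functions (sums of homogeneous functions) is $\mathrm{gr}(C^\infty(M))$. Higher tangent bundle. Let $\mathbb{A}_r=\mathbb{R}[\epsilon]/(\epsilon^{r+1})$ and $T_rM=\mathrm{Hom}_{\mathrm{alg}}(C^\infty(M),\mathbb{A}_r)$ (equivalently $r$-jets at $0$ of curves), with elements $\mathsf{u}=\sum_{i=0}^r\mathsf{u}_i\epsilon^i$ and $(\mathbb{R},\cdot)$-action $\kappa_t(\sum\mathsf{u}_j\epsilon^j)=\sum t^j\mathsf{u}_j\epsilon^j$. For $f\in C^\infty(M)$ and $0\le i\le r$, $f^{(i)}\in C^\infty(T_rM)$ is $f^{(i)}(\mathsf{u})=\mathsf{u}_i(f)$. The graded subbundle (i.e. $(\mathbb{R},\cdot)$-invariant submanifold) associated to the weighting is $$Q=\{\mathsf{u}\in T_rM\mid\forall f\in C^\infty(M)_{(i)},\ j<i\le r\Rightarrow f^{(j)}(\mathsf{u})=0\}.$$ Restriction of lifts to $Q$ gives a graded algebra morphism $\mathrm{gr}(C^\infty(M))\to C^\infty_{\mathrm{pol}}(Q)$, determined by $f\bmod C^\infty(M)_{(i+1)}\mapsto f^{(i)}|_Q$ for $f\in C^\infty(M)_{(i)}$, $0\le i\le r$; the canonical map $Q\to\nu_{\mathcal W}(M,N)$ is the dual map of character spectra. *)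

(* Defs.v *)
From HB Require Import structures.
From mathcomp Require Import all_boot all_order all_algebra.
From mathcomp Require Import qpoly generic_quotient ring_quotient.
From mathcomp Require Import all_classical all_reals all_analysis.

Set Implicit Arguments.
Unset Strict Implicit.
Unset Printing Implicit Defensive.

Import Order.TTheory GRing.Theory Num.Theory.
Import numFieldNormedType.Exports.
Import Pdiv.CommonRing Pdiv.RingMonic.
Local Open Scope classical_set_scope.
Local Open Scope ring_scope.

Section SmoothEuclidean.
Context {R : realType} {n : nat}.
Implicit Types (U : set 'rV[R]_n) (f g : 'rV[R]_n -> R).

Definition partial (j : 'I_n) f : 'rV[R]_n -> R :=
  fun x => 'D_(delta_mx 0 j) f x.

(* meant for U open *)
Fixpoint Ck (k : nat) U f : Prop :=
  {in U, continuous f} /\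
  if k is k'.+1 then
    forall j, {in U, forall x, derivable f x (delta_mx 0 j)} /\
              Ck k' U (partial j f)
  else True.

Definition Cinf U f := forall k, Ck k U f.

Lemma near_open U f g x : open U -> {in U, f =1 g} -> x \in U ->
  {near x, f =1 g}.
Proof.
move=> oU fg; rewrite inE => Ux; near=> y; apply: fg; rewrite inE.
by near: y; exact: open_nbhs_nbhs.
Unshelve. all: by end_near. Qed.

Lemma eq_partial U f g j : open U -> {in U, f =1 g} ->
  {in U, partial j f =1 partial j g}.
Proof. by move=> oU fg x Ux; apply: near_eq_derive; exact: near_open fg Ux. Qed.

Lemma eq_continuous_on U f g : open U -> {in U, f =1 g} ->
  {in U, continuous f} -> {in U, continuous g}.
Proof.
move=> oU fg cf x Ux; have := cf x Ux; rewrite /continuous_at (fg x Ux).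
apply: cvg_trans; apply: (@near_eq_cvg _ _ (nbhs x)).
exact: near_open fg Ux.
Qed.

Lemma Ck_ext k U f g : open U -> {in U, f =1 g} -> Ck k U f -> Ck k U g.
Proof.
move=> oU; elim: k f g => [|k IH] f g fg [cf df];
  (split; first exact: eq_continuous_on cf) => // j.
have [dj cj] := df j; split.
  by move=> x Ux; apply: near_eq_derivable (dj _ Ux); exact: near_open fg Ux.
by apply: IH cj; exact: eq_partial.
Qed.

Lemma Ck_le k U f : Ck k.+1 U f -> Ck k U f.
Proof.
elim: k f => [|k IH] f [cf df]; first by split.
by split=> // j; have [dj cj] := df j; split=> //; exact: IH.
Qed.

Lemma Ck_cst k U (c : R) : open U -> Ck k U (cst c).
Proof.
move=> oU; have cc (a : R) : {in U, continuous (cst a : 'rV[R]_n -> R)}.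
  by move=> x _; exact: cst_continuous.
elim: k c => [|k IH] c; split; do ?[exact: cc]; move=> // j; split;
  first by move=> x _; exact: derivable_cst.
by apply: Ck_ext (IH 0) => // x Ux; rewrite /partial derive_cst.
Qed.

Lemma CkD k U f g : open U -> Ck k U f -> Ck k U g -> Ck k U (f + g).
Proof.
move=> oU; elim: k f g => [|k IH] f g [cf df] [cg dg].
  by split=> // x Ux; exact: continuousD (cf _ Ux) (cg _ Ux).
split; first by move=> x Ux; exact: continuousD (cf _ Ux) (cg _ Ux).
move=> j; have [dfj cfj] := df j; have [dgj cgj] := dg j; split.
  by move=> x Ux; apply: derivableD; [exact: dfj|exact: dgj].
apply: Ck_ext (IH _ _ cfj cgj) => // x Ux.
by rewrite /partial deriveD //; [exact: dfj|exact: dgj].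
Qed.

Lemma CkM k U f g : open U -> Ck k U f -> Ck k U g -> Ck k U (f * g).
Proof.
move=> oU; elim: k f g => [|k IH] f g Cf Cg; have [cf df] := Cf;
  have [cg dg] := Cg.
  by split=> // x Ux; exact: continuousM (cf _ Ux) (cg _ Ux).
split; first by move=> x Ux; exact: continuousM (cf _ Ux) (cg _ Ux).
move=> j; have [dfj cfj] := df j; have [dgj cgj] := dg j; split.
  by move=> x Ux; apply: derivableM; [exact: dfj|exact: dgj].
apply: (@Ck_ext _ _ (f * partial j g + g * partial j f)) => //.
  move=> x Ux; rewrite /partial deriveM //; [exact: dfj|exact: dgj].
by apply: CkD => //; apply: IH => //; exact: Ck_le.
Qed.

Lemma Cinf_cst U c : open U -> Cinf U (cst c).
Proof. by move=> oU k; exact: Ck_cst. Qed.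

Lemma CinfD U f g : open U -> Cinf U f -> Cinf U g -> Cinf U (f + g).
Proof. by move=> oU Cf Cg k; exact: CkD. Qed.

Lemma CinfM U f g : open U -> Cinf U f -> Cinf U g -> Cinf U (f * g).
Proof. by move=> oU Cf Cg k; exact: CkM. Qed.

End SmoothEuclidean.

(* icoord is only meaningful on coord @` dom. *)
Record chart (R : realType) (M : topologicalType) (n : nat) := Chart {
  dom : set M;
  coord : M -> 'rV[R]_n;
  icoord : 'rV[R]_n -> M;
  dom_open : open dom;
  codom_open : open (coord @` dom);
  coordK : {in dom, cancel coord icoord};
  coord_continuous : {in dom, continuous coord};
  icoord_continuous : {in coord @` dom, continuous icoord} }.

Definition compatible R M n (c d : @chart R M n) : Prop :=
  forall j, Cinf (coord c @` (dom c `&` dom d))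
                 (fun y => coord d (icoord c y) 0 j).

Record manifold (R : realType) (n : nat) := Manifold {
  space :> topologicalType;
  atlas : set (chart R space n);
  manifold_hausdorff : hausdorff_space space;
  manifold_second_countable : @second_countable space;
  atlas_cover : forall p, exists2 c, atlas c & dom c p;
  atlas_compatible : forall c d, atlas c -> atlas d -> compatible c d }.

Section ManifoldFunctions.
Context {R : realType} {n : nat} (M : manifold R n).
Implicit Types (U V : set M) (f g : M -> R) (c d : chart R M n).

(* c belongs to the maximal atlas of M *)
Definition coord_chart c : Prop :=
  forall d, atlas d -> compatible c d /\ compatible d c.

Definition smooth_on U f : Prop :=
  forall c, atlas c -> Cinf (coord c @` (U `&` dom c)) (f \o icoord c).

Lemma open_coord_image c U : open U -> open (coord c @` (U `&` dom c)).
Proof.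
move=> oU.
have -> : coord c @` (U `&` dom c) = coord c @` dom c `&` (icoord c @^-1` U).
  apply/seteqP; split=> [_ [p [Up dp] <-]|_ [[p dp <-]]] /=.
    by split; [exists p|rewrite coordK ?inE].
  by rewrite coordK ?inE // => Up; exists p.
rewrite openE => y [dy Uy]; apply: filterI.
  by apply: open_nbhs_nbhs; split; [exact: codom_open|].
by apply: icoord_continuous; [rewrite inE|exact: open_nbhs_nbhs].
Qed.

Lemma smooth_on_cst U (a : R) : open U -> smooth_on U (cst a).
Proof. by move=> oU c _; apply: Cinf_cst; exact: open_coord_image. Qed.

Lemma smooth_onD U f g : open U -> smooth_on U f -> smooth_on U g ->
  smooth_on U (f + g).
Proof.
by move=> oU sf sg c ac; apply: CinfD (sf _ ac) (sg _ ac);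
  exact: open_coord_image.
Qed.

Lemma smooth_onM U f g : open U -> smooth_on U f -> smooth_on U g ->
  smooth_on U (f * g).
Proof.
by move=> oU sf sg c ac; apply: CinfM (sf _ ac) (sg _ ac);
  exact: open_coord_image.
Qed.

Lemma smooth_onZ U (a : R) f : open U -> smooth_on U f -> smooth_on U (a *: f).
Proof. by move=> oU; exact: smooth_onM (smooth_on_cst a oU). Qed.

End ManifoldFunctions.

(* A commutative algebra over K, as a ring under K.  MathComp's algType excludes
   the zero ring, whereas C^oo(M) and gr(C^oo(M)) vanish when M, resp. N, is
   empty. *)
Record comAlg (K : comNzRingType) := ComAlg {
  alg_ring :> comPzRingType;
  alg_unit : {rmorphism K -> alg_ring} }.

Record alg_hom (K : comNzRingType) (A B : comAlg K) := AlgHom {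
  alg_hom_fun :> A -> B;
  alg_hom_additive : zmod_morphism alg_hom_fun;
  alg_hom_monoid : monoid_morphism alg_hom_fun;
  alg_hom_unit : forall a, alg_hom_fun (alg_unit A a) = alg_unit B a }.

HB.instance Definition _ K (A B : comAlg K) (u : alg_hom A B) :=
  GRing.isZmodMorphism.Build A B u (alg_hom_additive u).
HB.instance Definition _ K (A B : comAlg K) (u : alg_hom A B) :=
  GRing.isMonoidMorphism.Build A B u (alg_hom_monoid u).

Section AlgHomComp.
Context {K : comNzRingType} {A B C : comAlg K}.
Variables (v : alg_hom B C) (u : alg_hom A B).

Lemma alg_hom_comp_additive : zmod_morphism (v \o u).
Proof. by move=> x y /=; rewrite !rmorphB. Qed.

Lemma alg_hom_comp_monoid : monoid_morphism (v \o u).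
Proof. by split=> [|x y] /=; rewrite ?rmorph1 ?rmorphM. Qed.

Lemma alg_hom_comp_unit a : (v \o u) (alg_unit A a) = alg_unit C a.
Proof. by rewrite /= !alg_hom_unit. Qed.

Definition alg_hom_comp :=
  AlgHom alg_hom_comp_additive alg_hom_comp_monoid alg_hom_comp_unit.
End AlgHomComp.

Definition base_alg (K : comNzRingType) : comAlg K := ComAlg (@idfun K).

Section SmoothFunctions.
Context {R : realType} {n : nat} (M : manifold R n).

Definition smooth_pred (f : M -> R) : bool := `[< smooth_on [set: M] f >].

Lemma smooth_subring_closed : subring_closed smooth_pred.
Proof.
split=> [|f g|f g]; rewrite /in_mem /=.
- by apply/asboolP; exact: smooth_on_cst openT.
- move=> /asboolP sf /asboolP sg; apply/asboolP.
  rewrite -[- g]mulN1r; apply: smooth_onD => //; first exact: openT.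
  apply: smooth_onM => //; first exact: openT.
  exact: (smooth_on_cst (-1) openT).
- move=> /asboolP sf /asboolP sg; apply/asboolP.
  by apply: smooth_onM => //; exact: openT.
Qed.

Record smooth_fun := SmoothFun {
  smooth_val :> M -> R;
  _ : smooth_pred smooth_val }.
HB.instance Definition _ := [isSub for smooth_val].
HB.instance Definition _ := [Choice of smooth_fun by <:].
HB.instance Definition _ := GRing.SubChoice_isSubComPzRing.Build
  (M -> R) smooth_pred smooth_fun smooth_subring_closed.

Lemma smooth_cst_subproof (a : R) : smooth_pred (cst a).
Proof. by apply/asboolP; exact: smooth_on_cst openT. Qed.

Definition smooth_cst (a : R) : smooth_fun := SmoothFun (smooth_cst_subproof a).

Lemma smooth_cst_additive : zmod_morphism smooth_cst.
Proof. by move=> a b; apply: val_inj; apply/funext. Qed.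
Lemma smooth_cst_monoid : monoid_morphism smooth_cst.
Proof. by split=> [|a b]; apply: val_inj; apply/funext. Qed.
HB.instance Definition _ :=
  GRing.isZmodMorphism.Build R smooth_fun smooth_cst smooth_cst_additive.
HB.instance Definition _ :=
  GRing.isMonoidMorphism.Build R smooth_fun smooth_cst smooth_cst_monoid.

Definition smooth_alg : comAlg R := ComAlg smooth_cst.

End SmoothFunctions.

Lemma comp_dilation (K : comNzRingType) (t : K) (p : {poly K}) :
  p \Po (t *: 'X) = \poly_(j < size p) (t ^+ j * p`_j).
Proof.
rewrite comp_polyE poly_def; apply: eq_bigr => j _.
by rewrite exprZn scalerA mulrC.
Qed.

Lemma coef_comp_dilation (K : comNzRingType) (t : K) (p : {poly K}) i :
  (p \Po (t *: 'X))`_i = t ^+ i * p`_i.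
Proof.
rewrite comp_dilation coef_poly; case: ltnP => // /(nth_default 0) ->.
by rewrite mulr0.
Qed.

Lemma size_comp_dilation (K : comNzRingType) (t : K) (p : {poly K}) :
  (size (p \Po (t *: 'X)) <= size p)%N.
Proof. by rewrite comp_dilation size_poly. Qed.

Section Jets.
Context {R : realType} (r : nat).
Local Notation jetp := ('X^(r.+1) : {poly R}).

(* A_r, with epsilon the class of 'X *)
Definition jet_alg : comAlg R := ComAlg (qpolyC jetp).

Definition jet_coef (i : nat) (a : jet_alg) : R := (a : {poly %/ jetp})`_i.

(* sum_j a_j epsilon^j |-> sum_j t^j a_j epsilon^j *)
Definition jet_dilate (t : R) (a : jet_alg) : jet_alg :=
  in_qpoly jetp ((a : {poly %/ jetp}) \Po (t *: 'X)).

Lemma jet_dilate_additive t : zmod_morphism (jet_dilate t).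
Proof. by move=> a b; rewrite /jet_dilate !raddfB. Qed.

Lemma jet_dilate_mod t (p : {poly R}) :
  in_qpoly jetp (rmodp p (mk_monic jetp) \Po (t *: 'X)) =
  in_qpoly jetp (p \Po (t *: 'X)).
Proof.
rewrite [in RHS](rdivp_eq (monic_mk_monic jetp) p) comp_polyD comp_polyM.
rewrite rmorphD rmorphM /=.
suff -> : in_qpoly jetp (mk_monic jetp \Po (t *: 'X)) = 0 by rewrite mulr0 add0r.
rewrite mk_monic_Xn /= comp_Xn_poly exprZn linearZ /=.
suff -> : in_qpoly jetp 'X^(r.+1) = 0 by rewrite scaler0.
by apply: val_inj; rewrite /= mk_monic_Xn rmodpp // monicXn.
Qed.

Lemma jet_dilate_monoid t : monoid_morphism (jet_dilate t).
Proof.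
split=> [|a b]; rewrite /jet_dilate.
  by rewrite /= comp_polyC -[1%:P]/(1 : {poly R}) in_qpoly1.
by rewrite jet_dilate_mod comp_polyM rmorphM.
Qed.

Lemma jet_dilate_unit t a :
  jet_dilate t (alg_unit jet_alg a) = alg_unit jet_alg a.
Proof.
rewrite /jet_dilate /= comp_polyC; apply: val_inj; rewrite /= rmodp_small //.
by have := size_mk_monic (qpolyC jetp a).
Qed.

Lemma jet_coef_dilate i t a :
  jet_coef i (jet_dilate t a) = t ^+ i * jet_coef i a.
Proof.
rewrite /jet_coef /jet_dilate in_qpoly_small; last first.
  by apply: leq_ltn_trans (size_mk_monic a); exact: size_comp_dilation.
exact: coef_comp_dilation.
Qed.

Definition jet_dilation (t : R) : alg_hom jet_alg jet_alg :=
  AlgHom (jet_dilate_additive t) (jet_dilate_monoid t) (jet_dilate_unit t).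

End Jets.

Section Weightings.
Context {R : realType} {n : nat} (M : manifold R n).

Definition weight_sequence (r : nat) (w : 'I_n -> nat) : Prop :=
  (forall a b : 'I_n, (a <= b)%N -> (w a <= w b)%N) /\
  (forall a, (w a <= r)%N).

(* On the domain of c, f is in the ideal of C^oo(dom c) generated by the
   monomials x^s of weight at least i. *)
Definition weighted_ideal (c : chart R M n) (w : 'I_n -> nat) (i : nat)
    (f : M -> R) : Prop :=
  exists (I : finType) (s : I -> 'I_n -> nat) (g : I -> M -> R),
    [/\ forall k, smooth_on (dom c) (g k),
        forall k, (i <= \sum_a s k a * w a)%N &
        {in dom c, forall p,
           f p = \sum_k g k p * \prod_a (coord c p 0 a) ^+ (s k a)}].

(* fil i U is the ideal of sections over the open set U of the i-th sheaf of
   the filtration.  A section over U is represented by any function on M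
   extending it. *)
Record weighting (r : nat) := Weighting {
  fil :> nat -> set M -> set (M -> R);
  fil_ext : forall i U f g, open U -> {in U, f =1 g} -> fil i U f -> fil i U g;
  fil_restrict : forall i U V f, open U -> open V -> V `<=` U ->
    fil i U f -> fil i V f;
  fil_glue : forall i U f, open U ->
    (forall p, U p -> exists V, [/\ open V, V p, V `<=` U & fil i V f]) ->
    fil i U f;
  fil_zero : forall i U, open U -> fil i U (cst 0);
  fil_add : forall i U f g, open U -> fil i U f -> fil i U g -> fil i U (f + g);
  fil_mul : forall i U f g, open U -> smooth_on U f -> fil i U g ->
    fil i U (f * g);
  fil0 : forall U f, open U -> fil 0 U f <-> smooth_on U f;
  fil_decr : forall i U f, open U -> fil i.+1 U f -> fil i U f;
  fil_local : forall p, exists c w,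
    [/\ coord_chart c, dom c p, weight_sequence r w &
        forall i f, fil i (dom c) f <-> weighted_ideal c w i f] }.

Definition closed_submanifold (N : set M) : Prop :=
  closed N /\ forall p, N p -> exists c (S : {set 'I_n}),
    [/\ coord_chart c, dom c p &
        forall q, dom c q -> (N q <-> forall a, a \in S -> coord c q 0 a = 0)].

Definition weighting_along r (W : weighting r) (N : set M) : Prop :=
  forall U f, open U ->
    (W 1%N U f <-> smooth_on U f /\ forall p, U p -> N p -> f p = 0).

End Weightings.

Section AssociatedGraded.
Context {R : realType} {n : nat} {M : manifold R n} {r : nat}.
Variable W : weighting M r.

Lemma fil_smooth i U f : open U -> W i U f -> smooth_on U f.
Proof.
move=> oU; elim: i => [|i IH] Wf; first exact/(fil0 W f oU).
by apply: IH; exact: fil_decr.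
Qed.

Lemma filN i U f : open U -> W i U f -> W i U (- f).
Proof.
move=> oU Wf; rewrite -[f]mul1r -mulNr; apply: fil_mul => //.
exact: (smooth_on_cst (-1) oU).
Qed.

Lemma smooth_on_sum (I : Type) (s : seq I) U (g : I -> M -> R) : open U ->
  (forall k, smooth_on U (g k)) -> smooth_on U (\sum_(k <- s) g k).
Proof.
move=> oU sg; elim/big_rec: _ => [|k f _ sf]; first exact: smooth_on_cst.
exact: smooth_onD.
Qed.

Lemma weighted_idealM (c : chart R M n) w i j f g :
  weighted_ideal c w i f -> weighted_ideal c w j g ->
  weighted_ideal c w (i + j) (f * g).
Proof.
move=> [I [s [a [sa si fE]]]] [J [t [b [sb tj gE]]]].
exists (I * J)%type, (fun k l => s k.1 l + t k.2 l)%N,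
  (fun k => a k.1 * b k.2); split.
- by move=> k; apply: smooth_onM => //; exact: dom_open.
- move=> k; apply: leq_trans (leq_add (si k.1) (tj k.2)) _.
  by rewrite -big_split leq_sum // => l _; rewrite mulnDl.
- move=> p dp; have -> : (f * g) p = f p * g p by [].
  rewrite fE // gE // big_distrlr /= pair_big /=; apply: eq_bigr => k _.
  rewrite mulrACA -big_split; congr (_ * _).
  by apply: eq_bigr => l _; rewrite exprD.
Qed.

Lemma filM i j f g : W i [set: M] f -> W j [set: M] g ->
  W (i + j)%N [set: M] (f * g).
Proof.
move=> Wf Wg; apply: (fil_glue openT) => p _.
have [c [w [_ dp _ loc]]] := fil_local W p.
exists (dom c); split=> //; first exact: dom_open.
apply/loc/weighted_idealM; apply/loc.
  by apply: (fil_restrict openT) Wf => //; exact: dom_open.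
by apply: (fil_restrict openT) Wg => //; exact: dom_open.
Qed.

Lemma fil_sum (I : Type) (s : seq I) (P : pred I) i (g : I -> M -> R) :
  (forall k, P k -> W i [set: M] (g k)) ->
  W i [set: M] (\sum_(k <- s | P k) g k).
Proof.
move=> Wg; elim/big_rec: _ => [|k f Pk Wf]; first exact: (fil_zero W i openT).
by apply: (fil_add openT) => //; exact: Wg.
Qed.

(* The function M -> R[t], p |-> sum_i f_i(p) t^i stands for the finite sequence
   (f_i); the ones with f_i in C^oo(M)_(i) form the ring (+)_i C^oo(M)_(i). *)
Definition rees_coef (i : nat) (P : M -> {poly R}) : M -> R :=
  fun p => (P p)`_i.

Definition rees_pred (P : M -> {poly R}) : bool :=
  `[< (exists d, forall p, (size (P p) <= d)%N) /\
      forall i, W i [set: M] (rees_coef i P) >].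

Lemma rees_coefM k (P Q : M -> {poly R}) :
  rees_coef k (P * Q) = \sum_(i < k.+1) rees_coef i P * rees_coef (k - i) Q.
Proof.
by apply/funext => p; rewrite fct_sumE /rees_coef [in LHS]/GRing.mul/= coefM.
Qed.

Lemma rees_coefB k (P Q : M -> {poly R}) :
  rees_coef k (P - Q) = rees_coef k P - rees_coef k Q.
Proof. by apply/funext => p; rewrite /rees_coef /= coefB. Qed.

Lemma rees_subring_closed : subring_closed rees_pred.
Proof.
split=> [|P Q|P Q]; rewrite /in_mem /=.
- apply/asboolP; split; first by exists 1%N => p; rewrite size_poly1.
  case=> [|i].
    apply/(fil0 W _ openT); rewrite (_ : rees_coef _ _ = cst 1).
      exact: smooth_on_cst openT.
    by apply/funext => p; rewrite /rees_coef coef1.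
  rewrite (_ : rees_coef _ _ = cst 0); first exact: (fil_zero W _ openT).
  by apply/funext => p; rewrite /rees_coef coef1.
- move=> /asboolP[[d1 s1] WP] /asboolP[[d2 s2] WQ]; apply/asboolP; split.
    exists (maxn d1 d2) => p; apply: leq_trans (size_polyD _ _) _.
    by rewrite size_polyN geq_max !leq_max s1 s2 orbT.
  move=> i; rewrite rees_coefB.
  by apply: (fil_add openT) => //; exact: (filN openT).
- move=> /asboolP[[d1 s1] WP] /asboolP[[d2 s2] WQ]; apply/asboolP; split.
    exists (d1 + d2)%N => p; apply: leq_trans (size_polyMleq _ _) _.
    by apply: leq_trans (leq_pred _) _; exact: leq_add.
  move=> k; rewrite rees_coefM; apply: fil_sum => i _.
  have := filM (WP i) (WQ (k - i)%N).
  by rewrite subnKC // -ltnS.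
Qed.

Record rees := Rees { rees_val : M -> {poly R}; _ : rees_pred rees_val }.
HB.instance Definition _ := [isSub for rees_val].
HB.instance Definition _ := [Choice of rees by <:].
HB.instance Definition _ := GRing.SubChoice_isSubComPzRing.Build
  (M -> {poly R}) rees_pred rees rees_subring_closed.

(* (+)_i C^oo(M)_(i+1) *)
Definition gr_ideal (P : rees) : bool :=
  `[< forall i, W i.+1 [set: M] (rees_coef i (rees_val P)) >].

Lemma gr_ideal_zmod_closed : zmod_closed gr_ideal.
Proof.
split=> [|P Q].
  apply/asboolP => i; rewrite (_ : rees_coef _ _ = cst 0).
    exact: (fil_zero W _ openT).
  by apply/funext => p; rewrite /rees_coef /= coef0.
move=> /asboolP IP /asboolP IQ; apply/asboolP => i; rewrite rees_coefB.
by apply: (fil_add openT) => //; exact: (filN openT).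
Qed.

Lemma gr_idealM (P Q : rees) : gr_ideal Q -> gr_ideal (P * Q).
Proof.
move=> /asboolP IQ; apply/asboolP => k; rewrite rees_coefM; apply: fil_sum => i _.
have /asboolP[_ WP] : rees_pred (rees_val P) by case: P.
have := filM (WP i) (IQ (k - i)%N).
by rewrite addnS subnKC // -ltnS.
Qed.

HB.instance Definition _ := GRing.isZmodClosed.Build rees gr_ideal
  gr_ideal_zmod_closed.

Definition gr : Type := @Quotient.quot rees (GRing.ZmodClosed.clone rees gr_ideal _).
HB.instance Definition _ := GRing.Zmodule.on gr.
HB.instance Definition _ := EqQuotient.on gr.

Local Open Scope quotient_scope.

Lemma pi_grP (x y : rees) : reflect (\pi_gr x = \pi_gr y) (gr_ideal (x - y)).
Proof.
rewrite -[gr_ideal _]/(_ \in GRing.ZmodClosed.clone rees gr_ideal _).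
by rewrite Quotient.idealrBE; exact: eqP.
Qed.

Definition gr_mul (a b : gr) : gr := \pi_gr (repr a * repr b).

Lemma pi_gr_mul (x y : rees) : \pi_gr (x * y) = gr_mul (\pi_gr x) (\pi_gr y).
Proof.
have id (z : rees) : gr_ideal (z - repr (\pi_gr z)) by apply/pi_grP; rewrite reprK.
apply/pi_grP.
set x' := repr _; set y' := repr _.
have -> : x * y - x' * y' = y * (x - x') + x' * (y - y').
  by rewrite !mulrBr [y * x]mulrC [y * x']mulrC addrA subrK.
apply: (@rpredD _ (GRing.ZmodClosed.clone rees gr_ideal _));
  exact: gr_idealM _ (id _).
Qed.

Lemma gr_mulA : associative gr_mul.
Proof.
elim/quotW=> a; elim/quotW=> b; elim/quotW=> c.
by rewrite -(pi_gr_mul b) -(pi_gr_mul a b) -(pi_gr_mul a) -(pi_gr_mul _ c) mulrA.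
Qed.
Lemma gr_mulC : commutative gr_mul.
Proof. by move=> a b; rewrite /gr_mul mulrC. Qed.
Lemma gr_mul1 : left_id (\pi_gr 1) gr_mul.
Proof. by elim/quotW=> a; rewrite -(pi_gr_mul 1) mul1r. Qed.
Lemma gr_mulDl : left_distributive gr_mul +%R.
Proof.
elim/quotW=> a; elim/quotW=> b; elim/quotW=> c.
have piD (x y : rees) : \pi_gr (x + y) = \pi_gr x + \pi_gr y by rewrite !piE.
by rewrite -piD -(pi_gr_mul _ c) -(pi_gr_mul a) -(pi_gr_mul b) -piD mulrDl.
Qed.

HB.instance Definition _ := GRing.Zmodule_isComPzRing.Build gr
  gr_mulA gr_mulC gr_mul1 gr_mulDl.

Definition to_gr (P : rees) : gr := \pi_gr P.

Lemma to_gr_additive : zmod_morphism to_gr.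
Proof. by move=> x y; rewrite /to_gr !piE. Qed.
Lemma to_gr_monoid : monoid_morphism to_gr.
Proof. by split=> // x y; exact: pi_gr_mul. Qed.
HB.instance Definition _ :=
  GRing.isZmodMorphism.Build rees gr to_gr to_gr_additive.
HB.instance Definition _ :=
  GRing.isMonoidMorphism.Build rees gr to_gr to_gr_monoid.

Lemma to_grP (x y : rees) : reflect (to_gr x = to_gr y) (gr_ideal (x - y)).
Proof. exact: pi_grP. Qed.

Lemma to_gr_surj (a : gr) : exists P, a = to_gr P.
Proof. by exists (repr a); rewrite /to_gr reprK. Qed.

Lemma rees_cst_subproof (a : R) : rees_pred (cst a%:P).
Proof.
apply/asboolP; split; first by exists 1%N => p; exact: size_polyC_leq1.
case=> [|i].
  apply/(fil0 W _ openT); rewrite (_ : rees_coef _ _ = cst a).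
    exact: smooth_on_cst openT.
  by apply/funext => p; rewrite /rees_coef coefC.
rewrite (_ : rees_coef _ _ = cst 0); first exact: (fil_zero W _ openT).
by apply/funext => p; rewrite /rees_coef coefC.
Qed.

Definition rees_cst (a : R) : rees := Rees (rees_cst_subproof a).

Lemma rees_cst_additive : zmod_morphism rees_cst.
Proof.
by move=> a b; apply: val_inj; apply/funext => p; rewrite /= /cst polyCB.
Qed.
Lemma rees_cst_monoid : monoid_morphism rees_cst.
Proof.
by split=> [|a b]; apply: val_inj; apply/funext => p //=; rewrite /cst polyCM.
Qed.
HB.instance Definition _ :=
  GRing.isZmodMorphism.Build R rees rees_cst rees_cst_additive.
HB.instance Definition _ :=
  GRing.isMonoidMorphism.Build R rees rees_cst rees_cst_monoid.

Definition gr_alg : comAlg R := ComAlg (to_gr \o rees_cst).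

Lemma rees_homog_subproof i (f : M -> R) : W i [set: M] f ->
  rees_pred (fun p => f p *: 'X^i).
Proof.
move=> Wf; apply/asboolP; split.
  by exists i.+1 => p; apply: leq_trans (size_scale_leq _ _) _; rewrite size_polyXn.
move=> j; have [->|ji] := eqVneq j i.
  rewrite (_ : rees_coef _ _ = f) //.
  by apply/funext => p; rewrite /rees_coef coefZ coefXn eqxx mulr1.
rewrite (_ : rees_coef _ _ = cst 0); first exact: (fil_zero W _ openT).
by apply/funext => p; rewrite /rees_coef coefZ coefXn (negbTE ji) mulr0.
Qed.

(* the class of f in C^oo(M)_(i) / C^oo(M)_(i+1) *)
Definition gr_class i f (Wf : W i [set: M] f) : gr_alg :=
  to_gr (Rees (rees_homog_subproof Wf)).

Lemma rees_coef_comp (t : R) i (P : M -> {poly R}) :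
  rees_coef i (fun p => P p \Po (t *: 'X)) = cst (t ^+ i) * rees_coef i P.
Proof.
by apply/funext => p; rewrite /rees_coef coef_comp_dilation.
Qed.

Lemma rees_dilate_subproof (t : R) (P : rees) :
  rees_pred (fun p => rees_val P p \Po (t *: 'X)).
Proof.
case: P => P /= /asboolP[[d sP] WP]; apply/asboolP; split.
  by exists d => p; apply: leq_trans (size_comp_dilation _ _) (sP p).
move=> i; rewrite rees_coef_comp; apply: (fil_mul openT) => //.
exact: smooth_on_cst openT.
Qed.

Definition rees_dilate t (P : rees) : rees := Rees (rees_dilate_subproof t P).

(* multiplication by t^i in degree i *)
Definition gr_dilate (t : R) (a : gr_alg) : gr_alg :=
  to_gr (rees_dilate t (repr (a : gr))).

Lemma rees_dilate_additive t : zmod_morphism (rees_dilate t).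
Proof. by move=> P Q; apply: val_inj; apply/funext => p /=; rewrite raddfB. Qed.
Lemma rees_dilate_monoid t : monoid_morphism (rees_dilate t).
Proof.
split=> [|P Q]; apply: val_inj; apply/funext => p /=.
  by rewrite -[(1 : M -> {poly R}) p]/(1%:P) comp_polyC.
by rewrite [LHS]comp_polyM.
Qed.

Lemma to_gr_dilate t (P : rees) : gr_dilate t (to_gr P) = to_gr (rees_dilate t P).
Proof.
apply/to_grP; rewrite -rees_dilate_additive; apply/asboolP => i /=.
rewrite rees_coef_comp; apply: (fil_mul openT); first exact: smooth_on_cst openT.
have /asboolP : gr_ideal (repr (to_gr P) - P) by apply/to_grP; rewrite /to_gr reprK.
exact.
Qed.

Lemma gr_dilate_additive t : zmod_morphism (gr_dilate t).
Proof.
move=> a b; have [x ->] := to_gr_surj a; have [y ->] := to_gr_surj b.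
by rewrite -rmorphB !to_gr_dilate rees_dilate_additive rmorphB.
Qed.

Lemma gr_dilate_monoid t : monoid_morphism (gr_dilate t).
Proof.
split; first by rewrite -(rmorph1 to_gr) to_gr_dilate (rees_dilate_monoid t).1.
move=> a b; have [x ->] := to_gr_surj a; have [y ->] := to_gr_surj b.
by rewrite -rmorphM !to_gr_dilate (rees_dilate_monoid t).2 rmorphM.
Qed.

Lemma gr_dilate_unit t a : gr_dilate t (alg_unit gr_alg a) = alg_unit gr_alg a.
Proof.
rewrite to_gr_dilate; congr (to_gr _); apply: val_inj; apply/funext => p /=.
by rewrite /cst comp_polyC.
Qed.

Definition gr_dilation (t : R) : alg_hom gr_alg gr_alg :=
  AlgHom (gr_dilate_additive t) (gr_dilate_monoid t) (gr_dilate_unit t).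

Definition weighted_normal_bundle : Type := alg_hom gr_alg (base_alg R).

Definition nu_dilate (t : R) (x : weighted_normal_bundle) :
  weighted_normal_bundle := alg_hom_comp x (gr_dilation t).

End AssociatedGraded.

(* A set with a family of real functions generating its smooth functions
   (a Sikorski differential space).  The topology is the initial one; a function
   is smooth when it is locally a C^oo function of finitely many generators.
   A manifold is recovered this way from any family of smooth functions that
   contains local coordinates at every point and induces the topology. *)
Record diff_space (R : realType) := DiffSpace {
  points :> Type;
  generators : set (points -> R) }.

Section DiffSpaces.
Context {R : realType}.
Implicit Types X Y : diff_space R.

Definition diff_open X (V : set X) : Prop :=
  forall x, V x -> exists (k : nat) (g : 'I_k -> X -> R) (e : R),
    [/\ forall i, generators (g i), 0 < e &
        forall y, (forall i, `|g i y - g i x| < e) -> V y].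

Definition diff_smooth X (V : set X) (h : X -> R) : Prop :=
  forall x, V x -> exists (k : nat) (g : 'I_k -> X -> R) (F : 'rV[R]_k -> R)
      (O : set X),
    [/\ forall i, generators (g i), Cinf [set: 'rV[R]_k] F,
        diff_open O, O x &
        forall y, O y -> V y -> h y = F (\row_i g i y)].

Definition diff_smooth_map X Y (V : set X) (phi : X -> Y) : Prop :=
  forall g, generators g -> diff_smooth V (g \o phi).

(* the structure induced on a subset of X *)
Definition diff_sub X (P : X -> Prop) : diff_space R :=
  @DiffSpace R {x | P x}
    [set h | exists2 g, generators g & h = fun x => g (proj1_sig x)].

Definition diff_quotient_structure X Y (phi : X -> Y) : Prop :=
  (forall V, diff_open V <-> diff_open (phi @^-1` V)) /\
  (forall V h, diff_open V ->
    (diff_smooth V h <-> diff_smooth (phi @^-1` V) (h \o phi))).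

(* smooth, with a smooth local section through every point of X *)
Definition diff_submersion X Y (phi : X -> Y) : Prop :=
  diff_smooth_map [set: X] phi /\
  forall x, exists (V : set Y) (s : Y -> X),
    [/\ diff_open V, V (phi x), diff_smooth_map V s, s (phi x) = x &
        {in V, cancel s phi}].

End DiffSpaces.

Section WeightedNormalBundle.
Context {R : realType} {n : nat} {M : manifold R n} {r : nat}.
Variable W : weighting M r.
Local Open Scope quotient_scope.

Definition higher_tangent : Type := alg_hom (smooth_alg M) (jet_alg r).

Definition lift (i : nat) (f : smooth_alg M) (u : higher_tangent) : R :=
  jet_coef i (u f).

Definition TM_dilate (t : R) (u : higher_tangent) : higher_tangent :=
  alg_hom_comp (jet_dilation r t) u.

Definition higher_tangent_space : diff_space R :=
  @DiffSpace R higher_tangent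
    [set h | exists i f, (i <= r)%N /\ h = lift i f].

Definition in_subbundle (u : higher_tangent) : Prop :=
  forall i j (f : smooth_fun M), W i [set: M] f ->
    (j < i)%N -> (i <= r)%N -> lift j f u = 0.

Definition subbundle_space : diff_space R :=
  @diff_sub R higher_tangent_space in_subbundle.

Definition subbundle : Type := subbundle_space.
HB.instance Definition _ := gen_eqMixin subbundle.
HB.instance Definition _ := gen_choiceMixin subbundle.

Lemma subbundle_dilate_subproof t (q : subbundle) :
  in_subbundle (TM_dilate t (proj1_sig q)).
Proof.
case: q => u uQ i j f Wf ji ir.
by rewrite /lift /= jet_coef_dilate [jet_coef _ _](uQ _ _ _ Wf ji ir) mulr0.
Qed.

Definition subbundle_dilate (t : R) (q : subbundle) : subbundle :=
  exist in_subbundle _ (subbundle_dilate_subproof t q).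

Definition subbundle_rel (q1 q2 : subbundle) : bool :=
  `[< forall i (f : smooth_fun M), (i <= r)%N -> W i [set: M] f ->
        lift i f (proj1_sig q1) = lift i f (proj1_sig q2) >].

Lemma subbundle_rel_equiv : equiv_class_of subbundle_rel.
Proof.
split=> [q|q1 q2|q2 q1 q3].
- exact/asboolP.
- by apply/asboolP/asboolP => H i f ir Wf; rewrite H.
- move=> /asboolP H12 /asboolP H23; apply/asboolP => i f ir Wf.
  by rewrite H12 // H23.
Qed.

Canonical subbundle_equiv := EquivRelPack subbundle_rel_equiv.

Definition subbundle_quotient : Type := {eq_quot subbundle_rel}.
HB.instance Definition _ := EqQuotient.on subbundle_quotient.

Definition nu_space : diff_space R :=
  @DiffSpace R (weighted_normal_bundle W)
    [set h | exists a : gr_alg W, h = fun x : weighted_normal_bundle W => x a].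

(* phi is dual to the algebra morphism gr -> C^oo_pol(Q) determined by
   f mod C^oo(M)_(i+1) |-> f^(i), i <= r. *)
Definition is_canonical (phi : subbundle_quotient -> weighted_normal_bundle W)
    : Prop :=
  forall (q : subbundle) i (f : smooth_fun M) (Wf : W i [set: M] f), (i <= r)%N ->
    phi (\pi_subbundle_quotient q) (gr_class Wf) = lift i f (proj1_sig q).

End WeightedNormalBundle.

(* Main.v *)
From Pilot Require Import Defs.
From mathcomp Require Import all_boot all_order all_algebra.
From mathcomp Require Import generic_quotient.
From mathcomp Require Import all_classical all_reals all_analysis.
From mathcomp Require Import qpoly ring lra zify.
Import Order.TTheory GRing.Theory Num.Theory.
Import numFieldNormedType.Exports.
Import Pdiv.CommonRing Pdiv.RingMonic.
(* all_algebra also exports constants named coord and lift *)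
Import Pilot.Defs.
Local Open Scope classical_set_scope.
Local Open Scope ring_scope.
Local Open Scope quotient_scope.

Set Implicit Arguments.
Unset Strict Implicit.
Unset Printing Implicit Defensive.

(** Around a point p of N take weighted coordinates x_a, of weights w_a, cut off
    to global functions.  A character of gr(C^oo(M)) restricts in degree 0 to
    a character of C^oo(M), which is evaluation at a point (Milnor's exercise),
    and by the local model it is determined by this point and by its values
    xi_a on the classes of the x_a in degree w_a.  A jet u in T_rM is determined
    by its values on the x_a, because by Hadamard's lemma the differences
    u(f) - v(f) of two jets with equal coordinates lie in every power of epsilon.
    So u is the jet of the polynomial curve with the same coordinates; u lies in Q
    iff the a-th coordinate of that curve is O(t^w_a), and then mapping f of degree
    i to the i-th Taylor coefficient of f along the curve, now for all i, is
    a character of gr.  Its value on x_a is the coefficient of t^w_a.  Replacing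
    this coefficient of the curve of a given q by xi_a, while keeping the others,
    gives a smooth local section of Q -> nu through q.  Hence Q -> nu is
    a surjective submersion, and its fibres are the equivalence classes. *)

(** * Calculus on open subsets of R^n *)

(** The jets in Q stop at order r, whereas gr(C^oo(M)) has components of every degree. This is why a
    jet is replaced by a polynomial curve, whose Taylor coefficients exist in all orders. The
    conditions defining Q mention only degrees up to r; but no weight exceeds r, so they bound the
    order of every coordinate of the curve from below, and by the local model this controls
    functions of every degree. Functions in C^oo(M) are global while coordinates are local. Bump
    functions bridge the gap: a jet or a character sends a bump function at its base point to an
    element with constant term 1, so it depends only on germs at that point. In Milnor's exercise M
    may be noncompact, and a locally finite sum built from second countability takes the place of a
    proper function. The smooth structure of nu is generated by the elements of gr, so the
    smoothness of Q -> nu and of its sections is checked on generators. A section is smooth because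
    the Taylor coefficients of a family of curves are iterated partial derivatives in time of one
    smooth function of time and parameters. *)

Section LocalCalculus.
Context {R : realType} {n : nat}.
Implicit Types (U V : set 'rV[R]_n) (f g : 'rV[R]_n -> R).

Lemma Ck_sub k U V f : V `<=` U -> Ck k U f -> Ck k V f.
Proof.
move=> VU; have VU' x : x \in V -> x \in U by rewrite !inE; exact: VU.
elim: k f => [|k IH] f [cf df]; split=> //; try by move=> x /VU'; exact: cf.
move=> j; have [d1 d2] := df j; split; last exact: IH.
by move=> x /VU'; exact: d1.
Qed.

Lemma Ck_continuous k U f : Ck k U f -> {in U, continuous f}.
Proof. by case: k => [|k] []. Qed.

Lemma Ck_local k U f :
  (forall x, U x -> exists V, [/\ open V, V x & Ck k V f]) -> Ck k U f.
Proof.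
elim: k f => [|k IH] f Uf; (split; first by
  move=> x /[1!inE] /Uf[V [oV Vx [cf _]]]; apply: cf; rewrite inE) => // j.
split.
  move=> x /[1!inE] /Uf[V [oV Vx [_ df]]].
  by have [d _] := df j; apply: d; rewrite inE.
by apply: IH => x /Uf[V [oV Vx [_ df]]]; exists V; split=> //; exact: (df j).2.
Qed.

Lemma Cinf_sub U V f : V `<=` U -> Cinf U f -> Cinf V f.
Proof. by move=> VU Cf k; exact: Ck_sub (Cf k). Qed.

Lemma Cinf_local U f :
  (forall x, U x -> exists V, [/\ open V, V x & Cinf V f]) -> Cinf U f.
Proof.
move=> Uf k; apply: Ck_local => x /Uf[V [oV Vx Cf]].
by exists V; split=> //; exact: Cf.
Qed.

Lemma Cinf_ext U f g : open U -> {in U, f =1 g} -> Cinf U f -> Cinf U g.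
Proof. by move=> oU fg Cf k; exact: Ck_ext (Cf k). Qed.

Lemma Cinf_partial U f j : Cinf U f -> Cinf U (partial j f).
Proof. by move=> Cf k; have [_ /(_ j)[]] := Cf k.+1. Qed.

Lemma Cinf_derivable U f j x : Cinf U f -> U x ->
  derivable f x (delta_mx 0 j).
Proof. by move=> Cf Ux; have [_ /(_ j)[+ _]] := Cf 1%N; apply; rewrite inE. Qed.

Lemma Cinf_continuous U f x : Cinf U f -> U x -> {for x, continuous f}.
Proof. by move=> Cf Ux; have [+ _] := Cf 0%N; apply; rewrite inE. Qed.

Lemma Cinf_prod (I : Type) (s : seq I) (P : pred I) U
    (F : I -> 'rV[R]_n -> R) : open U ->
  (forall i, P i -> Cinf U (F i)) -> Cinf U (\prod_(i <- s | P i) F i).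
Proof.
move=> oU CF; elim/big_rec: _ => [|i f Pi Cf]; first exact: Cinf_cst.
by apply: CinfM => //; exact: CF.
Qed.

Lemma Cinf_exp U f m : open U -> Cinf U f -> Cinf U (f ^+ m).
Proof.
move=> oU Cf; elim: m => [|m IH]; first exact: Cinf_cst.
by rewrite exprS; exact: CinfM.
Qed.

Lemma CinfN U f : open U -> Cinf U f -> Cinf U (- f).
Proof. by move=> oU Cf; rewrite -mulN1r; apply: CinfM => //; exact: (Cinf_cst (-1)). Qed.

Lemma is_derive_coord (a : 'I_n) (x v : 'rV[R]_n) :
  is_derive x v (fun y : 'rV[R]_n => y 0 a) (v 0 a).
Proof.
have E : (fun h : R => h^-1 *: ((h *: v + x) 0 a - x 0 a)) @ 0^' --> v 0 a.
  apply: (@cvg_trans _ (cst (v 0 a) @ (0 : R)^')); last exact: cvg_cst.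
  apply: near_eq_cvg; near=> h.
  have h0 : h != 0 by near: h; exact: nbhs_dnbhs_neq.
  by rewrite /= !mxE addrK /GRing.scale /= mulKf.
by apply: DeriveDef; [apply/cvg_ex; exists (v 0 a)|exact: cvg_lim E].
Unshelve. all: by end_near. Qed.

Lemma Cinf_coord U (a : 'I_n) : open U -> Cinf U (fun y : 'rV[R]_n => y 0 a).
Proof.
move=> oU [|k].
  by split=> // x _; apply: matrix_normedtype.coord_continuous.
split; first by move=> x _; apply: matrix_normedtype.coord_continuous.
move=> j; split; first by move=> x _; have [] := is_derive_coord a x (delta_mx 0 j).
apply: Ck_ext (Ck_cst k ((delta_mx 0 j : 'rV[R]_n) 0 a) oU) => // x _.
by have [_ <-] := is_derive_coord a x (delta_mx 0 j).
Qed.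

End LocalCalculus.

Lemma is_derive_line (R : realType) (V : normedModType R) (f : V -> R)
    (v z : V) (t : R) : derivable f (t *: v + z) v ->
  is_derive t 1 (fun s => f (s *: v + z)) ('D_v f (t *: v + z)).
Proof.
move=> df.
have E : (fun h : R => h^-1 *: (f ((h *: 1 + t) *: v + z) - f (t *: v + z))) =
         (fun h => h^-1 *: (f (h *: v + (t *: v + z)) - f (t *: v + z))).
  by apply/funext => h; rewrite addrA -scalerDl [h *: 1]mulr1.
by apply: DeriveDef; [rewrite /derivable E|rewrite /derive E].
Qed.

(** The increment [h] may have either sign, and only a bound on the intermediate point is kept, so
    that one statement serves along a line in both directions. *)
Lemma MVT0 (R : realType) (g dg : R -> R) (h : R) :
  (forall t : R, `|t| <= `|h| -> is_derive t 1 g (dg t)) ->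
  exists2 t, `|t| <= `|h| & g h - g 0 = h * dg t.
Proof.
move=> dgP; have cg t : `|t| <= `|h| -> {for t, continuous g}.
  by move=> /dgP[dt _]; apply/differentiable_continuous/derivable1_diffP.
have itvP (a b : R) : `|a| <= `|h| -> `|b| <= `|h| ->
    forall t, t \in `[a, b] -> `|t| <= `|h|.
  move=> ah bh t; rewrite in_itv /= => /andP[ta tb].
  rewrite ler_norml (le_trans tb) ?(le_trans (ler_norm _) bh) // andbT.
  by apply: le_trans ta; move: ah; rewrite ler_norml => /andP[].
have MV a b : `|a| <= `|h| -> `|b| <= `|h| -> a <= b ->
    exists2 t, `|t| <= `|h| & g b - g a = dg t * (b - a).
  move=> ah bh ab; have [] := @MVT_segment _ g dg a b ab.
  - by move=> x /subset_itv_oo_cc xab; apply: dgP; exact: (itvP a b).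
  - apply: continuous_in_subspaceT => x /[!inE] xab.
    by apply: cg; apply: (itvP a b).
  by move=> t tab E; exists t => //; exact: (itvP a b).
have h0 : `|0 : R| <= `|h| by rewrite normr0.
have [h_ge0|/ltW h_le0] := leP 0 h.
  by have [//|//|//|t th E] := MV 0 h; exists t; rewrite // E subr0 mulrC.
have [//|//|//|t th E] := MV h 0; exists t; rewrite // -[LHS]opprB E.
by rewrite sub0r mulrN opprK mulrC.
Qed.

(** * The chain rule along curves *)

Section ChainRule.
Context {R : realType} {n : nat}.
Implicit Types (U : set 'rV[R]_n) (f : 'rV[R]_n -> R).

(** Vertices of the path from [x] to [y] that changes one coordinate at a time. *)
Definition mix (x y : 'rV[R]_n) (k : nat) : 'rV[R]_n :=
  \row_a (if (a < k)%N then y 0 a else x 0 a).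

Lemma norm_rV_le (x : 'rV[R]_n) (e : R) : 0 <= e ->
  (forall a, `|x 0 a| <= e) -> `|x| <= e.
Proof.
move=> e0 xe; rewrite [leLHS]/Num.Def.normr/= mx_normrE bigmax_le //.
by move=> [i a] _; rewrite ord1 xe.
Qed.

Lemma coord_norm_le (x : 'rV[R]_n) a : `|x 0 a| <= `|x|.
Proof.
rewrite [leRHS]/Num.Def.normr/= mx_normrE.
exact: (le_bigmax _ (fun ij : 'I_1 * 'I_n => `|x ij.1 ij.2|) (0, a)).
Qed.

(* the mean value theorem along the edges of the box between x and y *)
Lemma increment_partials U f x e : 0 < e -> ball x e `<=` U ->
  Ck 1 U f -> exists xi : 'I_n -> 'rV[R]_n -> 'rV[R]_n,
  forall y, `|y - x| < e ->
    (forall a, `|xi a y - x| <= `|y - x|) /\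
    f y - f x = \sum_a (y 0 a - x 0 a) * partial a f (xi a y).
Proof.
move=> e0 eU [_ df].
suff /choice[xi xiP] : forall ay : 'I_n * 'rV[R]_n, exists z, `|ay.2 - x| < e ->
    `|z - x| <= `|ay.2 - x| /\
    f (mix x ay.2 ay.1.+1) - f (mix x ay.2 ay.1) =
      (ay.2 0 ay.1 - x 0 ay.1) * partial ay.1 f z.
  exists (fun a y => xi (a, y)) => y ye; split=> [a|].
    by have [] := xiP (a, y) ye.
  rewrite -(eq_bigr _ (fun a _ => (xiP (a, y) ye).2)) /=.
  rewrite -(big_mkord xpredT (fun k => f (mix x y k.+1) - f (mix x y k))).
  rewrite telescope_sumr //; congr (f _ - f _); apply/rowP => a; rewrite mxE //.
  by rewrite ltn_ord.
(* Beyond the radius nothing is required of the intermediate point, and [x] is a default. *)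
move=> [a y] /=; have [ye|] := boolP (`|y - x| < e); last by exists x.
pose z t := t *: delta_mx 0 a + mix x y a.
have zx t : `|t| <= `|y 0 a - x 0 a| -> `|z t - x| <= `|y - x|.
  move=> th; apply: norm_rV_le => // b; rewrite !mxE eqxx /=.
  have yb b' : `|y 0 b' - x 0 b'| <= `|y - x|.
    by have := coord_norm_le (y - x) b'; rewrite !mxE.
  have [->|ba] := eqVneq b a.
    by rewrite ltnn mulr1 addrK (le_trans th).
  by rewrite mulr0 add0r; case: ifP => _ //; rewrite subrr normr0.
have [|t th E] := @MVT0 _ (f \o z) (fun t => partial a f (z t)) (y 0 a - x 0 a).
  move=> t th; apply: is_derive_line; have [d _] := df a; apply: d.
  rewrite inE; apply: eU; rewrite -ball_normE /ball_ /= distrC.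
  exact: le_lt_trans (zx _ th) ye.
exists (z t) => _; split; first exact: zx.
rewrite -E /=; congr (f _ - f _); apply/rowP => b; rewrite !mxE /=.
  have [->|ba] := eqVneq b a; first by rewrite ltnSn ltnn mulr1 subrK.
  by rewrite ltnS leq_eqVlt (negbTE (ba : b != a :> nat)) mulr0 add0r.
by rewrite mul0r add0r.
Qed.

(** By [increment_partials] the difference quotient of [f \o c] is the sum of the quotients of the
    coordinates times partial derivatives at intermediate points. These points tend to [c t], and
    the partial derivatives of a C^1 function are continuous. *)
Lemma chain_curve U f (c : R -> 'rV[R]_n) (t : R) (dc : 'I_n -> R) :
  open U -> U (c t) -> Ck 1 U f ->
  (forall a, is_derive t 1 (fun s => c s 0 a) (dc a)) ->
  is_derive t 1 (f \o c) (\sum_a dc a * partial a f (c t)).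
Proof.
move=> oU Uc Cf dcP; set x := c t.
have /nbhs_ballP[e /= e0 eU] : nbhs x U by exact: open_nbhs_nbhs.
have [xi xiP] := increment_partials e0 eU Cf.
have cc : {for t, continuous c}.
  apply/differentiable_continuous/derivable1_diffP/derivable_mxP => i a.
  by rewrite ord1; have [] := dcP a.
have cct : c s @[s --> t] --> x by [].
have c0 : c (h *: 1 + t) @[h --> (0 : R)^'] --> x.
  apply: (@cvg_comp _ _ _ (fun h : R => h *: 1 + t) c _ (nbhs t)) cct.
  suff : h *: 1 + t @[h --> (0 : R)^'] --> (0 : R) *: (1 : R) + t by rewrite scale0r add0r.
  by apply: cvgD; [apply: cvgZr_tmp; exact: cvg_within|exact: cvg_cst].
have nx : \forall h \near (0 : R)^', `|c (h *: 1 + t) - x| < e.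
  by move/cvgrPdist_lt : c0 => /(_ _ e0); apply: filterS => h; rewrite distrC.
have xi0 a : xi a (c (h *: 1 + t)) @[h --> (0 : R)^'] --> x.
  apply/cvgrPdist_lt => d d0; near=> h.
  rewrite distrC; apply: le_lt_trans ((xiP (c (h *: 1 + t)) _).1 a) _.
    by near: h.
  rewrite distrC; near: h; by move/cvgrPdist_lt : c0 => /(_ _ d0).
have E : (fun h : R => h^-1 *: (f (c (h *: 1 + t)) - f x)) @ 0^' -->
    \sum_a dc a * partial a f x.
  apply: (@cvg_trans _ ((fun h => \sum_a h^-1 *: (c (h *: 1 + t) 0 a - x 0 a) *
      partial a f (xi a (c (h *: 1 + t)))) @ (0 : R)^')).
    apply: near_eq_cvg; near=> h.
    rewrite (xiP (c (h *: 1 + t)) _).2; last by near: h.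
    by rewrite scaler_sumr; apply: eq_bigr => a _; rewrite scalerAl.
  apply: cvg_big => [|a _]; first by apply: add_continuous.
  apply: cvgM.
    by have [dd <-] := dcP a; exact: dd.
  have /(_ a)[_ [cp _]] := Cf.2.
  apply: (@cvg_comp _ _ _ _ (partial a f) _ (nbhs x)); first exact: xi0.
  by apply: cp; rewrite inE.
by apply: DeriveDef; [apply/cvg_ex; eexists; exact: E|exact: cvg_lim E].
Unshelve. all: by end_near. Qed.

End ChainRule.

(** * Smoothness of composites and inverses *)

Section Composition.
Context {R : realType} {n m : nat}.
Implicit Types (U : set 'rV[R]_n) (O : set 'rV[R]_m) (f : 'rV[R]_m -> R)
  (G : 'rV[R]_n -> 'rV[R]_m).

Lemma Ck_sum k (I : Type) (s : seq I) U (F : I -> 'rV[R]_n -> R) : open U ->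
  (forall i, Ck k U (F i)) -> Ck k U (\sum_(i <- s) F i).
Proof.
move=> oU CF; elim/big_rec: _ => [|i f _ Cf]; first exact: Ck_cst.
exact: CkD.
Qed.

Lemma is_derive_comp_partial U O f G x j : open U -> open O -> U x -> O (G x) ->
  (forall a, Cinf U (fun x => G x 0 a)) -> Cinf O f ->
  is_derive x (delta_mx 0 j) (f \o G)
    (\sum_a partial j (fun x => G x 0 a) x * partial a f (G x)).
Proof.
move=> oU oO Ux Ox CG Cf; pose c s := G (s *: delta_mx 0 j + x).
have c0 : c 0 = G x by rewrite /c scale0r add0r.
have [||d1 d2] := @chain_curve R m O f c 0
  (fun a => partial j (fun x => G x 0 a) x) oO _ (Cf 1%N).
- by rewrite c0.
- move=> a; have -> : partial j (fun x => G x 0 a) x =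
      'D_(delta_mx 0 j) (fun x => G x 0 a) (0 *: delta_mx 0 j + x).
    by rewrite scale0r add0r.
  apply: is_derive_line; rewrite scale0r add0r.
  exact: Cinf_derivable (CG a) Ux.
rewrite c0 in d2; apply: DeriveDef; first exact/derivable1P.
rewrite -d2 /derive; apply: (congr1 (fun g => lim (g @ (0 : R)^'))); apply/funext => h /=.
by rewrite /c !scaler1 addr0 scale0r add0r.
Qed.

Lemma rV_continuous G x : (forall a, {for x, continuous (fun x => G x 0 a)}) ->
  {for x, continuous G}.
Proof.
move=> cG; apply/(@cvgrPdist_le _ _ _ (nbhs x) (nbhs_filter x)) => e e0.
have H : \forall y \near x, forall a, `|G x 0 a - G y 0 a| <= e.
  apply: (@filter_forall _ _ _ _ (nbhs_filter x)) => a.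
  exact: ((@cvgrPdist_le _ _ _ _ _ _ _).1 (cG a) e e0).
apply: filterS H => y H; apply: norm_rV_le; first exact: ltW.
by move=> a; rewrite !mxE.
Qed.

(** Induction on the order of differentiability, for all [f] at once: the partial derivatives of
    [f \o G] are sums of products of those of [G] with [partial a f \o G], to which the induction
    hypothesis applies. *)
Lemma Cinf_comp U O f G : open U -> open O -> (forall x, U x -> O (G x)) ->
  (forall a, Cinf U (fun x => G x 0 a)) -> Cinf O f -> Cinf U (f \o G).
Proof.
move=> oU oO UO CG Cf k; elim: k f Cf => [|k IH] f Cf.
  split=> // x /[1!inE] Ux; apply: continuous_comp.
    by apply: rV_continuous => a; exact: Cinf_continuous (CG a) _.
  by apply: Cinf_continuous Cf _; exact: UO.
split; first exact: Ck_continuous (IH f Cf).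
move=> j; split.
  move=> x /[1!inE] Ux.
  by have [] := is_derive_comp_partial j oU oO Ux (UO _ Ux) CG Cf.
apply: (@Ck_ext _ _ _ _ (\sum_a partial j (fun x => G x 0 a) * (partial a f \o G))) => //.
  move=> x /[1!inE] Ux; rewrite fct_sumE /= -[RHS]/('D_(delta_mx 0 j) (f \o G) x).
  by have [_ ->] := is_derive_comp_partial j oU oO Ux (UO _ Ux) CG Cf.
apply: Ck_sum => // a; apply: CkM => //; first exact: (Cinf_partial j (CG a)).
by apply: IH; exact: Cinf_partial.
Qed.

(* A smooth one-variable function is given as a member of a family that is
   closed under differentiation. *)
Lemma Cinf_comp1 (T : Type) (h : T -> R -> R) (d : T -> T) U
    (f : 'rV[R]_n -> R) : open U ->
  (forall t (x : R), is_derive x 1 (h t) (h (d t) x)) ->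
  Cinf U f -> forall t, Cinf U (h t \o f).
Proof.
move=> oU dh Cf t k; elim: k t => [|k IH] t.
  split=> // x /[1!inE] Ux; apply: continuous_comp; first exact: Cinf_continuous Cf _.
  by apply/differentiable_continuous/derivable1_diffP; have [] := dh t (f x).
split; first exact: Ck_continuous (IH t).
have D j x : U x -> is_derive x (delta_mx 0 j) (h t \o f)
    (h (d t) (f x) * partial j f x).
  move=> Ux; pose c s := f (s *: delta_mx 0 j + x).
  have c0 : c 0 = f x by rewrite /c scale0r add0r.
  have [dc1 dc2] : is_derive (0 : R) 1 c (partial j f x).
    have -> : partial j f x =
        'D_(delta_mx 0 j) f (0 *: delta_mx 0 j + x).
      by rewrite scale0r add0r.
    apply: is_derive_line; rewrite scale0r add0r.
    exact: Cinf_derivable Cf Ux.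
  have [dh1 dh2] := dh t (c 0).
  apply: DeriveDef.
    apply/derivable1P/derivable1_diffP.
    by apply: (@differentiable_comp _ _ _ _ c (h t)); exact/derivable1_diffP.
  rewrite -c0 -dc2 -dh2 -!derive1E -derive1_comp // derive1E.
  rewrite /derive; apply: (congr1 (fun g => lim (g @ (0 : R)^'))); apply/funext => s /=.
  by rewrite /c !scaler1 addr0 scale0r add0r.
move=> j; split; first by move=> x /[1!inE] /(D j)[].
apply: (@Ck_ext _ _ _ _ ((h (d t) \o f) * partial j f)) => //.
  by move=> x /[1!inE] /(D j)[_ /esym].
by apply: CkM => //; exact: (Cinf_partial j Cf).
Qed.

Lemma CinfV U (f : 'rV[R]_n -> R) : open U -> (forall x, U x -> f x != 0) ->
  Cinf U f -> Cinf U (fun x => (f x)^-1).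
Proof.
move=> oU f0 Cf k; elim: k => [|k IH].
  by split=> // x /[1!inE] Ux; apply: continuousV; [exact: f0|exact: Cinf_continuous Cf _].
split; first exact: Ck_continuous IH.
move=> j; split.
  move=> x /[1!inE] Ux; apply: derivableV; first exact: f0.
  exact: Cinf_derivable Cf Ux.
apply: (@Ck_ext _ _ _ _ (cst (-1) * ((fun x => (f x)^-1) *
  ((fun x => (f x)^-1) * partial j f)))) => //.
  move=> x /[1!inE] Ux; rewrite /partial deriveV; [|exact: f0|exact: Cinf_derivable Cf Ux].
  by rewrite /= -exprVn expr2 /GRing.scale /= !mulrA mulN1r mulNr.
apply: CkM => //; first exact: Ck_cst.
by do 2![apply: CkM => //]; exact: (Cinf_partial j Cf).
Qed.

End Composition.

(** * Bump functions *)

Section FlatFunction.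
Context {R : realType}.
Implicit Types (P Q : {poly R}) (x y : R).

(** The polynomial factor makes the family closed under differentiation, as [Cinf_comp1] requires;
    [Q = 1] is the classical flat function exp(-1/x). *)
Definition flat Q x : R := if 0 < x then Q.[x^-1] * expR (- x^-1) else 0.

(** From exp(z) >= z at z = y / (m+1), raised to the power m+1. *)
Lemma exprn_le_expR m y : 0 <= y -> y ^+ m.+1 <= m.+1%:R ^+ m.+1 * expR y.
Proof.
move=> y0; have -> : expR y = expR (y / m.+1%:R) ^+ m.+1.
  by rewrite -expRM_natl mulrC divfK // pnatr_eq0.
rewrite -exprMn; apply: lerXn2r; rewrite ?nnegrE //.
rewrite -ler_pdivrMl ?ltr0n // mulrC; apply: le_trans (expR_ge1Dx _).
by rewrite lerDr.
Qed.

(** For y = 1/x the bound reads C x. The power [y ^+ k] absorbs the variable split off in the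
    induction on [P]; for k = 1 it is the factor 1/x of the difference quotient of [flat] at 0. *)
Lemma horner_expRN_bound P k :
  exists2 C, 0 <= C & forall y, 0 < y -> `|y ^+ k * P.[y] * expR (- y)| <= C / y.
Proof.
elim/poly_ind: P k => [|P c IH] k.
  by exists 0 => // y y0; rewrite horner0 mulr0 mul0r normr0 mul0r.
have [C C0 CP] := IH k.+1; exists (C + `|c| * k.+1%:R ^+ k.+1) => [|y y0].
  by apply: addr_ge0 => //; apply: mulr_ge0 => //; exact: exprn_ge0.
have -> : y ^+ k * (P * 'X + c%:P).[y] * expR (- y) =
    y ^+ k.+1 * P.[y] * expR (- y) + c * (y ^+ k * expR (- y)).
  by rewrite hornerMXaddC exprS; ring.
rewrite (le_trans (ler_normD _ _)) // mulrDl lerD ?CP //.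
rewrite normrM -mulrA; apply: ler_wpM2l => //.
rewrite ger0_norm; last by apply: mulr_ge0; [exact/exprn_ge0/ltW|exact: expR_ge0].
rewrite ler_pdivlMr // mulrAC -exprSr expRN ler_pdivrMr ?expR_gt0 //.
exact/exprn_le_expR/ltW.
Qed.

(** In y = 1/x, differentiation by x is -y^2 d/dy, applied here to Q(y) exp(-y). *)
Definition flat_deriv Q : {poly R} := 'X^2 * (Q - Q^`()).

Lemma is_derive_flat Q x : is_derive x 1 (flat Q) (flat (flat_deriv Q) x).
Proof.
have [x0|x0|->] := ltgtP x 0.
- have E : \near x, flat Q x = cst 0 x.
    near=> y; rewrite /flat ifF //; apply/negbTE; rewrite -leNgt ltW //.
    by near: y; exact: lt_nbhsl.
  have [d1 d2] : is_derive x 1 (cst 0 : R -> R) 0 by exact: is_derive_cst.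
  have F : \near x, cst 0 x = flat Q x by near=> y; rewrite (near E y).
  have -> : flat (flat_deriv Q) x = 0 by rewrite /flat ltNge (ltW x0).
  exact: near_eq_is_derive F (DeriveDef d1 d2).
- have F : \near x, Q.[x^-1] * expR (- x^-1) = flat Q x.
    by near=> y; rewrite /flat ifT //; near: y; exact: lt_nbhsr.
  apply: near_eq_is_derive F _.
  have xn0 : x != 0 by rewrite gt_eqF.
  have dV : is_derive x 1 (fun y : R => y^-1) (- x ^- 2 *: 1).
    exact: (@is_deriveV _ id).
  pose g y := Q.[y] * expR (- y).
  have dQ : is_derive x^-1 1 (horner Q) Q^`().[x^-1].
    by apply: DeriveDef; [exact: derivable_horner|rewrite -derive1E -derivE].
  have dE : is_derive x^-1 1 (expR \o -%R) (expR (- x^-1) * -1).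
    by apply: is_derive1_comp; exact: is_deriveN.
  have dg : is_derive x^-1 1 g (Q.[x^-1] *: (expR (- x^-1) * -1) +
      expR (- x^-1) *: Q^`().[x^-1]).
    exact: (@is_deriveM _ _ (horner Q) (expR \o -%R)).
  have := @is_derive1_comp _ g (fun y => y^-1) x _ _ dg dV.
  suff -> : flat (flat_deriv Q) x = (Q.[x^-1] *: (expR (- x^-1) * -1) +
      expR (- x^-1) *: Q^`().[x^-1]) * (- x ^- 2 *: 1) by [].
  rewrite /flat x0 /flat_deriv hornerM hornerXn hornerD hornerN exprVn.
  by rewrite /GRing.scale /=; ring.
- have flat0 P : flat P 0 = 0 by rewrite /flat ltxx.
  (* From the right the difference quotient at 0 is h^-1 Q(1/h) exp(-1/h), in absolute value at most
     C h; from the left it is 0. *)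
  have [C C0 CP] := horner_expRN_bound Q 1.
  have E : h^-1 *: (flat Q (h *: 1 + 0) - flat Q 0) @[h --> (0 : R)^'] --> (0 : R).
    apply/cvgr0Pnorm_le => e e0; near=> h.
    rewrite flat0 subr0 addr0 [h *: 1]mulr1 /flat; case: ifPn => h0; last first.
      by rewrite scaler0 normr0 ltW.
    have := CP h^-1; rewrite invr_gt0 => /(_ h0).
    rewrite expr1 invrK /GRing.scale /= mulrA => /le_trans; apply.
    apply: (@le_trans _ _ ((C + 1) * h)).
      by rewrite ler_wpM2r ?lerDl // ltW.
    rewrite -ler_pdivlMl; last by rewrite ltr_pwDr.
    apply: le_trans (ler_norm _) _; near: h; apply: dnbhs0_le.
    by rewrite mulr_gt0 // invr_gt0 ltr_pwDr.
  rewrite flat0; apply: DeriveDef; first by apply/cvg_ex; exists 0.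
  exact: cvg_lim E.
Unshelve. all: by end_near. Qed.

End FlatFunction.

Section Bump.
Context {R : realType}.

Definition step (x : R) : R := flat 1 x / (flat 1 x + flat 1 (1 - x)).

Lemma flat1_ge0 (x : R) : 0 <= flat 1 x.
Proof. by rewrite /flat; case: ifP => // _; rewrite hornerC mul1r expR_ge0. Qed.

Lemma flat1_gt0 (x : R) : 0 < x -> 0 < flat 1 x.
Proof. by move=> x0; rewrite /flat x0 hornerC mul1r expR_gt0. Qed.

Lemma flat1_le0 (x : R) : x <= 0 -> flat 1 x = 0.
Proof. by move=> x0; rewrite /flat ltNge x0. Qed.

Lemma step_den_gt0 (x : R) : 0 < flat 1 x + flat 1 (1 - x).
Proof.
have [x0|x0] := leP x 0; first by rewrite ltr_wpDl ?flat1_ge0 // flat1_gt0 //; lra.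
by rewrite ltr_wpDr ?flat1_ge0 // flat1_gt0.
Qed.

Lemma step_ge0 (x : R) : 0 <= step x.
Proof. by rewrite divr_ge0 ?flat1_ge0 // ltW // step_den_gt0. Qed.

Lemma step_le1 (x : R) : step x <= 1.
Proof. by rewrite ler_pdivrMr ?step_den_gt0 // mul1r lerDl flat1_ge0. Qed.

Lemma step_eq0 (x : R) : x <= 0 -> step x = 0.
Proof. by move=> x0; rewrite /step flat1_le0 // mul0r. Qed.

Lemma step_eq1 (x : R) : 1 <= x -> step x = 1.
Proof.
move=> x1; rewrite /step (@flat1_le0 (1 - x)) ?addr0; last by lra.
by rewrite divff // gt_eqF // flat1_gt0; lra.
Qed.

Lemma Cinf_step n (U : set 'rV[R]_n) f : open U -> Cinf U f -> Cinf U (step \o f).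
Proof.
move=> oU Cf; have Cfl g : Cinf U g -> Cinf U (flat 1 \o g).
  by move=> Cg; exact: (Cinf_comp1 oU is_derive_flat Cg).
have C1 : Cinf U (flat 1 \o (cst 1 - f)).
  by apply: Cfl; apply: CinfD => //; [exact: Cinf_cst|exact: CinfN].
apply: (@CinfM _ _ _ (flat 1 \o f) (fun x => (flat 1 (f x) + flat 1 (1 - f x))^-1)) => //.
  exact: Cfl.
apply: CinfV => // [x _|]; first by rewrite gt_eqF ?step_den_gt0.
by apply: CinfD => //; exact: Cfl.
Qed.

Lemma bump_rV n (p : 'rV[R]_n) (e : R) : 0 < e -> exists b : 'rV[R]_n -> R,
  [/\ Cinf setT b, forall y, 0 <= b y <= 1,
      forall y, `|y - p| <= e -> b y = 1 &
      forall y, 2 * e <= `|y - p| -> b y = 0].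
Proof.
(* Affine in the square of the a-th coordinate of [y - p], with value 1 at e^2 and 0 at (2e)^2. The
   square keeps it smooth, and a product over [a] suits the sup norm. *)
move=> e0; pose s (a : 'I_n) (y : 'rV[R]_n) :=
  cst (4 / 3) y - (cst (3 * e ^+ 2)^-1 y) * (y 0 a - p 0 a) ^+ 2.
have e2 : 0 < 3 * e ^+ 2 by rewrite mulr_gt0 // exprn_gt0.
have sE a y : s a y = 1 + (e ^+ 2 - `|y 0 a - p 0 a| ^+ 2) / (3 * e ^+ 2).
  by rewrite /s real_normK ?num_real //=; field; rewrite gt_eqF.
exists (\prod_a (step \o s a)); split.
- apply: Cinf_prod => [|a _]; first exact: openT.
  apply: Cinf_step; first exact: openT.
  apply: CinfD; [exact: openT|exact: Cinf_cst openT|].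
  apply: CinfN; first exact: openT.
  apply: CinfM; [exact: openT|exact: Cinf_cst openT|].
  apply: (@Cinf_exp _ _ _ (fun y => y 0 a - p 0 a) 2); first exact: openT.
  apply: CinfD; first exact: openT.
    by apply: Cinf_coord; exact: openT.
  exact: Cinf_cst openT.
- move=> y; rewrite fct_prodE; apply/andP; split.
    by apply: prodr_ge0 => a _; exact: step_ge0.
  by apply: prodr_ile1 => a _; rewrite step_ge0 step_le1.
- move=> y ye; rewrite fct_prodE big1 // => a _; apply: step_eq1.
  rewrite sE lerDl divr_ge0 ?(ltW e2) // subr_ge0 lerXn2r ?nnegrE ?(ltW e0) //.
  by apply: le_trans ye; have := coord_norm_le (y - p) a; rewrite !mxE.
- move=> y ye; rewrite fct_prodE.
  have [a ha] : exists a, 2 * e <= `|y 0 a - p 0 a|.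
    apply/not_existsP => H; move: ye; apply/negP; rewrite -ltNge.
    rewrite [ltLHS]/Num.Def.normr/= mx_normrE bigmax_lt ?mulr_gt0 //.
    by move=> [i a] _; rewrite ord1 !mxE ltNge; apply/negP; exact: H.
  rewrite (bigD1 a) //= step_eq0 ?mul0r // sE.
  rewrite addrC -lerBrDr sub0r ler_pdivrMr // mulN1r lerBlDr addrC.
  have : (2 * e) ^+ 2 <= `|y 0 a - p 0 a| ^+ 2.
    by rewrite lerXn2r ?nnegrE // mulr_ge0 // ltW.
  by rewrite exprMn; lra.
Qed.

End Bump.

(** * Hadamard's lemma *)

Section Hadamard.
Context {R : realType}.

Lemma continuous_subf (f g : R -> R) : continuous f -> continuous g ->
  continuous (fun t => f t - g t).
Proof. by move=> cf cg t; exact: (continuousB (cf t) (cg t)). Qed.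

Lemma continuous_mulf (f g : R -> R) : continuous f -> continuous g ->
  continuous (fun t => f t * g t).
Proof. by move=> cf cg t; exact: (continuousM (cf t) (cg t)). Qed.

Definition int01 (g : R -> R) : R :=
  \int[@lebesgue_measure R]_(t in `[0, 1]) g t.

Lemma int01_integrable (g : R -> R) : continuous g ->
  (@lebesgue_measure R).-integrable `[0, 1] (EFin \o g).
Proof.
move=> cg; apply: continuous_compact_integrable; first exact: segment_compact.
exact: continuous_subspaceT.
Qed.

Lemma int01B (f g : R -> R) : continuous f -> continuous g ->
  int01 (fun t => f t - g t) = int01 f - int01 g.
Proof. by move=> cf cg; rewrite /int01 RintegralB //; exact: int01_integrable. Qed.

Lemma int01D (f g : R -> R) : continuous f -> continuous g ->
  int01 (fun t => f t + g t) = int01 f + int01 g.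
Proof. by move=> cf cg; rewrite /int01 RintegralD //; exact: int01_integrable. Qed.

Lemma int01Z (c : R) (g : R -> R) : continuous g ->
  int01 (fun t => c * g t) = c * int01 g.
Proof. by move=> cg; rewrite /int01 RintegralZl //; exact: int01_integrable. Qed.

Lemma int01_bound (g : R -> R) e : continuous g ->
  (forall t, 0 <= t <= 1 -> `|g t| <= e) -> `|int01 g| <= e.
Proof.
move=> cg ge; rewrite /int01.
apply: le_trans (le_normr_Rintegral _ (int01_integrable cg)) _ => //.
have -> : e = \int[@lebesgue_measure R]_(t in `[0, 1]) e.
  by rewrite Rintegral_cst //= lebesgue_measure_itv /= lte01 oppr0 adde0 mulr1.
apply: le_Rintegral => //.
- apply: (@int01_integrable (fun t => `|g t|)) => t.
  by apply: continuous_comp (cg t) _; exact: norm_continuous.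
- by apply: (@int01_integrable (cst e)) => t; exact: cst_continuous.
Qed.

Lemma int01_FTC (F f : R -> R) : continuous f ->
  (forall t : R, is_derive t 1 F (f t)) -> int01 f = F 1 - F 0.
Proof.
move=> cf dF; have cF t : {for t, continuous F}.
  by apply/differentiable_continuous/derivable1_diffP; have [] := dF t.
rewrite /int01 /Rintegral (@continuous_FTC2 _ f F) //.
- exact: continuous_subspaceT.
- split; first by move=> t _; have [] := dF t.
    exact/cvg_at_right_filter/cF.
  exact/cvg_at_left_filter/cF.
- by move=> t _; rewrite derive1E; have [_ ->] := dF t.
Qed.

(** * Averages along the segments from the origin *)

Section UniformSegment.
Context {n : nat}.
Implicit Types (f : 'rV[R]_n -> R) (x : 'rV[R]_n).

(** By compactness of [0, 1], the continuity of (t, y) |-> f (t y) at the points (t, x) becomes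
    uniform in t. This justifies both limits and derivatives under the integral. *)
Lemma scale_cvg_near f (e : R) x : 0 < e -> continuous f ->
  \forall y \near x, forall t : R, 0 <= t <= 1 -> `|f (t *: y) - f (t *: x)| <= e.
Proof.
move=> e0 cf.
have /compact_near_coveringP cov := @segment_compact R 0 1.
have H : \forall y \near x, `[0, 1] `<=` (fun t => `|f (t *: y) - f (t *: x)| <= e).
  apply: (cov _ (nbhs x) (fun y t => `|f (t *: y) - f (t *: x)| <= e)
    (nbhs_filter x)) => t _.
  have e2 : 0 < e / 2 by rewrite divr_gt0.
  have c1 : f (z.1 *: z.2) @[z --> (nbhs t, nbhs x)] --> f (t *: x).
    apply: (@cvg_comp _ _ _ (fun z : R * 'rV[R]_n => z.1 *: z.2) f _
      (nbhs (t *: x))); last exact: cf.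
    by apply: cvgZ; [exact: cvg_fst|exact: cvg_snd].
  have c2 : f (z.1 *: x) @[z --> (nbhs t, nbhs x)] --> f (t *: x).
    apply: (@cvg_comp _ _ _ (fun z : R * 'rV[R]_n => z.1 *: x) f _
      (nbhs (t *: x))); last exact: cf.
    by apply: cvgZ; [exact: cvg_fst|exact: cvg_cst].
  move/cvgrPdist_le : c1 => /(_ _ e2) c1; move/cvgrPdist_le : c2 => /(_ _ e2) c2.
  apply: filterS2 c1 c2 => z /= h1 h2.
  rewrite [e]splitr -(subrKA (f (t *: x))) (le_trans (ler_normD _ _)) // lerD //.
  by rewrite distrC.
by apply: filterS H => y H t t01; apply: H; rewrite /= in_itv.
Qed.

Lemma scale_continuous_t f x : continuous f -> continuous (fun t : R => f (t *: x)).
Proof.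
move=> cf t; apply: (@continuous_comp _ _ _ (fun t : R => t *: x) f); last exact: cf.
exact: scalel_continuous.
Qed.

(** The factor t^m accounts for derivatives: each derivative in [x] brings out one more t.
    Hadamard's quotients are averages of partial derivatives with m = 0. *)
Definition ray_avg (m : nat) f (x : 'rV[R]_n) : R :=
  int01 (fun t => t ^+ m * f (t *: x)).

Lemma ray_integrand_continuous m f x : continuous f ->
  continuous (fun t : R => t ^+ m * f (t *: x)).
Proof.
move=> cf; apply: continuous_mulf; last exact: scale_continuous_t.
exact: exprn_continuous.
Qed.

Lemma ray_avg_continuous m f : continuous f -> continuous (ray_avg m f).
Proof.
move=> cf x; apply/(@cvgrPdist_le _ _ _ (nbhs x) (nbhs_filter x)) => e e0.
apply: filterS (scale_cvg_near x e0 cf) => y fy.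
rewrite distrC -int01B; do ?exact: ray_integrand_continuous.
apply: int01_bound => [|t t01].
  by apply: continuous_subf; exact: ray_integrand_continuous.
rewrite -mulrBr normrM; apply: le_trans (fy t t01).
case/andP: t01 => t0 t1; rewrite ger0_norm ?exprn_ge0 // ler_piMl //.
exact: exprn_ile1.
Qed.

Lemma Cinf_setT_continuous f : Cinf setT f -> continuous f.
Proof. by move=> Cf x; exact: Cinf_continuous Cf _. Qed.

(* Differentiation under the integral sign, from the mean value theorem and the
   uniform continuity of the partial derivatives along a segment. *)
Lemma ray_avg_partial m f j x : Cinf setT f ->
  is_derive x (delta_mx 0 j) (ray_avg m f) (ray_avg m.+1 (partial j f) x).
Proof.
move=> Cf; have cf := Cinf_setT_continuous Cf.
have cj := Cinf_setT_continuous (Cinf_partial j Cf).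
set v := delta_mx 0 j.
have nv (h : R) : `|h *: v| <= `|h|.
  apply: norm_rV_le => // a; rewrite !mxE /=.
  by case: (a == j); rewrite ?mulr1 // mulr0 normr0.
have E : h^-1 *: (ray_avg m f (h *: v + x) - ray_avg m f x) @[h --> (0 : R)^'] -->
    ray_avg m.+1 (partial j f) x.
  apply/cvgrPdist_le => e e0.
  have /nbhs_ballP[d /= d0 dP] := scale_cvg_near x e0 cj.
  near=> h.
  have h0 : h != 0 by near: h; exact: nbhs_dnbhs_neq.
  have hd : `|h| < d by near: h; exact: dnbhs0_lt.
  have cfh y : continuous (fun t : R => t ^+ m * f (t *: y)).
    exact: ray_integrand_continuous.
  rewrite /ray_avg -int01B // -[_ *: int01 _]int01Z; last first.
    by apply: continuous_subf; exact: cfh.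
  have c1 : continuous (fun t : R => t ^+ m.+1 * partial j f (t *: x)).
    exact: ray_integrand_continuous.
  have c2 : continuous (fun t : R =>
      h^-1 * (t ^+ m * f (t *: (h *: v + x)) - t ^+ m * f (t *: x))).
    apply: continuous_mulf; first exact: cst_continuous.
    by apply: continuous_subf; exact: cfh.
  rewrite -int01B //; apply: int01_bound => [|t /andP[t0 t1]].
    by apply: continuous_subf; [exact: c1|exact: c2].
  pose c s := s *: (t *: v) + t *: x.
  have [|s sh sE] := @MVT0 R (f \o c) (fun s => t * partial j f (c s)) h.
    move=> s _; have dc a : is_derive s 1 (fun s => c s 0 a) ((t *: v) 0 a).
      have [d1 d2] := is_derive_coord a (s *: (t *: v) + t *: x) (t *: v).
      by rewrite -d2; exact: is_derive_line.
    have -> : t * partial j f (c s) = \sum_a (t *: v) 0 a * partial a f (c s).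
      rewrite (bigD1 j) //= !mxE !eqxx mulr1 big1 ?addr0 // => a aj.
      by rewrite !mxE (negbTE aj) mulr0 mul0r.
    exact: (chain_curve openT I (Cf 1%N)).
  have -> : t ^+ m.+1 * partial j f (t *: x) -
      h^-1 * (t ^+ m * f (t *: (h *: v + x)) - t ^+ m * f (t *: x)) =
      t ^+ m.+1 * (partial j f (t *: x) - partial j f (c s)).
    rewrite -mulrBr mulrCA; have -> : f (t *: (h *: v + x)) - f (t *: x) =
        h * (t * partial j f (c s)).
      rewrite -sE /= /c scale0r add0r; congr (f _ - _).
      by rewrite scalerDr !scalerA mulrC.
    by rewrite mulKf // exprSr; ring.
  rewrite normrM distrC ger0_norm ?exprn_ge0 //.
  have -> : c s = t *: (s *: v + x) by rewrite /c scalerDr !scalerA mulrC.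
  apply: (@le_trans _ _ `|partial j f (t *: (s *: v + x)) - partial j f (t *: x)|).
    by rewrite ler_piMl // exprn_ile1.
  apply: dP; last by rewrite t0.
  rewrite -ball_normE /ball_ /= opprD addrCA subrr addr0 normrN.
  by apply: le_lt_trans (nv s) _; exact: le_lt_trans sh hd.
by apply: DeriveDef; [apply/cvg_ex; eexists; exact: E|exact: cvg_lim E].
Unshelve. all: by end_near. Qed.

Lemma Cinf_ray_avg m f : Cinf setT f -> Cinf setT (ray_avg m f).
Proof.
move=> Cf k; elim: k m f Cf => [|k IH] m f Cf.
  by split=> // x _; apply: ray_avg_continuous; exact: Cinf_setT_continuous.
split; first exact: Ck_continuous (IH m f Cf).
move=> j; split; first by move=> x _; have [] := ray_avg_partial m j x Cf.
apply: (@Ck_ext _ _ _ _ (ray_avg m.+1 (partial j f))); first exact: openT.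
  by move=> x _; have [_ /esym] := ray_avg_partial m j x Cf.
by apply: IH; exact: Cinf_partial.
Qed.

(** The fundamental theorem of calculus for t |-> f (t y), whose derivative is the sum of the y_a
    (partial a f) (t y). *)
Lemma hadamard0 f y : Cinf setT f ->
  f y = f 0 + \sum_a y 0 a * ray_avg 0 (partial a f) y.
Proof.
move=> Cf; pose F t := f (t *: y).
pose dF t := \sum_a y 0 a * partial a f (t *: y).
have dFP (t : R) : is_derive t 1 F (dF t).
  have dc a : is_derive t 1 (fun s => (s *: y) 0 a) (y 0 a).
    have [d1 d2] := is_derive_coord a (t *: y + 0) y.
    rewrite -d2; have := is_derive_line d1.
    by under eq_fun do rewrite addr0.
  exact: (chain_curve openT I (Cf 1%N) dc).
have c1 a : continuous (fun t : R => y 0 a * partial a f (t *: y)).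
  apply: continuous_mulf; first exact: cst_continuous.
  apply: scale_continuous_t; apply: Cinf_setT_continuous; exact: Cinf_partial.
have cdF (s : seq 'I_n) :
    continuous (fun t : R => \sum_(a <- s) y 0 a * partial a f (t *: y)).
  by apply: continuous_big => // ; exact: add_continuous.
have := int01_FTC (cdF (index_enum 'I_n)) dFP.
rewrite /F scale1r scale0r => /esym/eqP; rewrite subr_eq => /eqP ->.
rewrite addrC; congr (_ + _).
elim: (index_enum 'I_n) => [|a s IH].
  rewrite big_nil -[RHS](mul0r (int01 (cst 0))) -int01Z; last exact: cst_continuous.
  by congr int01; apply/funext => t; rewrite big_nil mul0r.
rewrite big_cons -IH -int01Z; last first.
  apply: ray_integrand_continuous; apply: Cinf_setT_continuous; exact: Cinf_partial.
rewrite -int01D //; last first.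
  apply: continuous_mulf; first exact: cst_continuous.
  apply: ray_integrand_continuous; apply: Cinf_setT_continuous; exact: Cinf_partial.
by congr int01; apply/funext => t; rewrite big_cons expr0 mul1r.
Qed.

Lemma hadamard f x : Cinf setT f ->
  exists2 g : 'I_n -> 'rV[R]_n -> R, forall a, Cinf setT (g a) &
    forall y, f y = f x + \sum_a (y 0 a - x 0 a) * g a y.
Proof.
move=> Cf; have tr (z : 'rV[R]_n) (h : 'rV[R]_n -> R) :
    Cinf setT h -> Cinf setT (fun y => h (y + z)).
  move=> Ch; apply: (@Cinf_comp _ _ _ setT setT h (fun y => y + z)) => //;
    do ?exact: openT.
  move=> a; apply: (@Cinf_ext _ _ _ ((fun y => y 0 a) + cst (z 0 a))) => //;
    first exact: openT.
    by move=> y _; rewrite [RHS]mxE.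
  by apply: CinfD; [exact: openT|exact: Cinf_coord openT|exact: Cinf_cst openT].
pose h y := f (y + x).
exists (fun a y => ray_avg 0 (partial a h) (y - x)) => [a|y].
  apply: (tr (- x) (ray_avg 0 (partial a h))); apply: Cinf_ray_avg.
  by apply: Cinf_partial; exact: tr.
have := hadamard0 (y - x) (tr x f Cf); rewrite subrK add0r => ->.
by congr (_ + _); apply: eq_bigr => a _; rewrite !mxE.
Qed.

End UniformSegment.
End Hadamard.

(** * Taylor coefficients along curves *)

Section Taylor.
Context {R : realType}.
Implicit Types (f g : R -> R) (p : {poly R}).

Definition taylor g (k : nat) : R := derive1n k g 0 / (k`!)%:R.

Definition smooth1 g : Prop := forall k (t : R), derivable (derive1n k g) t 1.

Lemma derive1n_succ k g (t : R) : derive1n k.+1 g t = 'D_1 (derive1n k g) t.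
Proof. by rewrite derive1nS derive1E. Qed.

Lemma derive1nB k f g : smooth1 f -> smooth1 g ->
  derive1n k (f - g) = derive1n k f - derive1n k g.
Proof.
move=> sf sg; elim: k => // k IH; apply/funext => t.
by rewrite derive1n_succ IH deriveB // -!derive1n_succ.
Qed.

Lemma taylorB k f g : smooth1 f -> smooth1 g ->
  taylor (f - g) k = taylor f k - taylor g k.
Proof. by move=> sf sg; rewrite /taylor derive1nB // mulrBl. Qed.

Lemma derive1n_cst k (a : R) : derive1n k (cst a) = cst (a *+ (k == 0%N)).
Proof.
elim: k => // k IH; apply/funext => t.
by rewrite derive1n_succ IH derive_cst.
Qed.

Lemma taylor_cst k (a : R) : taylor (cst a) k = a *+ (k == 0%N).
Proof.
rewrite /taylor derive1n_cst /=; case: k => [|k]; first by rewrite fact0 divr1.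
by rewrite mul0r.
Qed.

Lemma smooth1_taylor_at k g (t : R) : smooth1 g ->
  is_derive t 1 (fun t => derive1n k g t / (k`!)%:R)
    (k.+1%:R * (derive1n k.+1 g t / (k.+1`!)%:R)).
Proof.
move=> sg; have -> : (fun t => derive1n k g t / (k`!)%:R) =
    (k`!)%:R^-1 *: derive1n k g by apply/funext => s; exact: mulrC.
have -> : k.+1%:R * (derive1n k.+1 g t / (k.+1`!)%:R) =
    (k`!)%:R^-1 *: 'D_1 (derive1n k g) t.
  rewrite derive1n_succ factS natrM invfM /GRing.scale /=.
  by rewrite mulrCA mulVKf ?pnatr_eq0 // mulrC.
by apply: is_deriveZ; apply/derivableP.
Qed.

(** Leibniz's rule in terms of u_i = f^(i) / i!, for which u_i' = (i+1) u_(i+1), so that no binomial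
    coefficients occur. *)
Lemma derive1nM k f g : smooth1 f -> smooth1 g ->
  derive1n k (f * g) = (fun t => (k`!)%:R * \sum_(i < k.+1)
    (derive1n i f t / (i`!)%:R) * (derive1n (k - i) g t / ((k - i)`!)%:R)).
Proof.
move=> sf sg; elim: k => [|k IH].
  by apply/funext => t; rewrite big_ord1 fact0 !divr1 mul1r.
apply/funext => t; rewrite derive1n_succ IH.
pose u i t := derive1n i f t / (i`!)%:R; pose v i t := derive1n i g t / (i`!)%:R.
have D : is_derive t 1 (\sum_(i < k.+1) u i * v (k - i)%N)
    (\sum_(i < k.+1) (u i t *: ((k - i).+1%:R * v (k - i).+1 t) +
       v (k - i)%N t *: (i.+1%:R * u i.+1 t))).
  apply: is_derive_sum => i.
  by apply: is_deriveM; exact: smooth1_taylor_at.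
have -> : (fun t => (k`!)%:R * \sum_(i < k.+1) u i t * v (k - i)%N t) =
    (k`!)%:R *: \sum_(i < k.+1) u i * v (k - i)%N.
  by apply/funext => s; rewrite [RHS]/(_ * _) fct_sumE.
have [D1 D2] := D; rewrite deriveZ // D2 factS natrM [in RHS]mulrC /GRing.scale /=.
rewrite mulrA [RHS]mulrC; congr (_ * _).
rewrite -[X in _ = X * _]/(\sum_(i < k.+2) u i t * v (k.+1 - i)%N t).
rewrite big_split /= [RHS]mulrC mulr_sumr.
(* The factor k+1 is split as (k+1-i) + i. The two halves are the two terms of the product rule, the
   second with its index shifted by one. *)
transitivity (\sum_(i < k.+2) ((k.+1 - i)%:R * (u i t * v (k.+1 - i)%N t) +
   i%:R * (u i t * v (k.+1 - i)%N t))); last first.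
  by apply: eq_bigr => i _; rewrite -mulrDl -natrD subnK // -ltnS.
rewrite big_split /=; congr (_ + _).
  rewrite [RHS]big_ord_recr /= subnn mul0r addr0; apply: eq_bigr => i _.
  by rewrite subSn 1?mulrCA // -ltnS.
rewrite [RHS]big_ord_recl /= mul0r add0r; apply: eq_bigr => i _.
by rewrite /bump /= add1n subSS; ring.
Qed.

Lemma taylorM k f g : smooth1 f -> smooth1 g ->
  taylor (f * g) k = \sum_(i < k.+1) taylor f i * taylor g (k - i).
Proof.
by move=> sf sg; rewrite /taylor derive1nM // mulrC mulKf // pnatr_eq0 -lt0n fact_gt0.
Qed.

Lemma derive1n_near k f g : (\forall t \near (0 : R), f t = g t) ->
  \forall t \near (0 : R), derive1n k f t = derive1n k g t.
Proof.
move=> fg; elim: k => // k IH.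
apply: filterS (near_join IH) => t H.
by rewrite !derive1n_succ; exact: near_eq_derive.
Qed.

Lemma taylor_near k f g : (\forall t \near (0 : R), f t = g t) -> taylor f k = taylor g k.
Proof.
by move=> /(derive1n_near k) /nbhs_singleton E; rewrite /taylor E.
Qed.

Lemma derive1n_horner k p : derive1n k (horner p) = horner (p^`(k)).
Proof. by elim: k => // k IH; rewrite derive1nS IH -derivE derivnS. Qed.

Lemma taylor_horner p k : taylor (horner p) k = p`_k.
Proof.
rewrite /taylor derive1n_horner horner_coef0 coef_derivn addn0 ffactnn.
by rewrite -[p`_k *+ _]mulr_natr mulfK // pnatr_eq0 -lt0n fact_gt0.
Qed.

Lemma derive1n_line n (f : 'rV[R]_n -> R) j x k : Cinf setT f ->
  derive1n k (fun t => f (t *: delta_mx 0 j + x)) =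
  (fun t => iter k (partial j) f (t *: delta_mx 0 j + x)) /\
  Cinf setT (iter k (partial j) f).
Proof.
move=> Cf; elim: k => // k [IH Ck]; split; last exact: Cinf_partial.
apply/funext => t; rewrite derive1n_succ IH.
have d := Cinf_derivable (j := j) Ck (I : setT (t *: delta_mx 0 j + x)).
by have [_ ->] := is_derive_line d.
Qed.

Lemma smooth1_line n (f : 'rV[R]_n -> R) j x : Cinf setT f ->
  smooth1 (fun t => f (t *: delta_mx 0 j + x)).
Proof.
move=> Cf k t; have [-> Ck] := derive1n_line j x k Cf.
have d := Cinf_derivable (j := j) Ck (I : setT (t *: delta_mx 0 j + x)).
by have [] := is_derive_line d.
Qed.

Lemma Cinf_horner n (U : set 'rV[R]_n) (f : 'rV[R]_n -> R) p : open U ->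
  Cinf U f -> Cinf U (fun x => p.[f x]).
Proof.
move=> oU Cf; elim/poly_ind: p => [|p c IH].
  by apply: (Cinf_ext oU _ (Cinf_cst 0 oU)) => x _; rewrite horner0.
apply: (Cinf_ext oU _ (CinfD oU (CinfM oU IH Cf) (Cinf_cst c oU))) => x _.
by rewrite hornerMXaddC.
Qed.

(** * Polynomial curves depending on parameters *)

Section Curves.
Context {n : nat}.
Implicit Types (phi : 'rV[R]_n -> R) (C : 'I_n -> {poly R}) (y : 'rV[R]_n).

Definition pcurve C (t : R) : 'rV[R]_n := \row_a (C a).[t].

Definition perturb C (w : 'I_n -> nat) y (a : 'I_n) : {poly R} :=
  C a + y 0 a *: 'X^(w a).

(** Time and parameters are joined in one space: coordinate 0 of ['rV_n.+1] is the time, the others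
    are the parameters [y], and [pad y] is the point at time 0. *)
Let pad y : 'rV[R]_n.+1 := \row_i oapp (y 0) 0 (unlift ord0 i).

Let Gam C (w : 'I_n -> nat) (z : 'rV[R]_n.+1) : 'rV[R]_n :=
  \row_a ((C a).[z 0 ord0] + z 0 (fintype.lift ord0 a) * z 0 ord0 ^+ w a).

Lemma pcurve_perturb C w y t :
  pcurve (perturb C w y) t = Gam C w (t *: delta_mx 0 ord0 + pad y).
Proof.
apply/rowP => a; rewrite !mxE /= liftK unlift_none /= mulr1 mulr0.
by rewrite addr0 add0r hornerD hornerZ hornerXn.
Qed.

Let Cinf_Gam C w phi : Cinf setT phi -> Cinf setT (phi \o Gam C w).
Proof.
move=> Cphi; apply: (@Cinf_comp _ _ _ setT setT) => //; do ?[exact: openT].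
move=> a; apply: (@Cinf_ext _ _ _ ((fun z : 'rV[R]_n.+1 => (C a).[z 0 ord0]) +
    (fun z : 'rV[R]_n.+1 => z 0 (fintype.lift ord0 a)) *
    (fun z : 'rV[R]_n.+1 => ('X^(w a)).[z 0 ord0]))); first exact: openT.
  by move=> z _; rewrite [RHS]mxE -[z 0 ord0 ^+ _]hornerXn.
apply: CinfD; first exact: openT.
  by apply: Cinf_horner; [exact: openT|exact: Cinf_coord openT].
apply: CinfM; [exact: openT|exact: Cinf_coord openT|].
by apply: Cinf_horner; [exact: openT|exact: Cinf_coord openT].
Qed.

(** Up to [k!] the coefficient is the k-th partial derivative of [phi \o Gam C w] in the time
    variable, taken at time 0, hence smooth in the parameters. *)
Lemma taylor_perturb_Cinf C w phi k : Cinf setT phi ->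
  Cinf setT (fun y => taylor (phi \o pcurve (perturb C w y)) k).
Proof.
move=> /(Cinf_Gam C w) CG.
have E y : taylor (phi \o pcurve (perturb C w y)) k =
    (iter k (partial ord0) (phi \o Gam C w) \o pad) y * (k`!)%:R^-1.
  rewrite /taylor; have -> : phi \o pcurve (perturb C w y) =
      (fun t => (phi \o Gam C w) (t *: delta_mx 0 ord0 + pad y)).
    by apply/funext => t; rewrite /= pcurve_perturb.
  have [-> _] := derive1n_line ord0 (pad y) k CG.
  by rewrite scale0r add0r.
apply: (@Cinf_ext _ _ _ ((iter k (partial ord0) (phi \o Gam C w) \o pad) *
   cst (k`!)%:R^-1)); first exact: openT.
  by move=> y _; rewrite E.
apply: CinfM; [exact: openT| |exact: Cinf_cst openT].
apply: (@Cinf_comp _ _ _ setT setT) => //; do ?exact: openT.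
  move=> i; have [j ij|ij] := unliftP ord0 i.
    apply: (Cinf_ext openT _ (Cinf_coord j openT)) => y _.
    by rewrite mxE ij liftK.
  apply: (Cinf_ext openT _ (Cinf_cst 0 openT)) => y _.
  by rewrite mxE ij unlift_none.
by have [] := derive1n_line ord0 0 k CG.
Qed.

Lemma smooth1_pcurve phi C : Cinf setT phi -> smooth1 (phi \o pcurve C).
Proof.
move=> Cphi; have CG := Cinf_Gam C (fun=> 0%N) Cphi.
have -> : phi \o pcurve C =
    (fun t => (phi \o Gam C (fun=> 0%N)) (t *: delta_mx 0 ord0 + pad 0)).
  apply/funext => t; rewrite /= -pcurve_perturb; congr (phi _).
  by apply/rowP => a; rewrite !mxE /perturb mxE scale0r addr0.
exact: smooth1_line.
Qed.

End Curves.
End Taylor.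

(** * Smooth functions in charts *)

Section SmoothCharts.
Context {R : realType} {n : nat} (M : manifold R n).
Implicit Types (U V : set M) (f g : M -> R) (c d : chart R M n) (p q : M).

Lemma atlas_coord_chart c : atlas c -> coord_chart c.
Proof. by move=> ac d ad; split; exact: atlas_compatible. Qed.

Lemma smooth_on_sub U V f : V `<=` U -> smooth_on U f -> smooth_on V f.
Proof.
move=> VU sf c ac; apply: Cinf_sub (sf c ac) => _ [q [Vq dq] <-].
by exists q => //; split=> //; exact: VU.
Qed.

Lemma smooth_on_local U f :
  (forall p, U p -> exists V, [/\ open V, V p & smooth_on V f]) -> smooth_on U f.
Proof.
move=> Uf c ac; apply: Cinf_local => _ [q [Uq dq] <-].
have [V [oV Vq sf]] := Uf q Uq.
exists (coord c @` (V `&` dom c)); split; last exact: sf.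
  exact: open_coord_image.
by exists q.
Qed.

Lemma smooth_on_ext U f g : open U -> {in U, f =1 g} -> smooth_on U f ->
  smooth_on U g.
Proof.
move=> oU fg sf c ac; apply: Cinf_ext (sf c ac); first exact: open_coord_image.
move=> _ /[1!inE] -[q [Uq dq] <-] /=; rewrite coordK ?inE //.
by apply: fg; rewrite inE.
Qed.

(** [smooth_on] tests only charts of the atlas. A chart of the maximal atlas is compared near each
    point with one of these through the transition map. *)
Lemma smooth_in_chart c U f : coord_chart c -> open U -> smooth_on U f ->
  Cinf (coord c @` (U `&` dom c)) (f \o icoord c).
Proof.
move=> cc oU sf; apply: Cinf_local => _ [q [Uq cq] <-].
have [d ad dq] := atlas_cover q; have [ccd cdc] := cc d ad.
have oUd : open (U `&` dom d) by apply: openI => //; exact: dom_open.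
pose V := coord c @` (U `&` dom d `&` dom c).
have oV : open V by exact: open_coord_image.
exists V; split=> //; first by exists q.
apply: (@Cinf_ext _ _ _ ((f \o icoord d) \o (coord d \o icoord c))) => //.
  move=> _ /[1!inE] -[x [[Ux dx] cx] <-] /=.
  by rewrite (coordK (c := c)) ?inE // (coordK (c := d)) ?inE.
apply: Cinf_comp (sf d ad) => //; first exact: open_coord_image.
  move=> _ [x [[Ux dx] cx] <-] /=; rewrite (coordK (c := c)) ?inE //.
  by exists x.
move=> a; apply: Cinf_sub (ccd a) => _ [x [[Ux dx] cx] <-].
by exists x.
Qed.

Lemma smooth_of_chart c U (O : set 'rV[R]_n) (phi : 'rV[R]_n -> R) :
  coord_chart c -> open U -> U `<=` dom c -> open O ->
  (forall q, U q -> O (coord c q)) -> Cinf O phi -> smooth_on U (phi \o coord c).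
Proof.
move=> cc oU Uc oO UO Cphi d ad; have [ccd cdc] := cc d ad.
apply: (@Cinf_comp _ _ _ _ O phi (coord c \o icoord d)) => //.
- exact: open_coord_image.
- by move=> _ [x [Ux dx] <-] /=; rewrite coordK ?inE //; exact: UO.
move=> a; apply: Cinf_sub (cdc a) => _ [x [Ux dx] <-].
by exists x => //; split=> //; exact: Uc.
Qed.

(** Stated in coordinates, since [b] serves both [cut] and [pull]. Its support lies in a compact
    subset of the chart image, so that extension by zero is smooth on [M] as well as on R^n. *)
Definition cutoff c p U (b : 'rV[R]_n -> R) : Prop :=
  [/\ Cinf setT b, forall y, 0 <= b y <= 1, \forall y \near coord c p, b y = 1 &
      exists B, [/\ compact B, B `<=` coord c @` (U `&` dom c) &
        forall y, ~ B y -> b y = 0]].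

Lemma cutoff_exists c p U : open U -> U p -> dom c p -> exists b, cutoff c p U b.
Proof.
move=> oU Up cp; set x := coord c p.
have /nbhs_ballP[e /= e0 eU] : nbhs x (coord c @` (U `&` dom c)).
  by apply: open_nbhs_nbhs; split; [exact: open_coord_image|exists p].
(* The bump function of radius e/4 vanishes from e/2 on; the closed ball of radius e/2 is compact
   and lies inside the ball of radius e. *)
have e40 : 0 < e / 4 by rewrite divr_gt0.
have [b [Cb b01 b1 b0]] := bump_rV x e40.
exists b; split=> //.
  apply/nbhs_ballP; exists (e / 4) => //= y xy; apply: b1.
  by rewrite distrC ltW //; move: xy; rewrite -ball_normE.
exists (closed_ball x (e / 2)); split.
- apply: bounded_closed_compact; last exact: closed_ball_closed.
  exists (`|x| + e / 2); split; first by rewrite num_real.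
  move=> m hm y; rewrite closed_ballE ?divr_gt0 // /closed_ball_ /= => xy.
  apply: le_trans (ltW hm); rewrite -[y](subrK x) addrC.
  by apply: le_trans (ler_normD _ _) _; rewrite lerD2l distrC.
- move=> y; rewrite closed_ballE ?divr_gt0 // /closed_ball_ /= => xy; apply: eU.
  rewrite -ball_normE /ball_ /=; apply: le_lt_trans xy _.
  by rewrite ltr_pdivrMr // ltr_pMr // ltr1n.
- move=> y; rewrite closed_ballE ?divr_gt0 // /closed_ball_ /= => /negP.
  rewrite -ltNge => xy; apply: b0; rewrite distrC; apply: le_trans (ltW xy).
  by rewrite [leRHS](_ : _ = 2 * (e / 4)) //; field.
Qed.

Lemma coord_near c p (P : 'rV[R]_n -> Prop) : dom c p ->
  (\forall y \near coord c p, P y) -> \forall q \near p, dom c q /\ P (coord c q).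
Proof.
move=> cp H; apply: filterI; first by apply: open_nbhs_nbhs; split=> //; exact: dom_open.
by apply: (coord_continuous (c := c)) H; rewrite inE.
Qed.

Definition cut c (b : 'rV[R]_n -> R) g : M -> R :=
  fun q => if q \in dom c then b (coord c q) * g q else 0.

(** Outside the chart image [icoord] is meaningless, but there a [cutoff] vanishes. *)
Definition pull c (b : 'rV[R]_n -> R) f : 'rV[R]_n -> R :=
  fun y => b y * f (icoord c y).

Section Cutoff.
Variables (c : chart R M n) (p : M) (U : set M) (b : 'rV[R]_n -> R).
Hypotheses (cc : coord_chart c) (oU : open U) (cp : dom c p).
Hypothesis (cb : cutoff c p U b).

Lemma cut_near g : \forall q \near p, cut c b g q = g q.
Proof.
have [_ _ b1 _] := cb; apply: filterS (coord_near cp b1) => q [cq bq].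
by rewrite /cut mem_set // bq mul1r.
Qed.

Lemma smooth_cutoff : smooth_on (dom c) (b \o coord c).
Proof.
have [Cb _ _ _] := cb.
by apply: smooth_of_chart Cb => //; [exact: dom_open|exact: openT].
Qed.

(** The support is the image of a compact set, hence compact, hence closed because [M] is
    Hausdorff. *)
Lemma cut_support : exists A, [/\ closed A, A `<=` U `&` dom c &
  forall g q, ~ A q -> cut c b g q = 0].
Proof.
have [Cb _ _ [B [cB BU B0]]] := cb; exists (icoord c @` B); split.
- apply: compact_closed; first exact: manifold_hausdorff.
  apply: continuous_compact => //; apply: continuous_in_subspaceT => y /[1!inE] By.
  apply: (icoord_continuous (c := c)); rewrite inE.
  by have [q [_ cq] <-] := BU y By; exists q.
- move=> _ [y /BU[q [Uq cq] <-] <-]; by rewrite coordK ?inE.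
- move=> g q nA; rewrite /cut; case: ifPn => // /[1!inE] cq.
  rewrite B0 ?mul0r // => Bq; apply: nA; exists (coord c q) => //.
  by rewrite coordK ?inE.
Qed.

Lemma cutE g : {in U `&` dom c, cut c b g =1 (b \o coord c) * g}.
Proof. by move=> q /[1!inE] -[_ cq]; rewrite /cut mem_set. Qed.

(** Two open sets cover [M]: on the intersection of [U] and [dom c] the function is a product with a
    smooth one, and off the closed support it is zero. The same cover serves [cut_fil]. *)
Lemma cut_smooth g : smooth_on (U `&` dom c) g -> smooth_on setT (cut c b g).
Proof.
move=> sg; have [A [cA AU A0]] := cut_support; have oUc : open (U `&` dom c).
  by apply: openI => //; exact: dom_open.
apply: smooth_on_local => q _; have [Aq|nAq] := pselect (A q).
  exists (U `&` dom c); split=> //; first exact: AU.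
  apply: (@smooth_on_ext _ ((b \o coord c) * g)) => //.
    by move=> x xU; rewrite (cutE g xU).
  by apply: smooth_onM => //; apply: smooth_on_sub smooth_cutoff; exact: subIsetr.
exists (~` A); split=> //; first exact: closed_openC.
apply: (@smooth_on_ext _ (cst 0)); first exact: closed_openC.
  by move=> x /[1!inE] nA; rewrite A0.
by apply: smooth_on_cst; exact: closed_openC.
Qed.

Lemma cut_fil r (W : weighting M r) i g : W i (U `&` dom c) g ->
  W i setT (cut c b g).
Proof.
move=> Wg; have [A [cA AU A0]] := cut_support; have oUc : open (U `&` dom c).
  by apply: openI => //; exact: dom_open.
apply: (fil_glue openT) => q _; have [Aq|nAq] := pselect (A q).
  exists (U `&` dom c); split=> //; first exact: AU.
  apply: (@fil_ext _ _ _ _ _ _ _ ((b \o coord c) * g)) => //.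
    by move=> x xU; rewrite (cutE g xU).
  by apply: fil_mul => //; apply: smooth_on_sub smooth_cutoff; exact: subIsetr.
exists (~` A); split=> //; first exact: closed_openC.
apply: (@fil_ext _ _ _ _ _ _ _ (cst 0)); first exact: closed_openC.
  by move=> x /[1!inE] nA; rewrite A0.
by apply: fil_zero; exact: closed_openC.
Qed.

Lemma pull_Cinf f : smooth_on (U `&` dom c) f -> Cinf setT (pull c b f).
Proof.
move=> sf; have [Cb _ _ [B [cB BU B0]]] := cb.
have oUc : open (U `&` dom c) by apply: openI => //; exact: dom_open.
apply: Cinf_local => y _; have [By|nBy] := pselect (B y).
  exists (coord c @` (U `&` dom c)); split; first exact: open_coord_image.
    exact: BU.
  apply: (@CinfM _ _ _ b (f \o icoord c)); first exact: open_coord_image.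
    exact: Cinf_sub Cb.
  apply: Cinf_sub (smooth_in_chart cc oUc sf) => _ [q [Uq cq] <-].
  by exists q.
have oB : open (~` B).
  by apply: closed_openC; apply: compact_closed => //; exact: norm_hausdorff.
exists (~` B); split=> //; apply: (Cinf_ext oB _ (Cinf_cst 0 oB)) => x /[1!inE] nB.
by rewrite /pull B0 // mul0r.
Qed.

End Cutoff.

Lemma bump_manifold p U : open U -> U p -> exists rho : M -> R,
  [/\ smooth_on setT rho, forall q, 0 <= rho q <= 1,
      \forall q \near p, rho q = 1 &
      exists A, [/\ closed A, A `<=` U & forall q, ~ A q -> rho q = 0]].
Proof.
move=> oU Up; have [c ac cp] := atlas_cover p; have cc := atlas_coord_chart ac.
have [b cb] := cutoff_exists oU Up cp; exists (cut c b (cst 1)); split.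
- apply: (cut_smooth cc oU cb); apply: smooth_on_cst.
  by apply: openI => //; exact: dom_open.
- have [_ b01 _ _] := cb; move=> q; rewrite /cut; case: ifP => _.
    by rewrite mulr1.
  by rewrite lexx ler01.
- exact: cut_near cb _.
- have [A [cA AU A0]] := cut_support cb; exists A; split=> //.
    by apply: subset_trans AU _; exact: subIsetl.
  by move=> q /(A0 (cst 1)).
Qed.

End SmoothCharts.

(** * Characters of the algebra of smooth functions *)

Section Evaluation.
Context {R : realType} {n : nat} (M : manifold R n).
Implicit Types (U V : set M) (f g : smooth_fun M) (p q : M).

Lemma smooth_fun_on f : smooth_on setT f.
Proof. by case: f => f /= /asboolP. Qed.

Definition mk_smooth (h : M -> R) (sh : smooth_on setT h) : smooth_fun M :=
  SmoothFun (introT (asboolP _) sh).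

Lemma smooth_continuous f : continuous f.
Proof.
move=> p; have [c ac cp] := atlas_cover p.
have H : \forall q \near p, (f \o icoord c \o coord c) q = f q.
  by apply: (@filterS _ (nbhs p) _ (dom c)) => [q cq /=|];
    [rewrite coordK ?inE|apply: open_nbhs_nbhs; split=> //; exact: dom_open].
rewrite /continuous_at -(nbhs_singleton H); apply: cvg_trans (near_eq_cvg H) _.
have [Cf _] := smooth_fun_on f ac 0%N.
apply: continuous_comp; first by apply: coord_continuous; rewrite inE.
by apply: Cf; rewrite inE; exists p.
Qed.

Lemma smooth_onV U (h : M -> R) : open U -> (forall q, U q -> h q != 0) ->
  smooth_on U h -> smooth_on U (fun q => (h q)^-1).
Proof.
move=> oU h0 sh c ac.
apply: (@CinfV _ _ _ (h \o icoord c)) => //; last exact: sh.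
  exact: open_coord_image.
by move=> _ [q [Uq cq] <-] /=; rewrite coordK ?inE //; exact: h0.
Qed.

Lemma smooth_val_sum (I : Type) (s : seq I) (F : I -> smooth_fun M) q :
  (\sum_(i <- s) F i) q = \sum_(i <- s) F i q.
Proof. by elim/big_ind2: _ => // ? x ? y <- <-. Qed.

Lemma smooth_val_prod (I : Type) (s : seq I) (F : I -> smooth_fun M) q :
  (\prod_(i <- s) F i) q = \prod_(i <- s) F i q.
Proof. by elim/big_ind2: _ => // ? x ? y <- <-. Qed.

Section NoPoint.
Variable phi : alg_hom (smooth_alg M) (base_alg R).

Lemma phi_cst (a : R) : phi (smooth_cst M a) = a.
Proof. exact: (alg_hom_unit phi a). Qed.

(** A bump function [rho] supported where [f] does not vanish is a multiple of [f] by the smooth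
    function rho / f, so it lies in the kernel along with [f]. *)
Lemma ker_bump f p : phi f = 0 -> f p != 0 ->
  exists chi : smooth_fun M, [/\ phi chi = 0, forall q, 0 <= chi q <= 1 &
    \forall q \near p, chi q = 1].
Proof.
move=> phif fp; pose U := [set q | f q != 0].
have oU : open U.
  have -> : U = f @^-1` [set x | x != 0] by [].
  apply: open_comp; first by move=> q _; exact: smooth_continuous.
  exact: open_neq.
have [rho [srho rho01 rho1 [A [cA AU A0]]]] := bump_manifold oU fp.
have sg : smooth_on setT (fun q => rho q * (f q)^-1).
  apply: smooth_on_local => q _; have [Aq|nAq] := pselect (A q).
    exists U; split=> //; first exact: AU.
    apply: (smooth_onM oU); first exact: smooth_on_sub srho.
    by apply: smooth_onV => //; exact: smooth_on_sub (smooth_fun_on f).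
  exists (~` A); split=> //; first exact: closed_openC.
  apply: (@smooth_on_ext _ _ _ _ (cst 0)); first exact: closed_openC.
    by move=> x /[1!inE] nA; rewrite A0 // mul0r.
  by apply: smooth_on_cst; exact: closed_openC.
exists (mk_smooth srho); split=> //.
have -> : mk_smooth srho = mk_smooth sg * f.
  apply: val_inj; apply/funext => q /=; rewrite -[RHS]/(rho q * (f q)^-1 * f q).
  have [fq|fq] := eqVneq (f q) 0; last by rewrite mulfVK.
  rewrite fq mulr0 A0 // => /AU; by rewrite /U /= fq eqxx.
by rewrite [LHS]rmorphM [X in _ * X]phif mulr0.
Qed.

(** Second countability makes the family countable: a basis has an injection [k] into the integers,
    and [chi i] is one of the bump functions [X p] equal to 1 on the basic set of code [i]. If there
    is none, [chi i] is 0, which also lies in the kernel. *)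
Lemma ker_cover : (forall p, exists2 f, phi f = 0 & f p != 0) ->
  exists chi : nat -> smooth_fun M,
    [/\ forall i, phi (chi i) = 0, forall i q, 0 <= chi i q <= 1 &
        forall p, exists i, \forall q \near p, chi i q = 1].
Proof.
move=> H; have [B cB [Bo Bx]] := manifold_second_countable M.
have /countable_injP[k kinj] := cB.
have /choice[X XP] : forall p, exists chi : smooth_fun M,
    [/\ phi chi = 0, forall q, 0 <= chi q <= 1 & \forall q \near p, chi q = 1].
  by move=> p; have [f f0 fp] := H p; exact: ker_bump f0 fp.
have /choice[chi chiP] : forall i : nat, exists chi : smooth_fun M,
    [/\ phi chi = 0, forall q, 0 <= chi q <= 1 & forall V p, B V -> k V = i ->
       V `<=` [set q | X p q = 1] -> V `<=` [set q | chi q = 1]].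
  move=> i; have [[V0 [p0 [BV0 kV0 VX0]]]|none] := pselect (exists V p,
      [/\ B V, k V = i & V `<=` [set q | X p q = 1]]).
    exists (X p0); have [X1 X2 X3] := XP p0; split=> // V p BV kV _.
    suff -> : V = V0 by [].
    by apply: kinj; rewrite ?inE // kV kV0.
  exists 0; split=> [|q|V p BV kV VX]; first exact: rmorph0.
    by rewrite -[(0 : smooth_fun M) q]/(0 : R) lexx ler01.
  by exfalso; apply: none; exists V, p.
exists chi; split=> [i|i|p]; try by have [] := chiP i.
have [_ _ Xp] := XP p; have [V [BV Vp] VX] := Bx p _ Xp.
exists (k V); have [_ _ chiV] := chiP (k V).
have Vn : nbhs p V by apply: open_nbhs_nbhs; split=> //; exact: Bo.
by apply: filterS Vn; exact: chiV BV erefl VX.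
Qed.

(* The partial products [theta j] of the [1 - chi i] lie over 1 and, near every
   point, all but finitely many of them vanish, so that their sum would be
   a smooth function whose image under phi exceeds every integer. *)
Lemma ker_no_cover (chi : nat -> smooth_fun M) :
  (forall i, phi (chi i) = 0) -> (forall i q, 0 <= chi i q <= 1) ->
  ~ (forall p, exists i, \forall q \near p, chi i q = 1).
Proof.
move=> chi0 chi01 /choice[N NP].
pose theta j : smooth_fun M := \prod_(i < j) (1 - chi i).
have thetaE j q : theta j q = \prod_(i < j) (1 - chi i q).
  by rewrite smooth_val_prod; apply: eq_bigr => i _.
have theta_ge0 j q : 0 <= theta j q.
  rewrite thetaE; apply: prodr_ge0 => i _; rewrite subr_ge0.
  by have /andP[] := chi01 i q.
have theta0 i j q : chi i q = 1 -> (i < j)%N -> theta j q = 0.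
  by move=> ci ij; rewrite thetaE (bigD1 (Ordinal ij)) //= ci subrr mul0r.
have phi_theta j : phi (theta j) = 1.
  rewrite rmorph_prod big1 // => i _.
  by rewrite rmorphB rmorph1 [X in _ - X](chi0 i) subr0.
pose S K q := \sum_(j < K) theta j q.
have S_le K L q : (K <= L)%N -> S K q <= S L q.
  move=> /subnK <-; rewrite addnC /S big_split_ord /= lerDl.
  by apply: sumr_ge0 => j _; exact: theta_ge0.
have S_stable i K q : chi i q = 1 -> (i < K)%N -> S K q = S i.+1 q.
  move=> ci /subnK <-; rewrite addnC /S big_split_ord /= [X in _ + X]big1 ?addr0 //.
  by move=> j _; apply: (theta0 i) => //; rewrite /= addSn ltnS leq_addr.
have SE i j q : chi i q = 1 -> chi j q = 1 -> S i.+1 q = S j.+1 q.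
  move=> ci cj; rewrite -(S_stable i (i + j).+1) // ?ltnS ?leq_addr //.
  by rewrite -(S_stable j (i + j).+1) // ltnS leq_addl.
(* The sum of all [theta j] at [q], as the terms with j > [N q] vanish there. Near [p] it is the
   finite sum up to [N p], hence smooth. *)
pose h q := S (N q).+1 q.
have sh : smooth_on setT h.
  apply: smooth_on_local => p _.
  have /nbhs_interior/nbhs_singleton Vp := NP p.
  have oV := @open_interior M [set q | chi (N p) q = 1].
  exists ([set q | chi (N p) q = 1]^°); split=> //.
  apply: (@smooth_on_ext _ _ _ _ (\sum_(j < (N p).+1) theta j : smooth_fun M)) => //.
    move=> q /[1!inE] /interior_subset /= cq; rewrite smooth_val_sum.
    by apply: SE => //; exact: nbhs_singleton (NP q).
  exact: smooth_on_sub (smooth_fun_on _).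
pose H := mk_smooth sh; pose m := (Num.trunc `|phi H|).+1.
have phiH : phi H < m%:R.
  by apply: le_lt_trans (ler_norm _) _; exact: truncnS_gt.
(* Every [theta j] is sent to 1, so [phi g] is phi H - m + (m - phi H) = 0. But [h] dominates all
   partial sums and m > phi H, so [g] is positive and invertible. *)
pose g : smooth_fun M := H - \sum_(j < m) theta j + smooth_cst M (m%:R - phi H).
have g_gt0 q : 0 < g q.
  rewrite -[g q]/(h q - (\sum_(j < m) theta j) q + (m%:R - phi H)).
  rewrite smooth_val_sum ltr_wpDl ?subr_gt0 // subr_ge0.
  have cq : chi (N q) q = 1 by exact: nbhs_singleton (NP q).
  rewrite -/(S m q) /h -(S_stable (N q) (maxn m (N q).+1)) ?leq_maxr //.
  by apply: S_le; exact: leq_maxl.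
have phig : phi g = 0.
  rewrite [LHS]rmorphD [X in _ + X]phi_cst rmorphB rmorph_sum.
  rewrite (eq_bigr (fun=> 1)) => [|j _]; last exact: phi_theta.
  by rewrite sumr_const card_ord addrA subrK subrr.
have sg : smooth_on setT (fun q => (g q)^-1).
  by apply: smooth_onV (smooth_fun_on g); [exact: openT|move=> q _; rewrite gt_eqF].
have : phi (g * mk_smooth sg) = 1.
  rewrite -(rmorph1 phi); congr (phi _); apply: val_inj; apply/funext => q.
  by rewrite -[LHS]/(g q * (g q)^-1) mulfV // gt_eqF.
by rewrite rmorphM [X in X * _]phig mul0r => /eqP; rewrite eq_sym oner_eq0.
Qed.

(** If phi is not the evaluation at p, some [f - phi f] lies in the kernel without vanishing at p.
    If this happens at every p, [ker_cover] and [ker_no_cover] contradict each other. *)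
Theorem hom_eval : exists p, forall f, phi f = f p.
Proof.
apply/not_existsP => H; have [|chi [c1 c2 c3]] := ker_cover.
  move=> p; have /existsNP[f fp] := H p.
  exists (f - smooth_cst M (phi f)).
    by rewrite rmorphB [X in _ - X]phi_cst subrr.
  rewrite -[(f - smooth_cst M (phi f)) p]/(f p - phi f) subr_eq0.
  by apply/eqP => E; apply: fp.
exact: ker_no_cover c1 c2 c3.
Qed.

End NoPoint.
End Evaluation.

(** * Jets *)

Section JetAlgebra.
Context {R : realType} {r : nat}.
Local Notation A := (jet_alg (R := R) r).
Implicit Types (a b : A) (i j k : nat).

Lemma jet_ext a b : (forall i, (i <= r)%N -> jet_coef i a = jet_coef i b) -> a = b.
Proof.
move=> ab; apply/npolyP => i; have [ir|ri] := leqP i r; first exact: ab.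
have big (x : {poly %/ ('X^(r.+1) : {poly R})}) : (x : {poly R})`_i = 0.
  apply: big_coef_npoly; apply: leq_trans ri.
  by rewrite mk_monic_Xn size_polyXn.
by rewrite [LHS]big [RHS]big.
Qed.

Lemma jet_coefB i a b : jet_coef i (a - b) = jet_coef i a - jet_coef i b.
Proof. by rewrite /jet_coef /= coefB. Qed.

Lemma jet_coefD i a b : jet_coef i (a + b) = jet_coef i a + jet_coef i b.
Proof. by rewrite /jet_coef /= coefD. Qed.

Lemma jet_coef0 i : jet_coef i (0 : A) = 0.
Proof. by rewrite /jet_coef /= coef0. Qed.

Lemma jet_coef_sum (I : Type) (s : seq I) (F : I -> A) i :
  jet_coef i (\sum_(k <- s) F k) = \sum_(k <- s) jet_coef i (F k).
Proof. by apply: (big_morph (jet_coef i)) => [x y|]; rewrite ?jet_coefD ?jet_coef0. Qed.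

Lemma jet_coef_unit i (x : R) : jet_coef i (alg_unit A x) = x *+ (i == 0%N).
Proof. by rewrite /jet_coef /= coefC; case: eqP. Qed.

Lemma jet_coefM i a b : (i <= r)%N ->
  jet_coef i (a * b) = \sum_(k < i.+1) jet_coef k a * jet_coef (i - k) b.
Proof.
move=> ir; rewrite -coefM /jet_coef.
have E (p q : {poly R}) : (rmodp (p * q) (mk_monic 'X^(r.+1)))`_i = (p * q)`_i.
  by rewrite mk_monic_Xn -take_poly_rmodp coef_take_poly ltnS ir.
exact: E.
Qed.

Definition jet_of (c : nat -> R) : A := in_qpoly 'X^(r.+1) (\poly_(i < r.+1) c i).

Lemma jet_coef_of c i : (i <= r)%N -> jet_coef i (jet_of c) = c i.
Proof.
move=> ir; rewrite /jet_coef in_qpoly_small ?coef_poly ?ltnS ?ir //.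
by rewrite mk_monic_Xn size_polyXn ltnS size_poly.
Qed.

(** Membership in the ideal generated by epsilon^k; only the coefficients up to [r] carry
    information. *)
Definition vanish k a : Prop := forall j, (j < k)%N -> (j <= r)%N -> jet_coef j a = 0.

Lemma vanish_le k l a : (k <= l)%N -> vanish l a -> vanish k a.
Proof. by move=> kl va j jk; apply: va; exact: leq_trans kl. Qed.

Lemma vanishM k l a b : vanish k a -> vanish l b -> vanish (k + l) (a * b).
Proof.
move=> va vb j jkl jr; rewrite jet_coefM // big1 // => i _.
have [ik|ki] := ltnP i k; first by rewrite va ?mul0r // (leq_trans _ jr) // -ltnS.
rewrite vb ?mulr0 //; last exact: leq_trans (leq_subr _ _) jr.
by have := ltn_ord i; lia.
Qed.

Lemma vanish_sum k (I : Type) (s : seq I) (F : I -> A) :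
  (forall x, vanish k (F x)) -> vanish k (\sum_(i <- s) F i).
Proof. by move=> vF j jk jr; rewrite jet_coef_sum big1 // => i _; exact: vF. Qed.

Lemma vanishX k m a : vanish k a -> vanish (m * k) (a ^+ m).
Proof.
move=> va; elim: m => [|m IH]; first by move=> j; rewrite mul0n ltn0.
by rewrite exprS mulSn; exact: vanishM.
Qed.

Lemma vanish_prod (I : Type) (s : seq I) (m : I -> nat) (F : I -> A) :
  (forall x, vanish (m x) (F x)) -> vanish (\sum_(x <- s) m x) (\prod_(x <- s) F x).
Proof.
move=> vF; elim: s => [|x s IH]; first by move=> j; rewrite big_nil ltn0.
by rewrite !big_cons; exact: vanishM.
Qed.

Lemma vanish_eq0 a : vanish r.+1 a -> a = 0.
Proof. by move=> va; apply: jet_ext => i ir; rewrite va // jet_coef0. Qed.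

(** An element with constant term 1 is a unit; here the coefficients of [b] are shown to vanish one
    after the other. *)
Lemma jet_mul_eq0 a b : jet_coef 0 a = 1 -> a * b = 0 -> b = 0.
Proof.
move=> a0 ab; apply: jet_ext => i; rewrite jet_coef0.
have [k] := ubnP i; elim: k i => // k IH i ik ir.
have := congr1 (jet_coef i) ab; rewrite jet_coefM // jet_coef0 big_ord_recl /=.
rewrite a0 mul1r subn0 big1 ?addr0 // => l _.
by have li := ltn_ord l; rewrite IH ?mulr0 // /bump leq0n add1n; lia.
Qed.

Lemma jet_eval_additive : zmod_morphism (jet_coef 0 : A -> base_alg R).
Proof. by move=> a b; exact: jet_coefB. Qed.

Lemma jet_eval_monoid : monoid_morphism (jet_coef 0 : A -> base_alg R).
Proof.
split=> [|a b]; last by rewrite jet_coefM // big_ord1 subn0.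
by rewrite /jet_coef /= coefC.
Qed.

Lemma jet_eval_unit (x : R) : jet_coef 0 (alg_unit A x) = alg_unit (base_alg R) x.
Proof. exact: jet_coef_unit. Qed.

Definition jet_eval : alg_hom A (base_alg R) :=
  AlgHom jet_eval_additive jet_eval_monoid jet_eval_unit.

End JetAlgebra.

(** * Expansions of global functions in cut-off coordinates *)

Section ChartFunctions.
Context {R : realType} {n : nat} {M : manifold R n}.
Implicit Types (f g : smooth_fun M) (c : chart R M n) (p q : M)
  (b : 'rV[R]_n -> R).

Lemma smooth_on_coord c a : coord_chart c ->
  smooth_on (dom c) (fun q => coord c q 0 a).
Proof.
move=> cc.
apply: (smooth_of_chart (O := setT) cc _ _ _ _ (Cinf_coord a openT)) => //.
- exact: dom_open.
- exact: openT.
Qed.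

(* meaningful only for g smooth on dom c *)
Definition cutf c b (g : M -> R) : smooth_fun M := insubd 0 (cut c b g).

Definition Xc c b (a : 'I_n) : smooth_fun M := cutf c b (fun q => coord c q 0 a).

Lemma cutfE c p b (g : M -> R) : coord_chart c -> cutoff c p setT b ->
  smooth_on (dom c) g -> cutf c b g = cut c b g :> (M -> R).
Proof.
move=> cc cb sg; rewrite /cutf val_insubd ifT //.
by apply/asboolP; apply: (cut_smooth cc openT cb); rewrite setTI.
Qed.

Lemma cutf_near c p b (g : M -> R) : coord_chart c -> dom c p ->
  cutoff c p setT b -> smooth_on (dom c) g ->
  \forall q \near p, cutf c b g q = g q.
Proof.
by move=> cc cp cb sg; rewrite (cutfE cc cb sg); exact: cut_near cp cb _.
Qed.

Lemma Xc_near c p b a : coord_chart c -> dom c p -> cutoff c p setT b ->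
  \forall q \near p, Xc c b a q = coord c q 0 a.
Proof. by move=> cc cp cb; apply: (cutf_near cc cp cb); exact: smooth_on_coord. Qed.

Lemma smooth_valX f m q : (f ^+ m) q = f q ^+ m.
Proof. by elim: m => // m IH; rewrite !exprS -IH. Qed.

Lemma near_all (I : finType) p (P : I -> M -> Prop) :
  (forall i, \forall q \near p, P i q) -> \forall q \near p, forall i, P i q.
Proof. exact: filter_forall. Qed.

(** The coefficients [G] are chosen before the point [p], so that one expansion serves near all
    points where [b] is locally 1. This uniformity passes on to [nu_formula]. *)
Lemma local_expansion r (W : weighting M r) c w b i f : coord_chart c ->
  (forall i (h : M -> R), W i (dom c) h <-> weighted_ideal c w i h) ->
  W i setT f -> exists (I : finType) (s : I -> 'I_n -> nat) (G : I -> smooth_fun M),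
    (forall k, (i <= \sum_a s k a * w a)%N) /\
    forall p, dom c p -> cutoff c p setT b -> \forall q \near p,
      f q = (\sum_k G k * \prod_a Xc c b a ^+ s k a) q.
Proof.
move=> cc loc Wf; have /loc[I [s [g [sg ws fE]]]] : W i (dom c) f.
  by apply: fil_restrict Wf => //; [exact: openT|exact: dom_open].
exists I, s, (fun k => cutf c b (g k)); split=> // p cp cb.
have nG := near_all (fun k => cutf_near cc cp cb (sg k)).
have nX := near_all (fun a => Xc_near a cc cp cb).
have nc : \forall q \near p, dom c q.
  by apply: open_nbhs_nbhs; split=> //; exact: dom_open.
near=> q; rewrite fE ?inE; last by near: q.
rewrite smooth_val_sum; apply: eq_bigr => k _.
rewrite -[RHS]/(cutf c b (g k) q * (\prod_a Xc c b a ^+ s k a) q); congr (_ * _).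
  by have -> : cutf c b (g k) q = g k q by move: k; near: q.
rewrite smooth_val_prod; apply: eq_bigr => a _; rewrite smooth_valX.
by have -> : Xc c b a q = coord c q 0 a by move: a; near: q.
Unshelve. all: by end_near. Qed.

(** [hadamard] concerns functions on all of R^n, where segments stay in the domain; so [f] is
    transported there by [pull], and the quotients are brought back to [M] by [cutf]. *)
Lemma hadamard_expansion c b p f : coord_chart c -> dom c p ->
  cutoff c p setT b -> exists G : 'I_n -> smooth_fun M,
    \forall q \near p, f q = (smooth_cst M (f p) +
      \sum_a (Xc c b a - smooth_cst M (coord c p 0 a)) * G a) q.
Proof.
move=> cc cp cb.
have Cf : Cinf setT (pull c b f).
  by apply: (pull_Cinf cc openT cb); exact: smooth_on_sub (smooth_fun_on f).
have [g Cg gE] := hadamard (coord c p) Cf.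
have sg a : smooth_on (dom c) (g a \o coord c).
  by apply: (smooth_of_chart cc _ _ openT _ (Cg a)) => //; exact: dom_open.
exists (fun a => cutf c b (g a \o coord c)).
have nG := near_all (fun a => cutf_near cc cp cb (sg a)).
have nX := near_all (fun a => Xc_near a cc cp cb).
have [_ _ b1 _] := cb; have nb := coord_near cp b1.
have pullE q : dom c q /\ b (coord c q) = 1 -> pull c b f (coord c q) = f q.
  by move=> [cq bq]; rewrite /pull bq mul1r coordK ?inE.
near=> q; rewrite -(pullE q); last by near: q.
rewrite gE pullE; last exact: nbhs_singleton nb.
rewrite -[RHS]/(f p + (\sum_a (Xc c b a - smooth_cst M (coord c p 0 a)) *
   cutf c b (g a \o coord c)) q) smooth_val_sum; congr (_ + _).
apply: eq_bigr => a _.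
rewrite -[RHS]/((Xc c b a q - coord c p 0 a) * cutf c b (g a \o coord c) q).
have -> : Xc c b a q = coord c q 0 a by move: a; near: q.
by have -> : cutf c b (g a \o coord c) q = g a (coord c q) by move: a; near: q.
Unshelve. all: by end_near. Qed.

End ChartFunctions.

Section SmoothHom.
Context {R : realType} {n : nat} {M : manifold R n} {B : comAlg R}.
Variable u : alg_hom (smooth_alg M) B.
Implicit Types (f g : smooth_fun M).

Lemma hom_sub f g : u (f - g) = u f - u g.
Proof. exact: rmorphB. Qed.

Lemma hom_add f g : u (f + g) = u f + u g.
Proof. exact: rmorphD. Qed.

Lemma hom_mul f g : u (f * g) = u f * u g.
Proof. exact: rmorphM. Qed.

Lemma hom_exp f m : u (f ^+ m) = u f ^+ m.
Proof. exact: rmorphXn. Qed.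

Lemma hom_sum (I : Type) (s : seq I) (F : I -> smooth_fun M) :
  u (\sum_(i <- s) F i) = \sum_(i <- s) u (F i).
Proof. exact: rmorph_sum. Qed.

Lemma hom_prod (I : Type) (s : seq I) (F : I -> smooth_fun M) :
  u (\prod_(i <- s) F i) = \prod_(i <- s) u (F i).
Proof. exact: rmorph_prod. Qed.

Lemma hom_cst x : u (smooth_cst M x) = alg_unit B x.
Proof. exact: (alg_hom_unit u x). Qed.

End SmoothHom.

(** * Jets as morphisms: locality, orders, determination by coordinates *)

Section Tangents.
Context {R : realType} {n : nat} {M : manifold R n} {m : nat}.
Local Notation TM := (alg_hom (smooth_alg M) (jet_alg (R := R) m)).
Implicit Types (u v : TM) (f g : smooth_fun M) (c : chart R M n) (p q : M)
  (b : 'rV[R]_n -> R).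

Definition base_at u p : Prop := forall f, jet_coef 0 (u f) = f p.

Lemma base_exists u : exists p, base_at u p.
Proof. by have [p pP] := hom_eval (alg_hom_comp jet_eval u); exists p. Qed.

(** A bump function supported where [f] and [g] agree annihilates [f - g], and its image under [u]
    has constant term 1. *)
Lemma tangent_local u p f g : base_at u p -> (\forall q \near p, f q = g q) ->
  u f = u g.
Proof.
move=> up /nbhs_interior/nbhs_singleton fg.
have oU := @open_interior M [set q | f q = g q].
have [rho [srho _ rho1 [A [_ AU A0]]]] := bump_manifold oU fg.
apply/subr0_eq; apply: (@jet_mul_eq0 _ _ (u (mk_smooth srho))).
  by rewrite up /=; exact: nbhs_singleton rho1.
rewrite -hom_sub -hom_mul -(rmorph0 u); congr (u _); apply: val_inj; apply/funext => q.
rewrite -[LHS]/(rho q * (f q - g q)); have [Aq|nAq] := pselect (A q).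
  have /interior_subset /= -> := AU q Aq; by rewrite subrr mulr0.
by rewrite A0 // mul0r.
Qed.

(** Orders in epsilon add up in products, and by the local model [f] is near [p] a combination of
    monomials of weight at least [i]. The order [m] of the jet is unrelated to the order [r] of the
    weighting. *)
Lemma tangent_valuation r (W : weighting M r) c w b p u : coord_chart c ->
  dom c p -> cutoff c p setT b ->
  (forall i (h : M -> R), W i (dom c) h <-> weighted_ideal c w i h) -> base_at u p ->
  (forall a, vanish (w a) (u (Xc c b a))) ->
  forall i f, W i setT f -> vanish i (u f).
Proof.
move=> cc cp cb loc up vX i f Wf.
have [I [s [G [ws fE]]]] := local_expansion b cc loc Wf.
rewrite (tangent_local up (fE p cp cb)) hom_sum; apply: vanish_sum => k.
apply: vanish_le (ws k) _; rewrite hom_mul.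
rewrite -[X in vanish X]add0n; apply: vanishM; first by move=> j; rewrite ltn0.
rewrite hom_prod; apply: vanish_prod => a.
by rewrite hom_exp; exact: vanishX.
Qed.

Lemma tangent_ext c b p u v : coord_chart c -> dom c p -> cutoff c p setT b ->
  base_at u p -> base_at v p -> (forall a, u (Xc c b a) = v (Xc c b a)) ->
  forall f, u f = v f.
Proof.
move=> cc cp cb up vp uv f; apply/subr0_eq/vanish_eq0.
suff H k : forall f, vanish k (u f - v f) by exact: H.
elim: k => [|k IH] {}f; first by move=> j; rewrite ltn0.
have [G fE] := hadamard_expansion f cc cp cb.
rewrite (tangent_local up fE) (tangent_local vp fE).
rewrite !hom_add.
rewrite !hom_cst opprD addrACA subrr add0r.
rewrite hom_sum hom_sum -sumrB.
apply: vanish_sum => a; rewrite hom_mul hom_mul.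
have -> : u (Xc c b a - smooth_cst M (coord c p 0 a)) =
    v (Xc c b a - smooth_cst M (coord c p 0 a)).
  by rewrite !hom_sub !hom_cst uv.
(* The first factor vanishes at [p] and contributes one power of epsilon; the induction hypothesis
   for the Hadamard quotient [G a] contributes the other [k]. *)
rewrite -mulrBr -add1n; apply: vanishM; last exact: IH.
case=> // _ _; rewrite vp.
rewrite -[LHS]/(Xc c b a p - coord c p 0 a).
by rewrite (nbhs_singleton (Xc_near a cc cp cb)) subrr.
Qed.

End Tangents.

(** * The jets of a polynomial curve in a chart *)

Section CurveJets.
Context {R : realType} {n : nat} {M : manifold R n}.
Implicit Types (f g : smooth_fun M).
Variables (c : chart R M n) (p0 : M) (b : 'rV[R]_n -> R) (P : 'I_n -> {poly R}).
Hypotheses (cc : coord_chart c) (cb : cutoff c p0 setT b).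
Hypothesis (Pb : \forall y \near pcurve P 0, b y = 1).

(** Multiplication by [b] makes sense of [f] along the whole curve, which may leave the chart. Near
    time 0 the factor is 1 by [Pb], so the coefficients are those of [f] itself. *)
Definition curve_coef (k : nat) f : R := taylor (pull c b f \o pcurve P) k.

Let smooth1_pull f : smooth1 (pull c b f \o pcurve P).
Proof.
apply/smooth1_pcurve/(pull_Cinf cc openT cb).
exact: smooth_on_sub (smooth_fun_on f).
Qed.

Let near_curve : \forall t \near (0 : R), b (pcurve P t) = 1.
Proof.
have cP : {for 0, continuous (pcurve P)}.
  apply/differentiable_continuous/derivable1_diffP/derivable_mxP => i a.
  have -> : (fun t => pcurve P t i a) = horner (P a).
    by apply/funext => t; rewrite /pcurve ord1 mxE.
  exact: derivable_horner.
exact: (cP [set y | b y = 1]).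
Qed.

Lemma curve_dom y : b y = 1 -> dom c (icoord c y) /\ coord c (icoord c y) = y.
Proof.
move=> by1; have [_ _ _ [B [_ BU B0]]] := cb.
have /BU[q [_ cq] <-] : B y.
  by apply: contrapT => /B0; rewrite by1 => /eqP; rewrite oner_eq0.
by rewrite coordK ?inE.
Qed.

Lemma curve_coefB k f g : curve_coef k (f - g) = curve_coef k f - curve_coef k g.
Proof.
rewrite /curve_coef -taylorB //; congr taylor; apply/funext => t.
exact: (mulrBr (b (pcurve P t)) (f _) (g _)).
Qed.

(** The two sides come from [b f g] and [b^2 f g], which agree along the curve near time 0, where
    [b] is 1. *)
Lemma curve_coefM k f g :
  curve_coef k (f * g) = \sum_(i < k.+1) curve_coef i f * curve_coef (k - i) g.
Proof.
rewrite -taylorM //; apply: taylor_near.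
apply: filterS near_curve => t bt /=.
by rewrite [RHS]/(_ * _) /= /pull bt !mul1r.
Qed.

Lemma curve_coef_cst k x : curve_coef k (smooth_cst M x) = x *+ (k == 0%N).
Proof.
rewrite -taylor_cst; apply: taylor_near.
by apply: filterS near_curve => t bt /=; rewrite /pull bt mul1r.
Qed.

Lemma curve_coef0 f : curve_coef 0 f = f (icoord c (pcurve P 0)).
Proof. by rewrite /curve_coef /taylor fact0 divr1 /= /pull (nbhs_singleton Pb) mul1r. Qed.

Lemma curve_coef_Xc k a : curve_coef k (Xc c b a) = (P a)`_k.
Proof.
rewrite -taylor_horner; apply: taylor_near.
apply: filterS near_curve => t bt /=; have [cq cqE] := curve_dom bt.
rewrite /pull bt mul1r (cutfE cc cb); last exact: smooth_on_coord.
by rewrite /cut mem_set // cqE bt mul1r mxE.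
Qed.

Lemma curve_jet_additive m :
  zmod_morphism (fun f : smooth_alg M => jet_of (r := m) (fun k => curve_coef k f)).
Proof.
move=> f g; apply: jet_ext => i im.
by rewrite jet_coefB !jet_coef_of // curve_coefB.
Qed.

Lemma curve_jet_monoid m :
  monoid_morphism (fun f : smooth_alg M => jet_of (r := m) (fun k => curve_coef k f)).
Proof.
split=> [|f g]; apply: jet_ext => i im.
  rewrite jet_coef_of // -[X in _ = jet_coef _ X](rmorph1 (alg_unit (jet_alg m))).
  rewrite jet_coef_unit -curve_coef_cst; congr curve_coef.
  exact/esym/(rmorph1 (smooth_cst M)).
rewrite jet_coefM // jet_coef_of // curve_coefM; apply: eq_bigr => k _.
by rewrite !jet_coef_of //; have := ltn_ord k; lia.
Qed.

Lemma curve_jet_unit m x :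
  jet_of (r := m) (fun k => curve_coef k (smooth_cst M x)) = alg_unit (jet_alg m) x.
Proof.
by apply: jet_ext => i im; rewrite jet_coef_of // curve_coef_cst jet_coef_unit.
Qed.

Definition curve_jet m : alg_hom (smooth_alg M) (jet_alg m) :=
  AlgHom (@curve_jet_additive m) (@curve_jet_monoid m) (@curve_jet_unit m).

Lemma curve_jetE m k f : (k <= m)%N -> jet_coef k (curve_jet m f) = curve_coef k f.
Proof. exact: jet_coef_of. Qed.

Lemma curve_jet_base m : base_at (curve_jet m) (icoord c (pcurve P 0)).
Proof. by move=> f; rewrite curve_jetE // curve_coef0. Qed.

End CurveJets.

(** * Points of the weighted normal bundle *)

Lemma alg_hom_ext (K : comNzRingType) (A B : comAlg K) (u v : alg_hom A B) :
  (forall a, u a = v a) -> u = v.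
Proof.
case: u v => [u a1 m1 e1] [v a2 m2 e2] /= uv.
have E : u = v by apply/funext.
by case: v / E a2 m2 e2 uv => a2 m2 e2 _; congr AlgHom; exact: Prop_irrelevance.
Qed.

Section NormalBundle.
Context {R : realType} {n : nat} {M : manifold R n} {r : nat}.
Variable W : weighting M r.
Implicit Types (f g : smooth_fun M) (x y : weighted_normal_bundle W) (i j : nat)
  (p q : M) (c : chart R M n) (b : 'rV[R]_n -> R).
Local Notation "f \in_ i" := (W i [set: M] (smooth_val f)) (at level 70).

Lemma fil0S f : f \in_ 0.
Proof. by apply/(fil0 W _ openT); exact: smooth_fun_on. Qed.

Lemma filMS i j f g : f \in_ i -> g \in_ j -> f * g \in_ (i + j)%N.
Proof. exact: filM. Qed.

Lemma filBS i f g : f \in_ i -> g \in_ i -> f - g \in_ i.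
Proof. by move=> Wf Wg; apply: (fil_add openT) => //; exact: (filN openT). Qed.

Lemma filDS i f g : f \in_ i -> g \in_ i -> f + g \in_ i.
Proof. by move=> Wf Wg; apply: (fil_add openT). Qed.

Lemma fil0S0 i : (0 : smooth_fun M) \in_ i.
Proof. exact: (fil_zero W i openT). Qed.

Lemma fil_le i j f : (i <= j)%N -> f \in_ j -> f \in_ i.
Proof.
by move=> /subnK <-; elim: (j - i)%N => // k IH Wf; apply/IH/(fil_decr openT).
Qed.

Lemma fil_sumS (I : Type) (s : seq I) (F : I -> smooth_fun M) i :
  (forall k, F k \in_ i) -> \sum_(k <- s) F k \in_ i.
Proof.
move=> WF; elim/big_rec: _ => [|k f _ Wf]; first exact: fil0S0.
by apply: filDS.
Qed.

Lemma fil_expS m i f : f \in_ i -> f ^+ m \in_ (m * i)%N.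
Proof.
move=> Wf; elim: m => [|m IH]; first exact: fil0S.
by rewrite exprS mulSn; exact: filMS.
Qed.

Lemma fil_prodS (I : Type) (s : seq I) (m : I -> nat) (F : I -> smooth_fun M) :
  (forall k, F k \in_ m k) -> \prod_(k <- s) F k \in_ (\sum_(k <- s) m k)%N.
Proof.
move=> WF; elim: s => [|k s IH]; first by rewrite !big_nil; exact: fil0S.
by rewrite !big_cons; exact: filMS.
Qed.

Lemma nu_sub x (a1 a2 : gr W) : x (a1 - a2) = x a1 - x a2 :> R.
Proof. exact: (rmorphB x). Qed.

Lemma nu_mul x (a1 a2 : gr W) : x (a1 * a2) = x a1 * x a2 :> R.
Proof. exact: (rmorphM x). Qed.

Lemma nu_sum x (I : Type) (s : seq I) (F : I -> gr W) :
  x (\sum_(k <- s) F k) = \sum_(k <- s) x (F k) :> R.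
Proof. exact: (rmorph_sum x). Qed.

Lemma nu_zero x : x (0 : gr W) = 0 :> R.
Proof. exact: (rmorph0 x). Qed.

(* meaningful only for f in W i; 0 otherwise *)
Definition nu_val x i (f : M -> R) : R :=
  if pselect (W i [set: M] f) is left Wf then x (gr_class Wf) else 0.

Lemma nu_valE x i (f : M -> R) (Wf : W i [set: M] f) : nu_val x i f = x (gr_class Wf).
Proof.
rewrite /nu_val; case: pselect => // Wf'.
by rewrite (Prop_irrelevance Wf' Wf).
Qed.

Lemma nu_valB x i f g : f \in_ i -> g \in_ i ->
  nu_val x i (f - g) = nu_val x i f - nu_val x i g.
Proof.
move=> Wf Wg; rewrite (nu_valE _ (filBS Wf Wg)) (nu_valE _ Wf) (nu_valE _ Wg).
rewrite -nu_sub; congr (x _); rewrite /gr_class -[RHS](to_gr_additive _ _).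
congr (to_gr _); apply: val_inj; apply/funext => q.
have E : (f q - g q) *: 'X^i = f q *: 'X^i - g q *: 'X^i :> {poly R} by rewrite scalerBl.
exact: E.
Qed.

Lemma nu_valM x i j f g : f \in_ i -> g \in_ j ->
  nu_val x (i + j) (f * g) = nu_val x i f * nu_val x j g.
Proof.
move=> Wf Wg; rewrite (nu_valE _ (filMS Wf Wg)) (nu_valE _ Wf) (nu_valE _ Wg).
rewrite -nu_mul; congr (x _); rewrite /gr_class -[RHS]((@to_gr_monoid _ _ _ _ W).2 _ _).
congr (to_gr _); apply: val_inj; apply/funext => q.
have E : (f q * g q) *: 'X^(i + j) = (f q *: 'X^i) * (g q *: 'X^j) :> {poly R}.
  by rewrite -scalerAl -scalerAr scalerA -exprD.
exact: E.
Qed.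

Lemma nu_val_deg x i f : f \in_ i.+1 -> nu_val x i f = 0.
Proof.
move=> Wf; have Wf' := fil_le (leqnSn i) Wf; rewrite (nu_valE _ Wf').
rewrite -(nu_zero x); congr (x _); rewrite -(rmorph0 (to_gr (W := W))).
apply/to_grP; rewrite subr0; apply/asboolP => j /=.
have [->|ji] := eqVneq j i.
  by rewrite (_ : rees_coef _ _ = f) //; apply/funext => q;
    rewrite /rees_coef coefZ coefXn eqxx mulr1.
rewrite (_ : rees_coef _ _ = cst 0); first exact: (fil_zero W _ openT).
by apply/funext => q; rewrite /rees_coef coefZ coefXn (negbTE ji) mulr0.
Qed.

Lemma nu_val_cst x (a : R) : nu_val x 0 (smooth_cst M a) = a.
Proof.
rewrite (nu_valE _ (fil0S _)) -[RHS](alg_hom_unit x a); congr (x _).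
congr (to_gr _); apply: val_inj; apply/funext => q /=.
by rewrite expr0 alg_polyC.
Qed.

Lemma nu_val0 x i : nu_val x i (0 : smooth_fun M) = 0.
Proof. by apply: nu_val_deg; exact: fil0S0. Qed.

Lemma nu_valD x i f g : f \in_ i -> g \in_ i ->
  nu_val x i (f + g) = nu_val x i f + nu_val x i g.
Proof.
move=> Wf Wg; have WN : - g \in_ i by rewrite -sub0r; apply: filBS => //; exact: fil0S0.
have E := nu_valB x (fil0S0 i) Wg; rewrite nu_val0 !sub0r in E.
by rewrite -[in LHS](opprK g) nu_valB // E opprK.
Qed.

Lemma nu_val_sum x i (I : Type) (s : seq I) (F : I -> smooth_fun M) :
  (forall k, F k \in_ i) ->
  nu_val x i (\sum_(k <- s) F k) = \sum_(k <- s) nu_val x i (F k).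
Proof.
move=> WF; elim: s => [|k s IH]; first by rewrite !big_nil nu_val0.
by rewrite !big_cons nu_valD ?IH //; exact: fil_sumS.
Qed.

Lemma nu_val_exp x m i f : f \in_ i -> nu_val x (m * i) (f ^+ m) = nu_val x i f ^+ m.
Proof.
move=> Wf; elim: m => [|m IH].
  rewrite expr0 -[in LHS](rmorph1 (smooth_cst M)); exact: nu_val_cst.
by rewrite !exprS mulSn nu_valM ?IH //; exact: fil_expS.
Qed.

Lemma nu_val_prod x (I : Type) (s : seq I) (m : I -> nat) (F : I -> smooth_fun M) :
  (forall k, F k \in_ m k) ->
  nu_val x (\sum_(k <- s) m k)%N (\prod_(k <- s) F k) = \prod_(k <- s) nu_val x (m k) (F k).
Proof.
move=> WF; elim: s => [|k s IH].
  rewrite !big_nil -[in LHS](rmorph1 (smooth_cst M)); exact: nu_val_cst.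
by rewrite !big_cons nu_valM ?IH //; exact: fil_prodS.
Qed.

Definition nu_deg0 x (f : smooth_alg M) : base_alg R := nu_val x 0 (smooth_val f).

Lemma nu_deg0_additive x : zmod_morphism (nu_deg0 x).
Proof. by move=> f g; apply: nu_valB; exact: fil0S. Qed.

Lemma nu_deg0_monoid x : monoid_morphism (nu_deg0 x).
Proof.
split=> [|f g]; last exact: (nu_valM x (fil0S f) (fil0S g)).
by rewrite -[1 in LHS](rmorph1 (smooth_cst M)); exact: nu_val_cst.
Qed.

Definition nu_deg0_hom x : alg_hom (smooth_alg M) (base_alg R) :=
  AlgHom (nu_deg0_additive x) (nu_deg0_monoid x) (nu_val_cst x).

Definition nu_base_at x p : Prop := forall f, nu_val x 0 f = f p.

Lemma nu_base_exists x : exists p, nu_base_at x p.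
Proof. exact: (hom_eval (nu_deg0_hom x)). Qed.

(** The degree 0 class of a bump function at [p] has value 1 under [x], so multiplying by it changes
    no value, while it removes the difference of [f] and [g]. *)
Lemma nu_local x p i f g : nu_base_at x p -> f \in_ i -> g \in_ i ->
  (\forall q \near p, f q = g q) -> nu_val x i f = nu_val x i g.
Proof.
move=> xp Wf Wg /nbhs_interior/nbhs_singleton fg.
have oU := @open_interior M [set q | f q = g q].
have [rho [srho _ rho1 [A [_ AU A0]]]] := bump_manifold oU fg.
have x1 : nu_val x 0 (mk_smooth srho) = 1 by rewrite xp /=; exact: nbhs_singleton rho1.
have E h : h \in_ i -> nu_val x i h = nu_val x i (mk_smooth srho * h).
  by move=> Wh; rewrite -[X in nu_val x X (_ * _)]add0n nu_valM ?x1 ?mul1r //; exact: fil0S.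
rewrite (E f) // (E g) //; congr (nu_val x i (smooth_val _)).
apply: val_inj; apply/funext => q.
rewrite -[LHS]/(rho q * f q) -[RHS]/(rho q * g q); have [Aq|nAq] := pselect (A q).
  by have /interior_subset /= -> := AU q Aq.
by rewrite A0 // !mul0r.
Qed.

(** Terms of weight above [i] have class 0 in degree [i]; only the monomials of weight exactly [i]
    remain. *)
Lemma nu_expansion x p i f (I : finType) (s : I -> 'I_n -> nat) (w : 'I_n -> nat)
    (G : I -> smooth_fun M) (X : 'I_n -> smooth_fun M) :
  nu_base_at x p -> f \in_ i -> (forall k, (i <= \sum_a s k a * w a)%N) ->
  (forall a, X a \in_ w a) ->
  (\forall q \near p, f q = (\sum_k G k * \prod_a X a ^+ s k a) q) ->
  nu_val x i f = \sum_(k | (\sum_a s k a * w a)%N == i)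
    nu_val x 0 (G k) * \prod_a nu_val x (w a) (X a) ^+ s k a.
Proof.
move=> xp Wf ws WX fE.
have WP k : \prod_a X a ^+ s k a \in_ (\sum_a s k a * w a)%N.
  by apply: fil_prodS => a; exact: fil_expS.
have WT k : G k * \prod_a X a ^+ s k a \in_ (\sum_a s k a * w a)%N.
  by rewrite -[X in _ \in_ X]add0n; apply: filMS => //; exact: fil0S.
have WTi k : G k * \prod_a X a ^+ s k a \in_ i by exact: fil_le (ws k) (WT k).
rewrite (nu_local xp Wf _ fE); last exact: fil_sumS.
rewrite nu_val_sum // [RHS]big_mkcond; apply: eq_bigr => k _; case: eqP => [<-|ki].
  rewrite -[X in nu_val x X (_ * _)]add0n nu_valM //; last exact: fil0S.
  congr (_ * _); rewrite nu_val_prod => [|a]; last exact: fil_expS.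
  by apply: eq_bigr => a _; exact: nu_val_exp.
apply: nu_val_deg; apply: fil_le (WT k).
by have := ws k; rewrite leq_eqVlt => /orP[/eqP ik|//]; case: ki.
Qed.

Definition local_model c (w : 'I_n -> nat) : Prop :=
  [/\ coord_chart c, weight_sequence r w &
      forall i (h : M -> R), W i (dom c) h <-> weighted_ideal c w i h].

Lemma Xc_fil c w p b a : local_model c w -> cutoff c p setT b -> Xc c b a \in_ w a.
Proof.
move=> [cc _ loc] cb; rewrite (cutfE cc cb); last exact: smooth_on_coord.
apply: (cut_fil cc openT cb); rewrite setTI; apply/loc.
exists unit, (fun _ a' => nat_of_bool (a' == a)), (fun _ => cst 1); split.
- by move=> _; exact: smooth_on_cst (dom_open c).
- move=> _; rewrite (bigD1 a) //= eqxx mul1n.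
  exact: leq_addr.
- move=> q _; rewrite (eq_bigr (fun=> coord c q 0 a)).
    by rewrite sumr_const card_unit mulr1n.
  move=> _ _; rewrite mul1r (bigD1 a) //= eqxx expr1 big1 ?mulr1 // => a' aa'.
  by rewrite (negbTE aa') expr0.
Qed.

(** One polynomial formula for all [x] over points where [b] is locally 1. Both the uniqueness of
    characters and the smoothness of the canonical map are read off from it. *)
Lemma nu_formula c w b i f : local_model c w -> f \in_ i ->
  exists (I : finType) (s : I -> 'I_n -> nat) (G : I -> smooth_fun M),
    forall x p, nu_base_at x p -> dom c p -> cutoff c p setT b ->
    nu_val x i f = \sum_(k | (\sum_a s k a * w a)%N == i)
      nu_val x 0 (G k) * \prod_a nu_val x (w a) (Xc c b a) ^+ s k a.
Proof.
move=> lm Wf; have [cc _ loc] := lm.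
have [I [s [G [ws fE]]]] := local_expansion b cc loc Wf.
exists I, s, G => x p xp cp cb; apply: (nu_expansion xp Wf ws _ (fE p cp cb)) => a.
exact: Xc_fil lm cb.
Qed.

Lemma local_model_at p : exists c w, local_model c w /\ dom c p.
Proof. by have [c [w [cc cp ws loc]]] := fil_local W p; exists c, w. Qed.

Lemma nu_gr x (P : rees W) d : (forall p, (size (rees_val P p) <= d)%N) ->
  x (to_gr P) = \sum_(i < d) nu_val x i (rees_coef i (rees_val P)).
Proof.
move=> sP; have WP i : W i [set: M] (rees_coef i (rees_val P)).
  by have /asboolP[_] : rees_pred W (rees_val P) by case: P {sP}.
transitivity (x (to_gr (\sum_(i < d) Rees (rees_homog_subproof (WP i))))).
  congr (x (to_gr _)); apply: val_inj; apply/funext => p.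
  rewrite [X in _ = X p](big_morph (@rees_val _ _ _ _ W) (id1 := 0) (op1 := +%R)) //.
  rewrite fct_sumE /= -(poly_def d (fun i => (rees_val P p)`_i)).
  apply/polyP => j; rewrite coef_poly; case: ltnP => // dj.
  by rewrite nth_default // (leq_trans (sP p)).
rewrite rmorph_sum nu_sum; apply: eq_bigr => i _.
by rewrite (nu_valE _ (WP i)).
Qed.

Lemma nu_ext_local x y p c w b : local_model c w -> dom c p ->
  cutoff c p setT b -> nu_base_at x p -> nu_base_at y p ->
  (forall a, nu_val x (w a) (Xc c b a) = nu_val y (w a) (Xc c b a)) -> x = y.
Proof.
move=> lm cp cb xp yp xy; apply: alg_hom_ext => a; have [P ->] := to_gr_surj a.
have [[d sP] WP] : (exists d, forall p, (size (rees_val P p) <= d)%N) /\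
    forall i, W i [set: M] (rees_coef i (rees_val P)).
  by case: P => P /= /asboolP.
rewrite !(nu_gr _ sP); apply: eq_bigr => i _.
have Wf : mk_smooth (fil_smooth openT (WP i)) \in_ i by exact: WP.
have [I [s [G GE]]] := nu_formula b lm Wf.
have := GE x p xp cp cb; rewrite /= => ->; have := GE y p yp cp cb; rewrite /= => ->.
apply: eq_bigr => k _; rewrite xp yp; congr (_ * _).
by apply: eq_bigr => a' _; rewrite xy.
Qed.

(* gr is generated in degrees at most r *)
Lemma nu_ext x y :
  (forall i f, (i <= r)%N -> f \in_ i -> nu_val x i f = nu_val y i f) -> x = y.
Proof.
move=> xy; have [p xp] := nu_base_exists x.
have yp : nu_base_at y p by move=> f; rewrite -xy //; exact: fil0S.
have [c [w [lm cp]]] := local_model_at p; have [_ [_ wr] _] := lm.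
have [b cb] := cutoff_exists openT (I : setT p) cp.
by apply: (nu_ext_local lm cp cb xp yp) => a; apply: xy => //; exact: Xc_fil lm cb.
Qed.

Lemma nu_val_dilate t x i f : f \in_ i ->
  nu_val (nu_dilate t x) i f = t ^+ i * nu_val x i f.
Proof.
move=> Wf; rewrite -[in RHS](nu_val_cst x (t ^+ i)) -nu_valM //; last exact: fil0S.
have Wcf := filMS (fil0S (smooth_cst M (t ^+ i))) Wf.
rewrite (nu_valE _ Wf) (nu_valE _ Wcf); congr (x _).
rewrite [LHS]to_gr_dilate; congr (to_gr _); apply: val_inj; apply/funext => q.
have E : (f q *: 'X^i) \Po (t *: 'X) = (t ^+ i * f q) *: 'X^i :> {poly R}.
  by rewrite comp_polyZ comp_Xn_poly exprZn scalerA mulrC.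
exact: E.
Qed.

End NormalBundle.

Lemma cutoff_move (R : realType) n (M : manifold R n) (c : chart R M n) p q U b :
  cutoff c p U b -> (\forall y \near coord c q, b y = 1) -> cutoff c q U b.
Proof. by case=> Cb b01 _ supp b1; split. Qed.

(** * The character of gr defined by a curve *)

Section CurveNormal.
Context {R : realType} {n : nat} {M : manifold R n} {r : nat} {W : weighting M r}.
Implicit Types (f g : smooth_fun M) (Q : rees W).
Variables (c : chart R M n) (w : 'I_n -> nat) (p0 : M) (b : 'rV[R]_n -> R)
  (P : 'I_n -> {poly R}).
Hypotheses (lm : local_model W c w) (cc : coord_chart c) (cb : cutoff c p0 setT b).
Hypothesis (Pb : \forall y \near pcurve P 0, b y = 1).
Hypothesis (Pw : forall a j, (j < w a)%N -> (P a)`_j = 0).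
Local Notation "f \in_ i" := (W i [set: M] (smooth_val f)) (at level 70).
Local Notation D := (curve_coef c b P).

Local Notation base := (icoord c (pcurve P 0)).

Let base_dom : dom c base /\ coord c base = pcurve P 0.
Proof. by have := curve_dom cb (nbhs_singleton Pb). Qed.

Lemma curve_cutoff : cutoff c base setT b.
Proof. by apply: (cutoff_move cb); rewrite base_dom.2. Qed.

Lemma curve_jet_valuation m i f : f \in_ i -> vanish i (curve_jet cc cb Pb m f).
Proof.
have [_ _ loc] := lm.
apply: (tangent_valuation cc base_dom.1 curve_cutoff loc (curve_jet_base cc cb Pb m)).
by move=> a j ja jm; rewrite curve_jetE // (curve_coef_Xc cc cb Pb) Pw.
Qed.

(** The jet of the curve is taken at order [j] instead of [r], so that all degrees are covered, also
    those above [r]. *)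
Lemma curve_vanish i j f : f \in_ i -> (j < i)%N -> D j f = 0.
Proof.
move=> Wf ji.
by rewrite -(curve_jetE cc cb Pb f (leqnn j)) (curve_jet_valuation Wf).
Qed.

Definition rcoef i Q : smooth_fun M := insubd 0 (rees_coef i (rees_val Q)).

Lemma rees_valP Q : (exists d, forall p, (size (rees_val Q p) <= d)%N) /\
  forall i, W i [set: M] (rees_coef i (rees_val Q)).
Proof. by case: Q => Q /= /asboolP. Qed.

Lemma rcoefE i Q : rcoef i Q = rees_coef i (rees_val Q) :> (M -> R).
Proof.
rewrite /rcoef val_insubd ifT //; apply/asboolP.
exact: fil_smooth openT ((rees_valP Q).2 i).
Qed.

Lemma rcoef_fil i Q : rcoef i Q \in_ i.
Proof. by rewrite rcoefE; exact: (rees_valP Q).2. Qed.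

Lemma smooth_fun_ext f g : f = g :> (M -> R) -> f = g.
Proof. by move=> fg; apply: val_inj. Qed.

Lemma rcoefB i Q1 Q2 : rcoef i (Q1 - Q2) = rcoef i Q1 - rcoef i Q2.
Proof.
apply: smooth_fun_ext; rewrite rcoefE.
have -> : smooth_val (rcoef i Q1 - rcoef i Q2) =
    smooth_val (rcoef i Q1) - smooth_val (rcoef i Q2) by [].
by rewrite !rcoefE -rees_coefB.
Qed.

Lemma rcoefM k Q1 Q2 :
  rcoef k (Q1 * Q2) = \sum_(i < k.+1) rcoef i Q1 * rcoef (k - i) Q2.
Proof.
apply: smooth_fun_ext; rewrite rcoefE; apply/funext => q.
rewrite smooth_val_sum [rees_val _]/(rees_val Q1 * rees_val Q2) rees_coefM fct_sumE.
by apply: eq_bigr => i _; rewrite -!rcoefE.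
Qed.

(* the sum over i of the leading coefficients D_i (Q_i), recorded as a
   polynomial so that multiplicativity becomes a coefficientwise statement *)
Definition curve_poly Q : {poly R} :=
  \poly_(i < sval (cid (rees_valP Q).1)) D i (rcoef i Q).

Lemma coef_curve_poly i Q : (curve_poly Q)`_i = D i (rcoef i Q).
Proof.
rewrite coef_poly; case: cid => d sQ /=; case: ltnP => // di.
suff -> : rcoef i Q = smooth_cst M 0.
  by rewrite curve_coef_cst // mul0rn.
apply: smooth_fun_ext; rewrite rcoefE; apply/funext => p.
by rewrite /rees_coef nth_default // (leq_trans (sQ p)).
Qed.

Lemma curve_polyB Q1 Q2 : curve_poly (Q1 - Q2) = curve_poly Q1 - curve_poly Q2.
Proof.
by apply/polyP => i; rewrite coefB !coef_curve_poly rcoefB (curve_coefB P cc cb).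
Qed.

Lemma curve_coef_sum k (I : Type) (s : seq I) (F : I -> smooth_fun M) :
  D k (\sum_(i <- s) F i) = \sum_(i <- s) D k (F i).
Proof.
rewrite -(curve_jetE cc cb Pb _ (leqnn k)) hom_sum jet_coef_sum; apply: eq_bigr => i _.
by rewrite curve_jetE.
Qed.

(** In the Leibniz sum for the product of the components of degrees [i] and [k - i], only the term
    of index [j = i] survives: for j < i the first factor vanishes, and for j > i the second, since
    then k - j < k - i. *)
Lemma curve_polyM Q1 Q2 : curve_poly (Q1 * Q2) = curve_poly Q1 * curve_poly Q2.
Proof.
apply/polyP => k; rewrite coefM coef_curve_poly rcoefM curve_coef_sum.
apply: eq_bigr => i _; rewrite !coef_curve_poly (curve_coefM cc cb Pb).
rewrite (bigD1 i) //= big1 ?addr0 // => j ji.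
have [lt|gt|E] := ltngtP (j : nat) (i : nat); last by case/eqP: ji; apply: val_inj.
  by rewrite (curve_vanish (rcoef_fil i Q1)) ?mul0r.
rewrite [X in _ * X](curve_vanish (rcoef_fil (k - i) Q2)) ?mulr0 //.
by have := ltn_ord j; lia.
Qed.

(** A component of degree i+1 has no i-th coefficient along the curve, so [curve_poly] descends to
    gr. *)
Lemma curve_poly_ideal Q : gr_ideal Q -> curve_poly Q = 0.
Proof.
move=> /asboolP IQ; apply/polyP => i; rewrite coef_curve_poly coef0.
by apply: (@curve_vanish i.+1) => //; rewrite rcoefE.
Qed.

Definition nu_curve_fun (a : gr_alg W) : base_alg R :=
  (curve_poly (repr (a : gr W))).[1].

Lemma nu_curve_to_gr Q : nu_curve_fun (to_gr Q) = (curve_poly Q).[1].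
Proof.
rewrite /nu_curve_fun; congr (_ .[1]); apply/subr0_eq.
rewrite -curve_polyB; apply/curve_poly_ideal/to_grP.
by rewrite /to_gr reprK.
Qed.

Lemma nu_curve_additive : zmod_morphism nu_curve_fun.
Proof.
move=> x y; have [P1 ->] := to_gr_surj x; have [P2 ->] := to_gr_surj y.
by rewrite -rmorphB !nu_curve_to_gr curve_polyB hornerD hornerN.
Qed.

Lemma curve_coef_homog i f (Q : rees W) :
  (forall q, rees_val Q q = f q *: 'X^i) -> curve_poly Q = D i f *: 'X^i.
Proof.
move=> QE; apply/polyP => j; rewrite coef_curve_poly coefZ coefXn.
have [->|ji] := eqVneq j i.
  rewrite mulr1; congr (D i _); apply: smooth_fun_ext; rewrite rcoefE.
  by apply/funext => q; rewrite /rees_coef QE coefZ coefXn eqxx mulr1.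
rewrite mulr0 (_ : rcoef j Q = smooth_cst M 0).
  by rewrite curve_coef_cst // mul0rn.
apply: smooth_fun_ext; rewrite rcoefE; apply/funext => q.
by rewrite /rees_coef QE coefZ coefXn (negbTE ji) mulr0.
Qed.

Lemma nu_curve_unit x : nu_curve_fun (alg_unit (gr_alg W) x) = alg_unit (base_alg R) x.
Proof.
rewrite [alg_unit (gr_alg W) x]/(to_gr (rees_cst W x)) nu_curve_to_gr.
rewrite (@curve_coef_homog 0 (smooth_cst M x)) => [|q].
  by rewrite curve_coef_cst // hornerZ hornerXn expr1n mulr1 mulr1n.
by rewrite expr0 alg_polyC.
Qed.

Lemma nu_curve_monoid : monoid_morphism nu_curve_fun.
Proof.
split=> [|x y].
  by rewrite -[1 in LHS](rmorph1 (alg_unit (gr_alg W))) nu_curve_unit.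
have [P1 ->] := to_gr_surj x; have [P2 ->] := to_gr_surj y.
by rewrite -rmorphM !nu_curve_to_gr curve_polyM hornerM.
Qed.

Definition nu_curve : weighted_normal_bundle W :=
  AlgHom nu_curve_additive nu_curve_monoid nu_curve_unit.

Lemma nu_curve_val i f : f \in_ i -> nu_val nu_curve i f = D i f.
Proof.
move=> Wf; rewrite (nu_valE _ Wf) [nu_curve _]nu_curve_to_gr.
by rewrite (@curve_coef_homog i f) // hornerZ hornerXn expr1n mulr1.
Qed.

End CurveNormal.

(** * Differential spaces *)

Section DiffSpaceTheory.
Context {R : realType}.
Implicit Types X Y : diff_space R.

Definition diff_nbhs X (x : X) (A : set X) : Prop :=
  exists (k : nat) (g : 'I_k -> X -> R) (e : R),
    [/\ forall i, generators (g i), 0 < e &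
        forall y, (forall i, `|g i y - g i x| < e) -> A y].

Lemma diff_nbhs_le X (x : X) (A B : set X) : A `<=` B -> diff_nbhs x A -> diff_nbhs x B.
Proof.
move=> AB [k [g [e [gG e0 H]]]]; exists k, g, e; split=> // y /H; exact: AB.
Qed.

Lemma diff_nbhsI X (x : X) (A B : set X) :
  diff_nbhs x A -> diff_nbhs x B -> diff_nbhs x (A `&` B).
Proof.
move=> [k [g [e [gG e0 H]]]] [k' [g' [e' [gG' e0' H']]]].
exists (k + k')%N, (fun i => match fintype.split i with inl j => g j | inr j => g' j end),
  (Num.min e e'); split.
- by move=> i; case: fintype.split.
- by rewrite lt_min e0.
- move=> y Hy; split; [apply: H => i|apply: H' => i].
    have := Hy (lshift k' i); rewrite lt_min => /andP[+ _].
    by case: splitP => j /= E; [have -> : j = i by apply: val_inj|have := ltn_ord i; lia].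
  have := Hy (rshift k i); rewrite lt_min => /andP[_].
  case: splitP => j /= E; first by have := ltn_ord j; lia.
  by have -> : j = i by apply: val_inj => /=; lia.
Qed.

Lemma diff_nbhsT X (x : X) : diff_nbhs x setT.
Proof. by exists 0%N, (fun _ _ => 0), 1; split=> // -[]. Qed.

Lemma diff_nbhs_all X (x : X) (I : finType) (A : I -> set X) :
  (forall i, diff_nbhs x (A i)) -> diff_nbhs x (fun y => forall i, A i y).
Proof.
move=> HA; suff : diff_nbhs x (fun y => forall i, i \in enum I -> A i y).
  by apply: diff_nbhs_le => y Hy i; apply: Hy; rewrite mem_enum.
elim: (enum I) => [|i s IH]; first exact: diff_nbhs_le (diff_nbhsT x).
apply: diff_nbhs_le (diff_nbhsI (HA i) IH) => y [H1 H2] j.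
by rewrite inE => /orP[/eqP ->|/H2].
Qed.

Lemma diff_openI X (A B : set X) : diff_open A -> diff_open B -> diff_open (A `&` B).
Proof. by move=> oA oB x [Ax Bx]; exact: diff_nbhsI (oA x Ax) (oB x Bx). Qed.

Lemma diff_openT X : diff_open (setT : set X).
Proof. by move=> x _; exact: diff_nbhsT. Qed.

Lemma diff_open_all X (I : finType) (A : I -> set X) :
  (forall i, diff_open (A i)) -> diff_open (fun y => forall i, A i y).
Proof. by move=> oA x Ax; apply: diff_nbhs_all => i; exact: oA. Qed.

Lemma diff_smooth_local X (V : set X) (h : X -> R) :
  (forall x, V x -> exists (O : set X) (h' : X -> R),
     [/\ diff_open O, O x, diff_smooth (V `&` O) h' &
         forall y, O y -> V y -> h y = h' y]) -> diff_smooth V h.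
Proof.
move=> H x Vx; have [ O [h1 [oO Ox sh hh]]] := H x Vx.
have [k [g [F [ O' [gG CF oO' Ox' E]]]]] := sh x (conj Vx Ox).
exists k, g, F, (O `&` O'); split=> //; first exact: diff_openI.
by move=> y [Oy Oy'] Vy; rewrite hh // E.
Qed.

Lemma diff_smooth_sub X (U V : set X) (h : X -> R) : V `<=` U ->
  diff_smooth U h -> diff_smooth V h.
Proof.
move=> VU sh x Vx; have [k [g [F [ O [gG CF oO Ox E]]]]] := sh x (VU x Vx).
by exists k, g, F, O; split=> // y Oy /VU; exact: E.
Qed.

Lemma diff_smooth_ext X (V : set X) (h h' : X -> R) :
  (forall x, V x -> h x = h' x) -> diff_smooth V h -> diff_smooth V h'.
Proof.
move=> hh' sh; apply: diff_smooth_local => x Vx.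
exists setT, h; split=> //; first exact: diff_openT.
  by apply: diff_smooth_sub sh => y [].
by move=> y _ /hh'.
Qed.

Lemma diff_smooth_gen X (V : set X) (g : X -> R) : generators g -> diff_smooth V g.
Proof.
move=> gG x Vx; exists 1%N, (fun _ => g), (fun z => z 0 0), setT; split=> //.
- by apply: Cinf_coord; exact: openT.
- exact: diff_openT.
- by move=> y _ _; rewrite mxE.
Qed.

Lemma diff_smooth_cst X (V : set X) (a : R) : diff_smooth V (cst a).
Proof.
move=> x Vx; exists 0%N, (fun _ _ => 0), (cst a), setT; split=> //.
- by case.
- by apply: Cinf_cst; exact: openT.
- exact: diff_openT.
Qed.

Lemma diff_smooth_comp X (V : set X) (k : nat) (h : 'I_k -> X -> R)
    (F : 'rV[R]_k -> R) : (forall i, diff_smooth V (h i)) -> Cinf setT F ->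
  diff_smooth V (fun x => F (\row_i h i x)).
Proof.
move=> sh CF x Vx.
pose S := {m : nat & (('I_m -> X -> R) * ('rV[R]_m -> R) * set X)%type}.
have /choice[D DP] : forall i, exists D : S,
    [/\ forall j, generators ((projT2 D).1.1 j), Cinf setT (projT2 D).1.2,
        diff_open (projT2 D).2, (projT2 D).2 x &
        forall y, (projT2 D).2 y -> V y ->
          h i y = (projT2 D).1.2 (\row_j (projT2 D).1.1 j y)].
  move=> i; have [m [g [G [ O HO]]]] := sh i x Vx.
  by exists (existT _ m (g, G, O)).
pose m i := projT1 (D i); pose g i := (projT2 (D i)).1.1.
pose G i := (projT2 (D i)).1.2; pose O i := (projT2 (D i)).2.
(* Each [h i] has its own number [m i] of generators. Their disjoint union is enumerated, and
   [sel i] reads off the i-th block. *)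
pose T := {i : 'I_k & 'I_(m i)}.
pose sel i (z : 'rV[R]_#|{: T}|) : 'rV[R]_(m i) :=
  \row_j z 0 (enum_rank (Tagged (fun i => 'I_(m i)) j : T)).
exists #|{: T}|, (fun t => g (tag (enum_val t)) (tagged (enum_val t))),
  (fun z => F (\row_i G i (sel i z))), (fun y => forall i, O i y); split.
- by move=> t; have [gG _ _ _ _] := DP (tag (enum_val t)); exact: gG.
- apply: (@Cinf_comp _ _ _ setT setT F (fun z => \row_i G i (sel i z))) => //;
    do ?exact: openT.
  move=> i; apply: (@Cinf_ext _ _ _ (G i \o sel i)); first exact: openT.
    by move=> z _; rewrite [RHS]mxE.
  apply: (@Cinf_comp _ _ _ setT setT) => //; do ?exact: openT.
    move=> j; pose t := enum_rank (Tagged (fun i => 'I_(m i)) j : T).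
    apply: (Cinf_ext openT _ (Cinf_coord t openT)).
    by move=> z _; rewrite mxE.
  by have [] := DP i.
- by apply: diff_open_all => i; have [] := DP i.
- by move=> i; have [] := DP i.
- move=> y Oy Vy; congr F; apply/rowP => i; rewrite !mxE.
  have [_ _ _ _ E] := DP i; rewrite (E y (Oy i) Vy).
  by congr (G i _); apply/rowP => j; rewrite !mxE enum_rankK.
Qed.

Lemma diff_smoothD X (V : set X) (h1 h2 : X -> R) :
  diff_smooth V h1 -> diff_smooth V h2 -> diff_smooth V (fun x => h1 x + h2 x).
Proof.
move=> s1 s2; pose h (i : 'I_2) := if i == 0 then h1 else h2.
apply: (@diff_smooth_ext _ _ (fun x => (fun z : 'rV[R]_2 => z 0 0 + z 0 1) (\row_i h i x))).
  by move=> x _; rewrite !mxE.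
apply: (@diff_smooth_comp _ V 2 h (fun z => z 0 0 + z 0 1)) => [i|].
  by rewrite /h; case: ifP.
by apply: CinfD; [exact: openT|exact: Cinf_coord openT|exact: Cinf_coord openT].
Qed.

Lemma diff_smoothM X (V : set X) (h1 h2 : X -> R) :
  diff_smooth V h1 -> diff_smooth V h2 -> diff_smooth V (fun x => h1 x * h2 x).
Proof.
move=> s1 s2; pose h (i : 'I_2) := if i == 0 then h1 else h2.
apply: (@diff_smooth_ext _ _ (fun x => (fun z : 'rV[R]_2 => z 0 0 * z 0 1) (\row_i h i x))).
  by move=> x _; rewrite !mxE.
apply: (@diff_smooth_comp _ V 2 h (fun z => z 0 0 * z 0 1)) => [i|].
  by rewrite /h; case: ifP.
by apply: CinfM; [exact: openT|exact: Cinf_coord openT|exact: Cinf_coord openT].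
Qed.

Lemma diff_smooth_sum X (V : set X) (I : Type) (s : seq I) (P : pred I)
    (h : I -> X -> R) : (forall i, diff_smooth V (h i)) ->
  diff_smooth V (fun x => \sum_(i <- s | P i) h i x).
Proof.
move=> sh; elim: s => [|i s IH].
  apply: (@diff_smooth_ext _ _ (cst 0)) => [x _|]; first by rewrite big_nil.
  exact: diff_smooth_cst.
apply: (@diff_smooth_ext _ _ (fun x => (if P i then h i x else 0) +
    \sum_(i <- s | P i) h i x)) => [x _|].
  by rewrite big_cons; case: ifP => // _; rewrite add0r.
by apply: diff_smoothD => //; case: (P i) => //; exact: diff_smooth_cst.
Qed.

Lemma diff_smooth_prod X (V : set X) (I : Type) (s : seq I)
    (h : I -> X -> R) : (forall i, diff_smooth V (h i)) ->
  diff_smooth V (fun x => \prod_(i <- s) h i x).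
Proof.
move=> sh; elim: s => [|i s IH].
  apply: (@diff_smooth_ext _ _ (cst 1)) => [x _|]; first by rewrite big_nil.
  exact: diff_smooth_cst.
apply: (@diff_smooth_ext _ _ (fun x => h i x * \prod_(i <- s) h i x)) => [x _|].
  by rewrite big_cons.
exact: diff_smoothM.
Qed.

Lemma diff_smoothX X (V : set X) (h : X -> R) m :
  diff_smooth V h -> diff_smooth V (fun x => h x ^+ m).
Proof.
move=> sh; elim: m => [|m IH].
  apply: (@diff_smooth_ext _ _ (cst 1)) => [x _|]; first by rewrite expr0.
  exact: diff_smooth_cst.
apply: (@diff_smooth_ext _ _ (fun x => h x * h x ^+ m)) => [x _|].
  by rewrite exprS.
exact: diff_smoothM.
Qed.

Lemma diff_smooth_nbhs X (V : set X) (h : X -> R) x e : diff_open V ->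
  diff_smooth V h -> V x -> 0 < e -> diff_nbhs x [set y | V y /\ `|h y - h x| < e].
Proof.
move=> oV sh Vx e0; have [k [g [F [ O [gG CF oO Ox E]]]]] := sh x Vx.
have /cvgrPdist_lt/(_ e e0)/nbhs_ballP[d /= d0 dF] :=
  Cinf_continuous CF (I : setT (\row_i g i x)).
have : diff_nbhs x (fun y => forall i, `|g i y - g i x| < d / 2).
  by exists k, g, (d / 2); split=> //; rewrite divr_gt0.
move=> /(diff_nbhsI (oO x Ox))/(diff_nbhsI (oV x Vx)).
apply: diff_nbhs_le => y [Vy [Oy gy]]; split=> //.
rewrite !E // distrC; apply: dF; rewrite -ball_normE /ball_ /= distrC.
apply: (@le_lt_trans _ _ (d / 2)); last by rewrite ltr_pdivrMr // ltr_pMr // ltr1n.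
apply: norm_rV_le => [|i]; first by rewrite divr_ge0 // ltW.
by rewrite !mxE ltW.
Qed.

Lemma diff_open_preimage X Y (U : set X) (V : set Y) (phi : X -> Y) :
  diff_open U -> diff_open V -> diff_smooth_map U phi ->
  diff_open (U `&` phi @^-1` V).
Proof.
move=> oU oV sphi x [Ux Vx]; have [k [g [e [gG e0 H]]]] := oV _ Vx.
have H1 : diff_nbhs x (fun y => forall i, U y /\ `|g i (phi y) - g i (phi x)| < e).
  apply: diff_nbhs_all => i; apply: (@diff_smooth_nbhs _ U (g i \o phi)) => //.
  exact: sphi.
apply: diff_nbhs_le (diff_nbhsI (oU x Ux) H1) => y [Uy Hy]; split=> //.
by apply: H => i; have [] := Hy i.
Qed.

Lemma diff_smooth_pullback X Y (U : set X) (V : set Y) (phi : X -> Y) (h : Y -> R) :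
  diff_open U -> diff_open V -> diff_smooth_map U phi -> diff_smooth V h ->
  diff_smooth (U `&` phi @^-1` V) (h \o phi).
Proof.
move=> oU oV sphi sh; apply: diff_smooth_local => x [Ux Vx].
have [k [g [F [ O [gG CF oO Ox E]]]]] := sh _ Vx.
exists (U `&` phi @^-1` O), (fun y => F (\row_i (g i \o phi) y)); split.
- exact: diff_open_preimage.
- by [].
- apply: diff_smooth_comp => // i.
  by apply: diff_smooth_sub (sphi _ (gG i)) => y [[]].
- by move=> y [Uy Oy] [_ Vy] /=; rewrite E.
Qed.

(** Everything descends along a local section [s]: where [s] is defined, [V] is the preimage under
    [s] of its own preimage under [phi], and [h] equals [(h \o phi) \o s]. *)
Lemma submersion_quotient X Y (phi : X -> Y) : diff_submersion phi ->
  (forall y, exists x, phi x = y) -> diff_quotient_structure phi.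
Proof.
move=> [sphi sec] surj.
have pre V : diff_open V -> diff_open (phi @^-1` V).
  move=> oV; rewrite -[_ @^-1` _]setTI.
  exact: diff_open_preimage (@diff_openT X) oV sphi.
split=> [V|V h oV].
  split=> [|oV y Vy]; first exact: pre.
  have [x xy] := surj y; subst y.
  have [V' [s [oV' Vx' ss sx sK]]] := sec x.
  have := @diff_open_preimage _ _ V' (phi @^-1` V) s oV' oV ss (phi x).
  case; first by split; rewrite //= sx.
  move=> k [g [e [gG e0 H]]]; exists k, g, e; split=> // z /H [Vz' /=].
  by rewrite sK ?inE.
split=> sh.
  rewrite -[_ @^-1` _]setTI.
  exact: diff_smooth_pullback (@diff_openT X) oV sphi sh.
apply: diff_smooth_local => y Vy; have [x xy] := surj y; subst y.
have [V' [s [oV' Vx' ss sx sK]]] := sec x.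
exists (V' `&` s @^-1` (phi @^-1` V)), ((h \o phi) \o s); split.
- exact: diff_open_preimage oV' (pre _ oV) ss.
- by split=> //=; rewrite sx.
- apply: diff_smooth_sub (diff_smooth_pullback oV' (pre _ oV) ss sh).
  by move=> z [].
- by move=> z [Vz' _] _ /=; rewrite sK ?inE.
Qed.

End DiffSpaceTheory.

(** * The canonical map *)

Section Quotient.
Context {R : realType} {n r : nat} {M : manifold R n} {W : weighting M r}.
Implicit Types (f g : smooth_fun M) (p : M) (c : chart R M n) (b : 'rV[R]_n -> R)
  (x : weighted_normal_bundle W) (u : higher_tangent (r := r) (M := M))
  (q : subbundle W).
Local Notation "f \in_ i" := (W i [set: M] (smooth_val f)) (at level 70).

(** Over this open set the cut-off coordinates are the true ones, and one [b] serves at all points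
    simultaneously, as a local section requires. *)
Definition cutoff_core c b : set M :=
  [set p | dom c p /\ \forall y \near coord c p, b y = 1].

Lemma cutoff_core_open c b : open (cutoff_core c b).
Proof.
rewrite openE => p [cp b1]; exact: coord_near cp (near_join b1).
Qed.

Lemma cutoff_core_mem c b p : dom c p -> cutoff c p setT b -> cutoff_core c b p.
Proof. by move=> cp [_ _ b1 _]; split. Qed.

Definition nu_over (O : set M) : set (nu_space W) :=
  [set x | exists p, nu_base_at x p /\ O p].

Definition subbundle_over (O : set M) : set (subbundle_space W) :=
  [set q | exists p, base_at (proj1_sig q) p /\ O p].

Lemma nu_val_generator i f : f \in_ i ->
  @generators R (nu_space W) (fun x => nu_val x i f).
Proof. by move=> Wf; exists (gr_class Wf); apply/funext => x; exact: nu_valE. Qed.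

Lemma lift_generator i f : (i <= r)%N ->
  @generators R (subbundle_space W) (fun q => lift i f (proj1_sig q)).
Proof. by move=> ir; exists (lift i f) => //; exists i, f. Qed.

(** The degree 0 class of a bump function supported in [O] is a generator. Where it differs by less
    than 1 from its value 1 at [x], the bump function does not vanish at the base point, which
    therefore lies in [O]. *)
Lemma nu_over_open (O : set M) : open O -> diff_open (nu_over O).
Proof.
move=> oO x [p [xp Op]].
have [rho [srho rho01 rho1 [A [cA AO A0]]]] := bump_manifold oO Op.
pose f := mk_smooth srho.
exists 1%N, (fun _ x => nu_val x 0 f), 1; split=> // [_|y /(_ ord0)].
  by apply: nu_val_generator; exact: fil0S.
have [p' yp] := nu_base_exists y; rewrite xp yp /= (nbhs_singleton rho1) => H.
exists p'; split=> //; apply: AO; apply: contrapT => /A0 E.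
by move: H; rewrite E sub0r normrN normr1 ltxx.
Qed.

Lemma subbundle_over_open (O : set M) : open O -> diff_open (subbundle_over O).
Proof.
move=> oO q [p [qp Op]].
have [rho [srho rho01 rho1 [A [cA AO A0]]]] := bump_manifold oO Op.
pose f := mk_smooth srho.
exists 1%N, (fun _ q => lift 0 f (proj1_sig q)), 1; split=> // [_|q' /(_ ord0)].
  exact: lift_generator.
have [p' qp'] := base_exists (proj1_sig q').
rewrite /lift qp qp' /= (nbhs_singleton rho1) => H.
exists p'; split=> //; apply: AO; apply: contrapT => /A0 E.
by move: H; rewrite E sub0r normrN normr1 ltxx.
Qed.

(** * Local sections over one weighted chart *)

Section LocalSection.
Variables (c : chart R M n) (w : 'I_n -> nat) (p0 : M) (b : 'rV[R]_n -> R).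
Hypotheses (lm : local_model W c w) (cp0 : dom c p0) (cb : cutoff c p0 setT b).

Let cc : coord_chart c. Proof. by case: lm. Qed.

Lemma core_cutoff p : cutoff_core c b p -> cutoff c p setT b.
Proof. by move=> [_ b1]; exact: cutoff_move cb b1. Qed.

Lemma Xc_filT a : Xc c b a \in_ w a.
Proof. exact: Xc_fil lm cb. Qed.

Lemma weight_le a : (w a <= r)%N.
Proof. by have [_ [_ wr] _] := lm. Qed.

Lemma Xc_core p a : cutoff_core c b p -> Xc c b a p = coord c p 0 a.
Proof.
move=> cbp; have [cp _] := cbp.
exact: nbhs_singleton (Xc_near a cc cp (core_cutoff cbp)).
Qed.

Definition nu_coord x : 'rV[R]_n := \row_a nu_val x (w a) (Xc c b a).

(** The part of the curve that a section keeps fixed. The coefficient of t^(w a) is also 0, to be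
    filled by the value xi_a of the character. *)
Definition transverse (C : 'I_n -> {poly R}) : Prop :=
  forall a j, (j <= w a)%N -> (C a)`_j = 0.

Definition nu_curve_of (C : 'I_n -> {poly R}) x : 'I_n -> {poly R} :=
  perturb C w (nu_coord x).

Lemma coef_nu_curve_of C x a j : transverse C -> (j <= w a)%N ->
  (nu_curve_of C x a)`_j = nu_val x (w a) (Xc c b a) *+ (j == w a).
Proof.
move=> tC ja; rewrite coefD coefZ coefXn tC // add0r mxE.
by case: eqP => _; rewrite ?mulr1 ?mulr0.
Qed.

(** In weight 0 the value xi_a is the a-th coordinate of the base point. In positive weight both
    sides vanish, because [Xc c b a] then has degree at least 1. *)
Lemma nu_curve_base C x p : transverse C -> nu_base_at x p -> cutoff_core c b p ->
  pcurve (nu_curve_of C x) 0 = coord c p.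
Proof.
move=> tC xp cbp; apply/rowP => a; rewrite mxE horner_coef0 coef_nu_curve_of //.
rewrite -(Xc_core a cbp) -xp eq_sym; case: eqP => [->|w0] //=.
rewrite mulr0n nu_val_deg //; apply: fil_le (Xc_filT a).
by rewrite lt0n; apply/eqP.
Qed.

Lemma nu_curve_core C x : transverse C -> nu_over (cutoff_core c b) x ->
  \forall y \near pcurve (nu_curve_of C x) 0, b y = 1.
Proof. by move=> tC [p [xp cbp]]; rewrite (nu_curve_base tC xp cbp); case: cbp. Qed.

Lemma nu_curve_weight C x a j : transverse C -> (j < w a)%N ->
  (nu_curve_of C x a)`_j = 0.
Proof.
by move=> tC ja; rewrite coef_nu_curve_of 1?ltnW // (ltn_eqF ja).
Qed.

Lemma section_exists C x : transverse C -> nu_over (cutoff_core c b) x ->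
  exists q, forall f i, (i <= r)%N ->
    lift i f (proj1_sig q) = curve_coef c b (nu_curve_of C x) i f.
Proof.
move=> tC Vx; have Pb := nu_curve_core tC Vx.
have uQ : in_subbundle W (curve_jet cc cb Pb r).
  move=> i j f Wf ji ir; have Pw a k := @nu_curve_weight C x a k tC.
  exact: (curve_jet_valuation lm cc cb Pb Pw Wf ji (leq_trans (ltnW ji) ir)).
by exists (exist _ _ uQ) => f i ir; exact: curve_jetE.
Qed.

Lemma subbundle_ext_local q1 q2 p : base_at (proj1_sig q1) p ->
  base_at (proj1_sig q2) p -> cutoff_core c b p ->
  (forall a i, (i <= r)%N -> lift i (Xc c b a) (proj1_sig q1) =
     lift i (Xc c b a) (proj1_sig q2)) -> q1 = q2.
Proof.
case: q1 q2 => [u1 Q1] [u2 Q2] /= b1 b2 cbp E.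
have uE : u1 = u2.
  apply: alg_hom_ext => f; have [cp _] := cbp.
  apply: (tangent_ext cc cp (core_cutoff cbp) b1 b2) => a.
  by apply: jet_ext => i ir; exact: E.
by case: _ / uE Q2 {b2 E} => Q2; congr exist; exact: Prop_irrelevance.
Qed.

(** Read as a curve. Any curve with the same [r]-jet would define the same character; the
    coefficients above [r] are set to 0. *)
Definition sub_coord q (a : 'I_n) : {poly R} :=
  \poly_(j < r.+1) lift j (Xc c b a) (proj1_sig q).

Lemma coef_sub_coord q a j : (j <= r)%N ->
  (sub_coord q a)`_j = lift j (Xc c b a) (proj1_sig q).
Proof. by move=> jr; rewrite coef_poly ltnS jr. Qed.

Lemma sub_coord_weight q a j : (j < w a)%N -> (sub_coord q a)`_j = 0.
Proof.
move=> ja; have jr : (j <= r)%N by apply: leq_trans (ltnW ja) (weight_le a).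
by rewrite coef_sub_coord //; exact: (proj2_sig q) (Xc_filT a) ja (weight_le a).
Qed.

Lemma sub_coord_base q p : base_at (proj1_sig q) p -> cutoff_core c b p ->
  pcurve (sub_coord q) 0 = coord c p.
Proof.
move=> qp cbp; apply/rowP => a.
by rewrite mxE horner_coef0 coef_sub_coord // [lift _ _ _]qp Xc_core.
Qed.

Lemma lift_sub_coord q p f i : base_at (proj1_sig q) p -> cutoff_core c b p ->
  (i <= r)%N -> lift i f (proj1_sig q) = curve_coef c b (sub_coord q) i f.
Proof.
move=> qp cbp ir; have [cp b1] := cbp.
have Pb : \forall y \near pcurve (sub_coord q) 0, b y = 1.
  by rewrite (sub_coord_base qp cbp).
rewrite -(curve_jetE cc cb Pb _ ir) /lift; congr (jet_coef i _).
apply: (tangent_ext cc cp (core_cutoff cbp) qp).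
  have := curve_jet_base cc cb Pb r.
  by rewrite (sub_coord_base qp cbp) coordK ?inE.
move=> a; apply: jet_ext => j jr.
by rewrite curve_jetE // (curve_coef_Xc cc cb Pb) coef_sub_coord.
Qed.

Lemma nu_of_subbundle q p : base_at (proj1_sig q) p -> cutoff_core c b p ->
  exists x, forall i f, (i <= r)%N -> f \in_ i -> nu_val x i f = lift i f (proj1_sig q).
Proof.
move=> qp cbp; have Pb : \forall y \near pcurve (sub_coord q) 0, b y = 1.
  by rewrite (sub_coord_base qp cbp); case: cbp.
exists (nu_curve lm cc cb Pb (fun a j => @sub_coord_weight q a j)) => i f ir Wf.
by rewrite nu_curve_val // (lift_sub_coord f qp cbp ir).
Qed.

End LocalSection.

Lemma nu_of_subbundle_ex q : exists x, forall i f, (i <= r)%N -> f \in_ i ->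
  nu_val x i f = lift i f (proj1_sig q).
Proof.
have [p qp] := base_exists (proj1_sig q).
have [c [w [lm cp]]] := local_model_at W p.
have [b cb] := cutoff_exists openT (I : setT p) cp.
exact: (nu_of_subbundle lm cb qp (cutoff_core_mem cp cb)).
Qed.

Definition nu_map q : weighted_normal_bundle W := sval (cid (nu_of_subbundle_ex q)).

Lemma nu_mapP q i f : (i <= r)%N -> f \in_ i ->
  nu_val (nu_map q) i f = lift i f (proj1_sig q).
Proof. by rewrite /nu_map; case: cid => x /= H; exact: H. Qed.

Lemma nu_map_base q p : base_at (proj1_sig q) p -> nu_base_at (nu_map q) p.
Proof. by move=> qp f; rewrite nu_mapP //; [exact: qp|exact: fil0S]. Qed.

Lemma nu_map_dilate t q : nu_map (subbundle_dilate t q) = nu_dilate t (nu_map q).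
Proof.
apply: nu_ext => i f ir Wf; rewrite nu_val_dilate // !nu_mapP //.
by rewrite /lift /= jet_coef_dilate.
Qed.

Lemma nu_map_section c w p0 b C x : local_model W c w -> cutoff c p0 setT b ->
  transverse w C -> nu_over (cutoff_core c b) x ->
  forall q, (forall f i, (i <= r)%N ->
    lift i f (proj1_sig q) = curve_coef c b (nu_curve_of c w b C x) i f) ->
  nu_map q = x.
Proof.
move=> lm cb tC Vx q qE; have [p [xp cbp]] := Vx; have [cp _] := cbp.
have [cc _ _] := lm; have Pb := nu_curve_core lm cb tC Vx.
have qp : base_at (proj1_sig q) p.
  move=> f; rewrite -[LHS]/(lift 0 f _) qE // curve_coef0 //.
  by rewrite (nu_curve_base lm cb tC xp cbp) coordK ?inE.
apply: (nu_ext_local lm cp (core_cutoff cb cbp) (nu_map_base qp) xp) => a.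
rewrite nu_mapP; [|exact: weight_le lm a|exact: Xc_filT lm cb a].
rewrite qE; last exact: weight_le lm a.
by rewrite (curve_coef_Xc cc cb Pb) coef_nu_curve_of // eqxx.
Qed.

Lemma nu_map_surj x : exists q, nu_map q = x.
Proof.
have [p xp] := nu_base_exists x; have [c [w [lm cp]]] := local_model_at W p.
have [b cb] := cutoff_exists openT (I : setT p) cp.
(* With [C = 0] the curve is the quasi-homogeneous one, xi_a t^(w a) in coordinate [a]. *)
have tC : transverse w (fun=> 0) by move=> a j _; rewrite coef0.
have Vx : nu_over (cutoff_core c b) x.
  by exists p; split=> //; exact: cutoff_core_mem.
have [q qE] := section_exists lm cb tC Vx.
by exists q; exact: nu_map_section lm cb tC Vx q qE.
Qed.

(** [nu_mapP] identifies this value with a lift only for [i <= r]. In every degree, [nu_formula]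
    makes it locally a polynomial in lifts of index at most [r]. *)
Lemma nu_map_val_smooth i f : f \in_ i ->
  @diff_smooth R (subbundle_space W) setT (fun q => nu_val (nu_map q) i f).
Proof.
move=> Wf; apply: diff_smooth_local => q0 _.
have [p qp] := base_exists (proj1_sig q0); have [c [w [lm cp]]] := local_model_at W p.
have [b cb] := cutoff_exists openT (I : setT p) cp.
have [I [s [G GE]]] := nu_formula b lm Wf.
exists (subbundle_over (cutoff_core c b)), (fun q : subbundle_space W =>
  \sum_(k | (\sum_a s k a * w a)%N == i) (lift 0 (G k) (proj1_sig q) *
    \prod_a lift (w a) (Xc c b a) (proj1_sig q) ^+ s k a)); split.
- by apply: subbundle_over_open; exact: cutoff_core_open.
- by exists p; split=> //; exact: cutoff_core_mem.
- apply: diff_smooth_sum => k; apply: diff_smoothM.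
    by apply: diff_smooth_gen; exact: lift_generator.
  apply: diff_smooth_prod => a; apply: diff_smoothX; apply: diff_smooth_gen.
  by apply: lift_generator; exact: weight_le lm a.
- move=> q [p' [qp' cbp']] _; have [cp' _] := cbp'.
  rewrite (GE _ _ (nu_map_base qp') cp' (core_cutoff cb cbp')).
  apply: eq_bigr => k _; rewrite nu_mapP //; last exact: fil0S.
  congr (_ * _); apply: eq_bigr => a _; rewrite nu_mapP //.
    exact: weight_le lm a.
  exact: Xc_filT lm cb a.
Qed.

Lemma nu_map_smooth : @diff_smooth_map R (subbundle_space W) (nu_space W) setT nu_map.
Proof.
move=> _ [a ->]; have [P ->] := to_gr_surj a; have [[d sP] _] := rees_valP P.
apply: (@diff_smooth_ext _ (subbundle_space W) _ (fun q => \sum_(i < d)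
    nu_val (nu_map q) i (rcoef i P))) => [q _|].
  by rewrite /= (nu_gr _ sP); apply: eq_bigr => i _; rewrite rcoefE.
apply: diff_smooth_sum => i; apply: nu_map_val_smooth; exact: rcoef_fil.
Qed.

Lemma nu_map_submersion : @diff_submersion R (subbundle_space W) (nu_space W) nu_map.
Proof.
split; first exact: nu_map_smooth.
move=> q0; have [p qp] := base_exists (proj1_sig q0).
have [c [w [lm cp]]] := local_model_at W p; have [cc _ _] := lm.
have [b cb] := cutoff_exists openT (I : setT p) cp.
(* The curve of [q0] without its coefficients of t^(w a), for which the section substitutes the
   values xi_a of the character. *)
pose C a : {poly R} := sub_coord c b q0 a - (sub_coord c b q0 a)`_(w a) *: 'X^(w a).
have tC : transverse w C.
  move=> a j ja; rewrite coefB coefZ coefXn.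
  have [->|jw] := eqVneq j (w a); first by rewrite mulr1 subrr.
  by rewrite mulr0 subr0 (sub_coord_weight lm cb) // ltn_neqAle jw.
pose V := nu_over (cutoff_core c b).
have /choice[s sP] : forall x, exists q, V x -> forall f i, (i <= r)%N ->
    lift i f (proj1_sig q) = curve_coef c b (nu_curve_of c w b C x) i f.
  move=> x; have [Vx|nVx] := pselect (V x); last by exists q0.
  by have [q qE] := section_exists lm cb tC Vx; exists q.
have cbp : cutoff_core c b p by exact: cutoff_core_mem.
have V0 : V (nu_map q0) by exists p; split=> //; exact: nu_map_base.
exists V, s; split=> //.
- by apply: nu_over_open; exact: cutoff_core_open.
- move=> _ [_ [i [f [ir ->]]] ->].
  apply: (@diff_smooth_ext _ (nu_space W) _ (fun x =>
      taylor (pull c b f \o pcurve (perturb C w (\row_a nu_val x (w a) (Xc c b a)))) i)).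
    by move=> x Vx /=; rewrite -[RHS]/(lift i f (proj1_sig (s x))) sP.
  (* The lift along the section is a smooth function of the [n] generators xi_a. *)
  apply: (@diff_smooth_comp _ (nu_space W) V n (fun a x => nu_val x (w a) (Xc c b a))
    (fun y => taylor (pull c b f \o pcurve (perturb C w y)) i)).
    by move=> a; apply: diff_smooth_gen; apply: nu_val_generator; exact: Xc_filT lm cb a.
  apply: taylor_perturb_Cinf; apply: (pull_Cinf cc openT cb).
  exact: smooth_on_sub (smooth_fun_on f).
(* At [nu_map q0] the value xi_a is exactly the coefficient removed in [C], so the curve of [q0] is
   recovered and the section passes through [q0]. *)
- have CE : nu_curve_of c w b C (nu_map q0) = sub_coord c b q0.
    apply/funext => a; rewrite /nu_curve_of /perturb mxE nu_mapP; first last.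
    - exact: Xc_filT lm cb a.
    - exact: weight_le lm a.
    by rewrite -coef_sub_coord ?subrK //; exact: weight_le lm a.
  have sE f i : (i <= r)%N ->
      lift i f (proj1_sig (s (nu_map q0))) = lift i f (proj1_sig q0).
    by move=> ir; rewrite sP // CE (lift_sub_coord lm cb f qp cbp ir).
  apply: (subbundle_ext_local lm cb _ qp cbp) => [f|a i ir]; last exact: sE.
  by rewrite -[LHS]/(lift 0 f _) sE //; exact: qp.
- by move=> x /[1!inE] Vx; apply: (nu_map_section lm cb tC Vx); exact: sP.
Qed.

(** * Descent to the quotient *)

Local Open Scope quotient_scope.

Definition nu_quotient_map (z : subbundle_quotient W) : weighted_normal_bundle W :=
  nu_map (repr z).

Lemma nu_map_rel q1 q2 : (\pi_(subbundle_quotient W) q1 = \pi_(subbundle_quotient W) q2)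
  <-> nu_map q1 = nu_map q2.
Proof.
split=> [/eqmodP/asboolP H|E].
  by apply: nu_ext => i f ir Wf; rewrite !nu_mapP //; exact: H.
by apply/eqmodP/asboolP => i f ir Wf; rewrite -!nu_mapP // E.
Qed.

Lemma nu_quotient_map_pi q : nu_quotient_map (\pi_(subbundle_quotient W) q) = nu_map q.
Proof. by apply/nu_map_rel; rewrite reprK. Qed.

End Quotient.

Theorem theorem7p4 (R : realType) (n r : nat) (M : manifold R n)
    (W : weighting M r) (N : set M)
    (N_closed : closed_submanifold N) (W_along_N : weighting_along W N) :
  exists Phi : subbundle_quotient W -> weighted_normal_bundle W,
    [/\ is_canonical Phi /\
          (forall Psi : subbundle_quotient W -> weighted_normal_bundle W,
             is_canonical Psi -> Psi = Phi),
        bijective Phi,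
        (forall (t : R) (q : subbundle W),
           Phi (\pi_(subbundle_quotient W) (subbundle_dilate t q)) =
           nu_dilate t (Phi (\pi_(subbundle_quotient W) q))),
        @diff_quotient_structure R (subbundle_space W) (nu_space W)
          (fun q : subbundle W => Phi (\pi_(subbundle_quotient W) q)) &
        @diff_submersion R (subbundle_space W) (nu_space W)
          (fun q : subbundle W => Phi (\pi_(subbundle_quotient W) q))].
Proof.
exists (@nu_quotient_map R n r M W).
have mapE : (fun q : subbundle W => nu_quotient_map (\pi_(subbundle_quotient W) q)) =
    @nu_map R n r M W.
  by apply/funext => q; exact: nu_quotient_map_pi.
rewrite mapE; split.
- split=> [q i f Wf ir|Psi cPsi].
    by rewrite nu_quotient_map_pi -nu_valE nu_mapP.
  (* [is_canonical] prescribes values only in degrees at most [r]; by [nu_ext] these determine the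
     character. *)
  apply/funext => z; rewrite -[z]reprK nu_quotient_map_pi; apply: nu_ext => i f ir Wf.
  by rewrite (nu_valE _ Wf) cPsi // nu_mapP.
- exists (fun x => \pi_(subbundle_quotient W) (sval (cid (nu_map_surj x)))) => [z|x].
    by rewrite -[RHS]reprK; apply/nu_map_rel; case: cid.
  by rewrite nu_quotient_map_pi; case: cid.
- by move=> t q; rewrite !nu_quotient_map_pi nu_map_dilate.
- by apply: submersion_quotient; [exact: nu_map_submersion|exact: nu_map_surj].
- exact: nu_map_submersion.
Qed.
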